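(* Let $\varphi\in L^1_{\mathrm{loc}}[0,\infty)\cap L^2((0,\infty),(1\wedge x)dx)$. Let $\psi$ be the unique function in $L^1_{\mathrm{loc}}[0,\infty)$ for which there is $a>0$ with $e^{-ax}\psi(x)\in L^1(0,\infty)$ and $\mathcal{L}[\psi](z)=\mathcal{L}[\varphi](z)/(1-\mathcal{L}[\varphi](z))$ for all $\mathrm{Re}\, z\ge a$. Set $k(x,y)=\varphi(x+y)+\int_0^x\varphi(x+y-s)\psi(s)\,ds$ for $x,y>0$, define $K_t$ ($t\ge0$) on $L^2(0,\infty)$ by $$K_tf(x)=\int_0^\infty k(t-x,y)f(y)\,dy\ \ (x<t),\qquad K_tf(x)=0\ \ (x\ge t),$$ and let $T_t=S_t+K_t$. Then $\{T_t\}_{t\ge0}$ is a $C_0$-semigroup such that $T_t^*S_t=I$ and $T_t-S_t$ is a Hilbert–Schmidt operator for all $t\geq 0$. Let $M\in\mathcal{HD}_2$ be such that $A_M$ is the generator of $\{T_t\}_{t\geq 0}$, and let $q\in L^2(0,\infty)\setminus D(A)$ be the function satisfying $(1+z)\mathcal{L}[q](z)=M(z)$. Then $q$ is continuous at $0$ and $M(z)=q(0)(1-\mathcal{L}[\varphi](z))$. The relation between $\varphi$ and $q$ is given by $$q(x)=q(0)\Big(e^{-x}-\int_0^x\varphi(s)e^{s-x}\,ds\Big),\qquad \varphi=-\frac{q+q'}{q(0)}.$$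
   Context: $1\wedge x=\min\{1,x\}$. $L^1_{\mathrm{loc}}[0,\infty)$ is the set of measurable (complex) functions on $[0,\infty)$ integrable on every compact subset of $[0,\infty)$. $\mathcal L[f](z)=\int_0^\infty f(x)e^{-zx}dx$ is the Laplace transform. The existence and uniqueness of $\psi$ is known. $q$ is identified with its continuous representative when it has one. $\{S_t\}_{t\ge0}$ is the shift semigroup on $L^2(0,\infty)$: $(S_tf)(x)=0$ for $x<t$ and $(S_tf)(x)=f(x-t)$ for $x\ge t$. Its generator is $A$, $Af=-f'$, with $D(A)$ the set of locally absolutely continuous $f\in L^2(0,\infty)$ on $[0,\infty)$ with $f'\in L^2(0,\infty)$ and $f(0)=0$; its adjoint is $A^*f=f'$ with $D(A^* )$ the set of locally absolutely continuous $f\in L^2(0,\infty)$ on $[0,\infty)$ with $f'\in L^2(0,\infty)$. $(f,g)=\int_0^\infty f(x)g(x)\,dx$. $\mathcal{O}=\{p\in D(A^* ):\ p'\notin D(A)\}$. For $p\in\mathcal O$, $A_p$ has domain $D(A_p)=\{g\in D(A^* ):\ (g,p)+(g',p')=0\}$ and $A_pg=-g'$. For $\mathrm{Re}\, z>0$, $\mathcal{M}[p](z)=(1-z^2)\mathcal L[p](z)+p(0)z$. $\mathbb{H}_r=\{\mathrm{Re}\, z>0\}$; $H^2(\mathbb{H}_r)$ is the Hardy space of holomorphic $F$ on $\mathbb{H}_r$ with $\sup_{x>0}\int_{\mathbb R}|F(x+iy)|^2dy<\infty$. $\mathcal{HD}$ is the set of holomorphic $M$ on $\mathbb{H}_r$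 with $M(z)/(1+z)\in H^2(\mathbb{H}_r)$ and $M\notin H^2(\mathbb{H}_r)$. The map $p\mapsto\mathcal M[p]$ is a bijection from $\mathcal O$ onto $\mathcal{HD}$, and $q\mapsto(1+z)\mathcal L[q](z)$ is a bijection from $L^2(0,\infty)\setminus D(A)$ onto $\mathcal{HD}$. For $M=\mathcal M[p]$, $A_M:=A_p$. $\mathcal{HD}_2$ is the set of $M\in\mathcal{HD}$ such that $A_M$ generates a $C_0$-semigroup $\{T_t\}$ with $T_t^*S_t=I$ and $T_t-S_t$ Hilbert–Schmidt for all $t\ge0$. The generator of any $C_0$-semigroup satisfying $T_t^*S_t=I$ for all $t\ge 0$ is $A_M$ for some $M\in\mathcal{HD}$. *)

(* Defs.v *)
From mathcomp Require Import all_boot all_order all_algebra.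
From mathcomp Require Import all_classical all_reals all_analysis.
From mathcomp Require Export complex.

Set Implicit Arguments.
Unset Strict Implicit.
Unset Printing Implicit Defensive.

Import Order.TTheory GRing.Theory Num.Theory.
Import numFieldNormedType.Exports.

Local Open Scope classical_set_scope.
Local Open Scope ring_scope.
Local Open Scope complex_scope.

Section complex_functions.
Context {R : realType}.
Implicit Types (f g : R -> R[i]) (D : set R) (z : R[i]).

Local Notation mu := (@lebesgue_measure R).

Definition Ref f : R -> R := fun x => complex.Re (f x).
Definition Imf f : R -> R := fun x => complex.Im (f x).

Definition cmodulus z : R := Normc.normc z.

Definition cexp z : R[i] :=
  (expR (complex.Re z))%:C *
  (cos (complex.Im z) +i* sin (complex.Im z)).

Definition cmeasurable D f : Prop :=
  measurable_fun D (Ref f) /\ measurable_fun D (Imf f).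

Definition cintegrable D f : Prop :=
  mu.-integrable D (EFin \o Ref f) /\ mu.-integrable D (EFin \o Imf f).

(* Total: meaningful when [cintegrable D f]. *)
Definition cint D f : R[i] :=
  Rintegral mu D (Ref f) +i* Rintegral mu D (Imf f).

(* Derivative in the real variable, computed componentwise; it has a junk value
   wherever f is not differentiable. *)
Definition cderiv f : R -> R[i] :=
  fun x => derive1 (Ref f) x +i* derive1 (Imf f) x.

Definition cderivable f (x : R) : Prop :=
  derivable (Ref f) x 1 /\ derivable (Imf f) x 1.

Definition halfline : set R := `]0, +oo[.

(* An element of L^2(0,oo) is represented by a function R -> R[i], of which only
   the almost everywhere class on the open half-line matters. *)
Definition eqae f g : Prop := ae_eq mu halfline f g.

Definition L2norm f : \bar R :=
  'N[mu]_(2%:E) [EFin \o ((cmodulus \o f) \_ halfline)].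

Definition inL2 f : Prop := cmeasurable halfline f /\ (L2norm f < +oo)%E.

Definition L1loc f : Prop :=
  cmeasurable `[0, +oo[ f /\
  forall K : set R, compact K -> K `<=` `[0, +oo[ -> cintegrable K f.

(* Finiteness of the norm of L^2((0,oo), (1 /\ x) dx). *)
Definition finite_weighted_L2 f : Prop :=
  (\int[mu]_(x in halfline) ((cmodulus (f x)) ^+ 2 * Num.min 1 x)%:E < +oo)%E.

Definition laplace f z : R[i] :=
  cint halfline (fun x => f x * cexp (- (z * x%:C))).

(* The bilinear pairing (f, g), without conjugation. *)
Definition pairing f g : R[i] := cint halfline (fun x => f x * g x).

(* The Hilbert space inner product. *)
Definition inner f g : R[i] := cint halfline (fun x => f x * (g x)^*).

(* Absolute continuity on [a, b], over finite families of non-overlapping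
   intervals [u i, v i]. *)
Definition abs_continuous (a b : R) f : Prop :=
  forall e : R, 0 < e -> exists2 d : R, 0 < d &
    forall (n : nat) (u v : 'I_n -> R),
      (forall i, [/\ a <= u i, u i <= v i & v i <= b]) ->
      (forall i j, i != j -> v i <= u j \/ v j <= u i) ->
      \sum_(i < n) (v i - u i) < d ->
      \sum_(i < n) cmodulus (f (v i) - f (u i)) < e.

Definition locally_AC f : Prop := forall b : R, 0 < b -> abs_continuous 0 b f.

End complex_functions.

Section operators.
Context {R : realType}.

Local Notation fn := (R -> R[i]).

Implicit Types (B : fn -> fn) (T : R -> fn -> fn) (f g h : fn).

(* Bounded linear operators on L^2(0,oo), given by maps on representatives that
   respect equality almost everywhere. *)
Definition bounded_operator B : Prop :=
  [/\ forall f, inL2 f -> inL2 (B f),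
      forall f g, inL2 f -> inL2 g -> eqae f g -> eqae (B f) (B g),
      forall (a b : R[i]) f g, inL2 f -> inL2 g ->
        eqae (B (fun x => a * f x + b * g x))
             (fun x => a * B f x + b * B g x)
    & exists c : R, forall f, inL2 f -> (L2norm (B f) <= c%:E * L2norm f)%E].

Definition is_adjoint B B' : Prop :=
  bounded_operator B' /\
  forall f g, inL2 f -> inL2 g -> inner (B f) g = inner f (B' g).

Definition orthonormal_basis (e : nat -> fn) : Prop :=
  [/\ forall n, inL2 (e n),
      forall m n, inner (e m) (e n) = (m == n)%:R
    & forall f, inL2 f -> (forall n, inner f (e n) = 0) ->
        eqae f (fun=> 0)].

(* L^2(0,oo) is separable and infinite dimensional, so that its orthonormal bases
   are sequences. *)
Definition hilbert_schmidt B : Prop :=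
  bounded_operator B /\
  forall e : nat -> fn, orthonormal_basis e ->
    (\sum_(0 <= n <oo) (L2norm (B (e n))) ^+ 2 < +oo)%E.

Definition C0_semigroup T : Prop :=
  [/\ forall t, 0 <= t -> bounded_operator (T t),
      forall f, inL2 f -> eqae (T 0 f) f,
      forall s t f, 0 <= s -> 0 <= t -> inL2 f ->
        eqae (T (s + t) f) (T s (T t f))
    & forall f, inL2 f ->
        L2norm (fun x => T t f x - f x) @[t --> 0^'+] --> 0%E].

(* (f, h) belongs to the graph of the generator of T. *)
Definition generator_graph T f h : Prop :=
  L2norm (fun x => (t^-1)%:C * (T t f x - f x) - h x) @[t --> 0^'+] --> 0%E.

(* Unbounded operators are given by their graphs. *)
Definition is_generator (G : fn -> fn -> Prop) T : Prop :=
  forall f h, inL2 f -> inL2 h -> (generator_graph T f h <-> G f h).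

Definition shift_op (t : R) f : fn := fun x => if x < t then 0 else f (x - t).

Definition left_inverse_of_shift T : Prop :=
  forall t, 0 <= t -> exists2 T' : fn -> fn, is_adjoint (T t) T' &
    forall f, inL2 f -> eqae (T' (shift_op t f)) f.

Definition HS_perturbation_of_shift T : Prop :=
  forall t, 0 <= t -> hilbert_schmidt (fun f x => T t f x - shift_op t f x).

End operators.

Section generators.
Context {R : realType}.

Local Notation fn := (R -> R[i]).

Implicit Types (f g p : fn) (M F : R[i] -> R[i]).

(* Domains of A^* and A; their members are absolutely continuous representatives,
   so that values at 0 make sense. *)
Definition dom_Astar f : Prop :=
  [/\ locally_AC f, inL2 f & inL2 (cderiv f)].

Definition dom_A f : Prop := dom_Astar f /\ f 0 = 0.

Definition ae_in (D : fn -> Prop) f : Prop := exists2 g, D g & eqae f g.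

Definition calO p : Prop := dom_Astar p /\ ~ ae_in dom_A (cderiv p).

Definition dom_Ap p g : Prop :=
  dom_Astar g /\ pairing g p + pairing (cderiv g) (cderiv p) = 0.

Definition transM p (z : R[i]) : R[i] :=
  (1 - z ^+ 2) * laplace p z + p 0 * z.

Definition holomorphic_Hr F : Prop :=
  forall z : R[i], 0 < complex.Re z ->
    derivable (F : R[i]^o -> R[i]^o) z 1.

Definition hardy2 F : Prop :=
  holomorphic_Hr F /\
  (ereal_sup [set (\int[@lebesgue_measure R]_y
                     ((cmodulus (F (x +i* y))) ^+ 2)%:E)%E
             | x in [set x : R | (0 < x)%R]] < +oo)%E.

Definition HD M : Prop :=
  [/\ holomorphic_Hr M, hardy2 (fun z => M z / (1 + z)) & ~ hardy2 M].

(* Graph of A_M = A_p, where p in calO is determined by M = transM p. *)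
Definition graph_AM M f h : Prop :=
  exists p, [/\ calO p,
    forall z : R[i], 0 < complex.Re z -> M z = transM p z &
    exists g, [/\ dom_Ap p g, eqae f g & eqae h (fun x => - cderiv g x)]].

Definition HD2 M : Prop :=
  HD M /\
  exists T, [/\ C0_semigroup T, is_generator (graph_AM M) T,
                left_inverse_of_shift T & HS_perturbation_of_shift T].

End generators.

Section perturbation.
Context {R : realType}.
Implicit Types (phi psi f : R -> R[i]).

Definition is_psi phi psi : Prop :=
  L1loc psi /\
  exists a : R, [/\ 0 < a,
    cintegrable halfline (fun x => (expR (- (a * x)))%:C * psi x)
  & forall z : R[i], a <= complex.Re z ->
      1 - laplace phi z != 0 /\
      laplace psi z = laplace phi z / (1 - laplace phi z)].

Definition kernel_k phi psi (x y : R) : R[i] :=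
  phi (x + y) + cint `[0, x] (fun s => phi (x + y - s) * psi s).

Definition op_K phi psi (t : R) f : R -> R[i] := fun x =>
  if x < t then cint halfline (fun y => kernel_k phi psi (t - x) y * f y)
  else 0.

Definition op_T phi psi (t : R) f : R -> R[i] := fun x =>
  shift_op t f x + op_K phi psi t f x.

End perturbation.

(* Main.v *)
(* Extend functions on the half-line by 0 and let [w u = (T_t f) (t - u)], which does not
   depend on [t > u]. This response satisfies [w = F f + psi * F f], where
   [F f u = \int phi (u + y) f y dy]; equivalently, it is the only solution of the renewal
   equation [w = F f + phi * w] with an integrable exponential weight, because the Laplace
   transform of [w] is [L[F f] / (1 - L[phi])]. Since [u |-> w (u + t)] solves the equation
   with [T_t f] in place of [f], the [T_t] form a semigroup. Weighting [|phi (u + y)|^2] by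
   [e^{-a u}] shows that the kernels of the [K_t] are square-integrable, hence that the [K_t]
   are Hilbert-Schmidt and tend strongly to 0.

   For the generator, take [f x = M l' e^{-l x} - M l e^{-l' x}] with [l, l' > 0]: as
   [M = M[p]], it lies in the domain of [A_p], hence in that of the generator. Then [w] tends
   to [f 0] in mean at 0, while the renewal equation makes it tend to [\int phi f], so that
   [M l' (1 - L[phi] l) = M l (1 - L[phi] l')] and [M = c (1 - L[phi])] on the positive reals.
   By uniqueness of the Laplace transform [q x] is [c (e^{-x} - \int_0^x phi s e^{s - x} ds)]
   almost everywhere, and everything follows from this formula.

   That [f] is in the domain of [A_p] uses an integration by parts against the absolutely
   continuous [p], hence the fundamental theorem of calculus for such functions; it comes from
   the Radon-Nikodym theorem for the Stieltjes measure of the total variation. *)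
Require Import Defs.
From mathcomp Require Import all_boot all_order all_algebra.
From mathcomp Require Import all_classical all_reals all_analysis.
From mathcomp Require Import measurable_realfun ring lra.
Import Order.TTheory GRing.Theory Num.Theory.
Import numFieldNormedType.Exports.

Set Implicit Arguments.
Unset Strict Implicit.
Unset Printing Implicit Defensive.

Local Open Scope classical_set_scope.
Local Open Scope ring_scope.
Local Open Scope complex_scope.

(** * Complex-valued functions and their integrals *)

Arguments cmodulus : simpl never.
Arguments cint : simpl never.

Section complex_modulus.
Context {R : realType}.
Implicit Types z w : R[i].

(** An integration by parts shows that [g |-> (g, p) + (g', p')], the functional that cuts out the
    domain of [A_p], takes at [e^{-l x}] the value [(1 - l^2) L[p] l + l p(0) = M l]; the
    coefficients of the test function make the two values cancel. The obstacle is that [phi] need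
    not be square integrable near 0, so that the response [w] of a general [f] need not be bounded
    there: renewal identities are proved almost everywhere, and the limit of [w] at 0 is taken in
    mean. As [(T_t f) x = w (t - x)] for [0 < x < t], differentiability of the orbit makes the L^2
    norm of [u |-> w u - f (t - u) + t f' (t - u)] on [(0, t)] at most [t] for small [t], hence its
    L^1 norm at most [t^{3/2}]. The L^1 norm of [phi * w] on [(0, t)] is at most that of [phi] times
    that of [w], which is also [o(t)]. A constant whose integral over [(0, t)] is [o(t)] vanishes,
    so the two limits agree. The relation found on the positive reals reaches complex [z] without
    analytic continuation, since it identifies [q] itself. *)

Lemma cmodulusE z : cmodulus z = Num.sqrt (complex.Re z ^+ 2 + complex.Im z ^+ 2).
Proof. by case: z. Qed.

Lemma cmodulus_ge0 z : 0 <= cmodulus z.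
Proof. by rewrite cmodulusE sqrtr_ge0. Qed.

Lemma cmodulus_sqr z :
  cmodulus z ^+ 2 = complex.Re z ^+ 2 + complex.Im z ^+ 2.
Proof. by rewrite cmodulusE sqr_sqrtr// addr_ge0 ?sqr_ge0. Qed.

Lemma cmodulusM z w : cmodulus (z * w) = cmodulus z * cmodulus w.
Proof. exact: Normc.normcM. Qed.

Lemma cmodulusD z w : cmodulus (z + w) <= cmodulus z + cmodulus w.
Proof. exact: le_normcD. Qed.

Lemma cmodulusN z : cmodulus (- z) = cmodulus z.
Proof. exact: normcN. Qed.

Lemma cmodulus0 : cmodulus (0 : R[i]) = 0.
Proof. by rewrite cmodulusE /= expr0n addr0 sqrtr0. Qed.

Lemma cmodulus_eq0 z : cmodulus z = 0 -> z = 0.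
Proof. exact: Normc.eq0_normc. Qed.

Lemma cmodulusC (x : R) : cmodulus x%:C = `|x|.
Proof. by rewrite cmodulusE /= expr0n addr0 sqrtr_sqr. Qed.

Lemma cmodulus_conj z : cmodulus (conjc z) = cmodulus z.
Proof. by case: z => a b; rewrite !cmodulusE /= sqrrN. Qed.

Lemma Re_le_cmodulus z : `|complex.Re z| <= cmodulus z.
Proof. by rewrite cmodulusE -sqrtr_sqr ler_wsqrtr// lerDl sqr_ge0. Qed.

Lemma Im_le_cmodulus z : `|complex.Im z| <= cmodulus z.
Proof. by rewrite cmodulusE -sqrtr_sqr ler_wsqrtr// lerDr sqr_ge0. Qed.

Lemma cmodulus_le_ReIm z : cmodulus z <= `|complex.Re z| + `|complex.Im z|.
Proof.
rewrite -(@ler_pXn2r _ 2)// ?nnegrE ?addr_ge0 ?cmodulus_ge0//.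
rewrite cmodulus_sqr sqrrD !real_normK ?num_real// addrAC lerDl.
by rewrite mulrn_wge0// mulr_ge0.
Qed.

Lemma cmodulus_exp (x : R) : cmodulus (expR x)%:C = expR x.
Proof. by rewrite cmodulusC ger0_norm// expR_ge0. Qed.

Lemma ReM z w : complex.Re (z * w)
  = complex.Re z * complex.Re w - complex.Im z * complex.Im w.
Proof. by case: z; case: w. Qed.

Lemma ImM z w : complex.Im (z * w)
  = complex.Re z * complex.Im w + complex.Im z * complex.Re w.
Proof. by case: z; case: w. Qed.

Lemma ReD z w : complex.Re (z + w) = complex.Re z + complex.Re w.
Proof. by case: z; case: w. Qed.

Lemma ImD z w : complex.Im (z + w) = complex.Im z + complex.Im w.
Proof. by case: z; case: w. Qed.

Lemma ReN z : complex.Re (- z) = - complex.Re z.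
Proof. by case: z. Qed.

Lemma ImN z : complex.Im (- z) = - complex.Im z.
Proof. by case: z. Qed.

Lemma complex_ext z w :
  complex.Re z = complex.Re w -> complex.Im z = complex.Im w -> z = w.
Proof. by case: z => a b; case: w => c d /= -> ->. Qed.

Lemma cexpE (x : R) : cexp x%:C = (expR x)%:C.
Proof. by rewrite /cexp /= cos0 sin0 mulr1. Qed.

Lemma cexpD z w : cexp (z + w) = cexp z * cexp w.
Proof.
rewrite /cexp ReD ImD expRD cosD sinD.
by apply: complex_ext; rewrite !(ReM, ImM) /=; ring.
Qed.

Lemma cmodulus_cexp z : cmodulus (cexp z) = expR (complex.Re z).
Proof.
rewrite /cexp cmodulusM cmodulus_exp.
by rewrite [X in _ * X]cmodulusE /= cos2Dsin2 sqrtr1 mulr1.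
Qed.

End complex_modulus.

Section complex_measurability.
Context {R : realType}.

Definition cmeas d (T : measurableType d) (f : T -> R[i]) : Prop :=
  measurable_fun setT (fun x => complex.Re (f x)) /\
  measurable_fun setT (fun x => complex.Im (f x)).

Context d {T : measurableType d}.
Implicit Types f g : T -> R[i].

Lemma cmeas_cst (c : R[i]) : cmeas (fun _ : T => c).
Proof. by split; exact: measurable_cst. Qed.

Lemma cmeas_real (f : T -> R) : measurable_fun setT f ->
  cmeas (fun x => (f x)%:C).
Proof. by move=> mf; split => //=; exact: measurable_cst. Qed.

Lemma cmeasD f g : cmeas f -> cmeas g -> cmeas (fun x => f x + g x).
Proof.
move=> [f1 f2] [g1 g2]; split.
- by under eq_fun do rewrite ReD; exact: measurable_funD.
- by under eq_fun do rewrite ImD; exact: measurable_funD.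
Qed.

Lemma cmeasN f : cmeas f -> cmeas (fun x => - f x).
Proof.
move=> [f1 f2]; split.
- by under eq_fun do rewrite ReN; exact: measurableT_comp.
- by under eq_fun do rewrite ImN; exact: measurableT_comp.
Qed.

Lemma cmeasB f g : cmeas f -> cmeas g -> cmeas (fun x => f x - g x).
Proof. by move=> mf mg; apply: cmeasD => //; exact: cmeasN. Qed.

Lemma cmeasM f g : cmeas f -> cmeas g -> cmeas (fun x => f x * g x).
Proof.
move=> [f1 f2] [g1 g2]; split.
- by under eq_fun do rewrite ReM; apply: measurable_funB; exact: measurable_funM.
- by under eq_fun do rewrite ImM; apply: measurable_funD; exact: measurable_funM.
Qed.

Lemma cmeas_conj f : cmeas f -> cmeas (fun x => conjc (f x)).
Proof.
have Jc (z : R[i]) : conjc z = complex.Re z -i* complex.Im z by case: z.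
move=> [f1 f2]; split.
- by under eq_fun do rewrite Jc.
- by under eq_fun do rewrite Jc /=; exact: measurableT_comp.
Qed.

Lemma measurable_cmodulus f : cmeas f ->
  measurable_fun setT (fun x => cmodulus (f x)).
Proof.
move=> [f1 f2]; under eq_fun do rewrite cmodulusE.
apply: measurableT_comp; first exact: (continuous_measurable_fun (@sqrt_continuous R)).
by apply: measurable_funD; exact: measurable_funX.
Qed.

Lemma cmeas_if (b : T -> bool) f g : measurable_fun setT b -> cmeas f ->
  cmeas g -> cmeas (fun x => if b x then f x else g x).
Proof.
move=> mb [f1 f2] [g1 g2]; split.
- rewrite (_ : (fun x => _) =
    fun x => if b x then complex.Re (f x) else complex.Re (g x)).
    exact: measurable_fun_ifT.
  by apply/funext => x; case: (b x).
- rewrite (_ : (fun x => _) =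
    fun x => if b x then complex.Im (f x) else complex.Im (g x)).
    exact: measurable_fun_ifT.
  by apply/funext => x; case: (b x).
Qed.

Lemma cmeas_comp d' (T' : measurableType d') (h : T' -> T) f :
  measurable_fun setT h -> cmeas f -> cmeas (fun x => f (h x)).
Proof.
by move=> mh [f1 f2]; split; [exact: (measurableT_comp f1)|
  exact: (measurableT_comp f2)].
Qed.

Lemma cmeas_cexp f : cmeas f -> cmeas (fun x => cexp (f x)).
Proof.
move=> [f1 f2]; apply: cmeasM.
  apply: cmeas_real; exact: (measurableT_comp (@measurable_expR R)).
split => /=.
- exact: (measurableT_comp (@continuous_measurable_fun _ _ (@continuous_cos R))).
- exact: (measurableT_comp (@continuous_measurable_fun _ _ (@continuous_sin R))).
Qed.

Local Notation mu := (@lebesgue_measure R).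

(** Tonelli applies to the positive and negative parts separately; where a section is not
    integrable, [fine] yields a default value, still measurably in the parameter. *)
Lemma measurable_Rint_param (F : T * R -> R) : measurable_fun setT F ->
  measurable_fun setT (fun x => Rintegral mu setT (fun y => F (x, y))).
Proof.
move=> mF; apply: measurableT_comp => //.
have mF' : measurable_fun setT (EFin \o F) by exact/measurable_EFinP.
under eq_fun do rewrite integralE.
apply: emeasurable_funB.
- have mFp : measurable_fun setT (EFin \o F)^\+%E by exact: measurable_funepos.
  have := @measurable_fun_fubini_tonelli_F _ _ _ _ R mu _ mFp (fun=> funepos_ge0 _ _).
  congr (measurable_fun _ _); apply/funext => x; apply: eq_integral => y _.
  exact: esym (congr1 (fun g : R -> \bar R => g y) (funepos_comp (EFin \o F) (pair x))).
- have mFp : measurable_fun setT (EFin \o F)^\-%E by exact: measurable_funeneg.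
  have := @measurable_fun_fubini_tonelli_F _ _ _ _ R mu _ mFp (fun=> funeneg_ge0 _ _).
  congr (measurable_fun _ _); apply/funext => x; apply: eq_integral => y _.
  exact: esym (congr1 (fun g : R -> \bar R => g y) (funeneg_comp (EFin \o F) (pair x))).
Qed.

Lemma cmeas_cint_param (F : T * R -> R[i]) : cmeas F ->
  cmeas (fun x => cint setT (fun y => F (x, y))).
Proof. by move=> [F1 F2]; split; [exact: (measurable_Rint_param F1)|exact:
  (measurable_Rint_param F2)]. Qed.

End complex_measurability.

Section complex_integral.
Context {R : realType}.
Local Notation mu := (@lebesgue_measure R).
Implicit Types (f g : R -> R[i]) (D : set R).

(** Integrability is expressed through the modulus, so that domination, Tonelli and changes of
    variable act on one nonnegative function instead of two components. *)
Definition cL1 f : Prop :=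
  cmeas f /\ (\int[mu]_x (cmodulus (f x))%:E < +oo)%E.

Definition cres D f : R -> R[i] := fun x => if x \in D then f x else 0.

Lemma Ref_cres D f : Ref (cres D f) = Ref f \_ D.
Proof. by apply/funext => x; rewrite patchE /Ref /cres; case: ifP. Qed.

Lemma Imf_cres D f : Imf (cres D f) = Imf f \_ D.
Proof. by apply/funext => x; rewrite patchE /Imf /cres; case: ifP. Qed.

Lemma cint_cres D f : cint D f = cint setT (cres D f).
Proof.
by congr (_ +i* _); rewrite (Ref_cres, Imf_cres); exact: Rintegral_mkcond.
Qed.

Lemma cmeasurable_cres D f : measurable D ->
  cmeasurable D f <-> cmeas (cres D f).
Proof.
move=> mD; rewrite (_ : cmeas (cres D f) = cmeasurable setT (cres D f))//.
rewrite /cmeasurable Ref_cres Imf_cres.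
by split=> -[f1 f2]; split; apply/(measurable_restrictT _ mD).
Qed.

Lemma cL1P f : cL1 f <-> cintegrable setT f.
Proof.
split=> [[[f1 f2] fi]|[/integrableP[f1 i1] /integrableP[f2 i2]]].
- have ic : mu.-integrable setT (fun x => (cmodulus (f x))%:E).
    apply/integrableP; split.
      by apply/measurable_EFinP; exact: measurable_cmodulus.
    by under eq_integral do rewrite gee0_abs ?lee_fin ?cmodulus_ge0//.
  split; apply: le_integrable ic => //.
  + exact/measurable_EFinP.
  + by move=> x _; rewrite /= lee_fin [leRHS]ger0_norm ?cmodulus_ge0// Re_le_cmodulus.
  + exact/measurable_EFinP.
  + by move=> x _; rewrite /= lee_fin [leRHS]ger0_norm ?cmodulus_ge0// Im_le_cmodulus.
- have mf : cmeas f by split; exact/measurable_EFinP.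
  split => //.
  apply: (@le_lt_trans _ _ (\int[mu]_x (`|(EFin \o Ref f) x| + `|(EFin \o Imf f) x|))%E).
    apply: ge0_le_integral => //.
    + by move=> x _; rewrite lee_fin cmodulus_ge0.
    + by apply/measurable_EFinP; exact: measurable_cmodulus.
    + by apply: emeasurable_funD; exact: measurableT_comp.
    + by move=> x _; rewrite /= -EFinD lee_fin; exact: cmodulus_le_ReIm.
  rewrite ge0_integralD//; [exact: lte_add_pinfty| |]; exact: measurableT_comp.
Qed.

Lemma cintegrable_cres D f : measurable D ->
  cintegrable D f <-> cL1 (cres D f).
Proof.
move=> mD; rewrite cL1P /cintegrable Ref_cres Imf_cres -!restrict_EFin.
have H h := @integrable_mkcond _ _ _ mu D h mD.
by split=> -[f1 f2]; split; [exact: (H _).1|exact: (H _).1|exact: (H _).2|exact: (H _).2].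
Qed.

Lemma cL1_integrable f : cL1 f ->
  mu.-integrable setT (fun x => (cmodulus (f x))%:E).
Proof.
move=> [mf fi]; apply/integrableP; split.
  by apply/measurable_EFinP; exact: measurable_cmodulus.
by under eq_integral do rewrite gee0_abs ?lee_fin ?cmodulus_ge0//.
Qed.

Lemma le_cL1 f (h : R -> R) : cmeas f -> mu.-integrable setT (EFin \o h) ->
  (forall x, cmodulus (f x) <= h x) -> cL1 f.
Proof.
move=> mf /integrableP[mh hi] fh; split => //; apply: le_lt_trans hi.
apply: ge0_le_integral => //.
- by move=> x _; rewrite lee_fin cmodulus_ge0.
- by apply/measurable_EFinP; exact: measurable_cmodulus.
- exact: measurableT_comp.
- by move=> x _; rewrite /= lee_fin (le_trans (fh x))// ler_norm.
Qed.

Lemma cL1_le f g : cmeas f -> cL1 g ->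
  (forall x, cmodulus (f x) <= cmodulus (g x)) -> cL1 f.
Proof. by move=> mf /cL1_integrable; exact: le_cL1. Qed.

Lemma cL1D f g : cL1 f -> cL1 g -> cL1 (fun x => f x + g x).
Proof.
move=> Lf Lg; have [mf _] := Lf; have [mg _] := Lg.
apply: (@le_cL1 _ (fun x => cmodulus (f x) + cmodulus (g x))).
- exact: cmeasD.
- by apply: (integrableD _ (cL1_integrable Lf) (cL1_integrable Lg)).
- by move=> x; exact: cmodulusD.
Qed.

Lemma cL1Z (c : R[i]) f : cL1 f -> cL1 (fun x => c * f x).
Proof.
move=> Lf; have [mf _] := Lf.
apply: (@le_cL1 _ (fun x => cmodulus c * cmodulus (f x))).
- by apply: cmeasM => //; exact: cmeas_cst.
- exact: (integrableZl _ _ (cL1_integrable Lf)).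
- by move=> x; rewrite cmodulusM.
Qed.

Lemma cL1N f : cL1 f -> cL1 (fun x => - f x).
Proof.
move=> /(cL1Z (-1)); congr cL1.
by apply/funext => x; rewrite mulN1r.
Qed.

Lemma cL1B f g : cL1 f -> cL1 g -> cL1 (fun x => f x - g x).
Proof. by move=> Lf Lg; apply: cL1D => //; exact: cL1N. Qed.

Lemma cint0 D : cint D (fun=> 0 : R[i]) = 0.
Proof. by rewrite /cint /Rintegral /Ref /Imf !integral0. Qed.

Lemma cintD f g : cL1 f -> cL1 g ->
  cint setT (fun x => f x + g x) = cint setT f + cint setT g.
Proof.
move=> /cL1P[f1 f2] /cL1P[g1 g2]; apply: complex_ext; rewrite ?(ReD, ImD) /=.
- by rewrite -RintegralD//; apply: eq_Rintegral => x _; rewrite /Ref ReD.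
- by rewrite -RintegralD//; apply: eq_Rintegral => x _; rewrite /Imf ImD.
Qed.

Lemma cintZ (c : R[i]) f : cL1 f ->
  cint setT (fun x => c * f x) = c * cint setT f.
Proof.
move=> /cL1P[f1 f2].
have i1 (a : R) : mu.-integrable setT (fun x => (a * Ref f x)%:E) by exact: (integrableZl _ a f1).
have i2 (a : R) : mu.-integrable setT (fun x => (a * Imf f x)%:E) by exact: (integrableZl _ a f2).
apply: complex_ext; rewrite ?(ReM, ImM) /=.
- rewrite -RintegralZl// -RintegralZl// -RintegralB//; [|exact: i1|exact: i2].
  by apply: eq_Rintegral => x _; rewrite /Ref ReM.
- rewrite -RintegralZl// -RintegralZl// -RintegralD//; [|exact: i2|exact: i1].
  by apply: eq_Rintegral => x _; rewrite /Imf ImM.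
Qed.

Lemma cintN f : cL1 f -> cint setT (fun x => - f x) = - cint setT f.
Proof.
move=> Lf; rewrite -mulN1r -cintZ//; congr cint.
by apply/funext => x; rewrite mulN1r.
Qed.

Lemma cintB f g : cL1 f -> cL1 g ->
  cint setT (fun x => f x - g x) = cint setT f - cint setT g.
Proof. by move=> Lf Lg; rewrite cintD ?cintN//; exact: cL1N. Qed.

(** Bounding the components separately would lose a constant. Instead the integral [I] is rotated
    onto the real axis: [|I|^2] is the real part of the integral of [conjc I * f], which is at most
    [|I|] times the integral of [|f|]. *)
Lemma le_cmodulus_cint f : cL1 f ->
  ((cmodulus (cint setT f))%:E <= \int[mu]_x (cmodulus (f x))%:E)%E.
Proof.
move=> Lf; set I := cint setT f; have [mf fi] := Lf.
have ic := cL1_integrable Lf.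
have B_fin : (\int[mu]_x (cmodulus (f x))%:E)%E \is a fin_num.
  exact: integrable_fin_num.
rewrite -(fineK B_fin) lee_fin -/(Rintegral mu setT (fun x => cmodulus (f x))).
have [->|I0] := eqVneq (cmodulus I) 0.
  by apply: Rintegral_ge0 => x _; exact: cmodulus_ge0.
have I_gt0 : 0 < cmodulus I by rewrite lt_def I0 cmodulus_ge0.
have key (c : R[i]) : complex.Re (c * I) <=
    cmodulus c * Rintegral mu setT (fun x => cmodulus (f x)).
  rewrite /I -cintZ// -RintegralZl//.
  have /cL1P[i1 _] := cL1Z c Lf.
  apply: le_Rintegral => //; first exact: (integrableZl _ _ ic).
  move=> x _; rewrite /Ref (le_trans (ler_norm _))// (le_trans (Re_le_cmodulus _))//.
  by rewrite cmodulusM.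
have -> : cmodulus I = (cmodulus I)^-1 * complex.Re (conjc I * I).
  rewrite (_ : complex.Re (conjc I * I) = cmodulus I ^+ 2).
    by rewrite expr2 mulKf.
  by rewrite cmodulus_sqr ReM; case: (I) => a b /=; ring.
by rewrite mulrC ler_pdivrMr// (le_trans (key _))// cmodulus_conj mulrC.
Qed.

Lemma ae_imply (P Q : R -> Prop) : (forall x, P x -> Q x) ->
  {ae mu, forall x, P x} -> {ae mu, forall x, Q x}.
Proof. by move=> PQ; apply: filterS => //; exact: (ae_filter_ringOfSetsType mu). Qed.

Lemma ae_imply2 (P Q S : R -> Prop) : (forall x, P x -> Q x -> S x) ->
  {ae mu, forall x, P x} -> {ae mu, forall x, Q x} -> {ae mu, forall x, S x}.
Proof. by move=> PQ; apply: filterS2 => //; exact: (ae_filter_ringOfSetsType mu). Qed.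

Lemma aeW (P : R -> Prop) : (forall x, P x) -> {ae mu, forall x, P x}.
Proof. by move=> aP; exact: aeW. Qed.

Lemma eq_ae_cint f g : cmeas f -> cmeas g ->
  {ae mu, forall x, f x = g x} -> cint setT f = cint setT g.
Proof.
move=> [f1 f2] [g1 g2] fg; rewrite /cint /Rintegral.
congr (fine _ +i* fine _); apply: ae_eq_integral => //; try exact/measurable_EFinP.
- by apply: ae_imply fg => x fgx _; rewrite /Ref fgx.
- by apply: ae_imply fg => x fgx _; rewrite /Imf fgx.
Qed.

Lemma eq_ae_cL1 f g : cmeas g -> {ae mu, forall x, f x = g x} -> cL1 f -> cL1 g.
Proof.
move=> mg fg [mf fi]; split => //.
rewrite (_ : (\int[mu]_x _)%E = (\int[mu]_x (cmodulus (f x))%:E)%E)//.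
apply: ae_eq_integral => //; try by apply/measurable_EFinP; exact: measurable_cmodulus.
by apply: ae_imply fg => x fgx _; rewrite fgx.
Qed.

End complex_integral.

Section complex_Fubini.
Context {R : realType}.
Local Notation mu := (@lebesgue_measure R).

Lemma measurable_pair_swap d1 d2 (T1 : measurableType d1) (T2 : measurableType d2) :
  measurable_fun setT (fun p : T1 * T2 => (p.2, p.1)).
Proof. by apply: measurable_fun_pair. Qed.

(** The inner real integral, taken with [fine], agrees with the extended one only where the section
    is integrable, that is for almost every [x]. *)
Lemma Rintegral_Fubini (G : R * R -> R) :
  (mu \x mu)%E.-integrable setT (EFin \o G) ->
  Rintegral mu setT (fun x => Rintegral mu setT (fun y => G (x, y))) =
  fine (\int[mu]_x \int[mu]_y (G (x, y))%:E).
Proof.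
move=> iG; have mG : measurable_fun setT G.
  by apply/measurable_EFinP; exact: (measurable_int _ iG).
rewrite /Rintegral; congr fine; apply: ae_eq_integral => //.
- by apply/measurable_EFinP; exact: measurable_Rint_param.
- exact: (measurable_fubini_F iG).
- apply: ae_imply (ae_integrable1 iG) => x ix _.
  by rewrite fineK//; exact: integrable_fin_num ix.
Qed.

Variable F : R * R -> R[i].
Hypothesis mF : cmeas F.
Hypothesis iF : (\int[mu]_x \int[mu]_y (cmodulus (F (x, y)))%:E < +oo)%E.

Let icF : (mu \x mu)%E.-integrable setT (fun p => (cmodulus (F p))%:E).
Proof.
have mE : measurable_fun setT (fun p => (cmodulus (F p))%:E).
  by apply/measurable_EFinP; exact: measurable_cmodulus.
apply: (@integrable12ltyP _ _ _ _ _ mu mu _ mE).2.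
by under eq_integral do under eq_integral do
  rewrite gee0_abs ?lee_fin ?cmodulus_ge0//.
Qed.

Let iRe : (mu \x mu)%E.-integrable setT (EFin \o (fun p => complex.Re (F p))).
Proof.
apply: le_integrable icF => //; first by apply/measurable_EFinP; case: mF.
by move=> x _; rewrite /= lee_fin [leRHS]ger0_norm ?cmodulus_ge0// Re_le_cmodulus.
Qed.

Let iIm : (mu \x mu)%E.-integrable setT (EFin \o (fun p => complex.Im (F p))).
Proof.
apply: le_integrable icF => //; first by apply/measurable_EFinP; case: mF.
by move=> x _; rewrite /= lee_fin [leRHS]ger0_norm ?cmodulus_ge0// Im_le_cmodulus.
Qed.

Lemma ae_cL1_section : {ae mu, forall x, cL1 (fun y => F (x, y))}.
Proof.
apply: ae_imply2 (ae_integrable1 iRe) (ae_integrable1 iIm) => x i1 i2.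
exact/cL1P.
Qed.

Lemma cL1_cint_section : cL1 (fun x => cint setT (fun y => F (x, y))).
Proof.
split; first exact: cmeas_cint_param.
apply: le_lt_trans iF; apply: ae_ge0_le_integral => //.
- by move=> x _; rewrite lee_fin cmodulus_ge0.
- by apply/measurable_EFinP/measurable_cmodulus; exact: cmeas_cint_param.
- by move=> x _; apply: integral_ge0 => y _; rewrite lee_fin cmodulus_ge0.
- have mE : measurable_fun setT (fun p => (cmodulus (F p))%:E).
  by apply/measurable_EFinP; exact: measurable_cmodulus.
  apply: (@measurable_fun_fubini_tonelli_F _ _ _ _ R mu _ mE) => p.
  by rewrite lee_fin cmodulus_ge0.
- by apply: ae_imply ae_cL1_section => x Lx _; exact: le_cmodulus_cint.
Qed.

Lemma cint_Fubini :
  cint setT (fun x => cint setT (fun y => F (x, y))) =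
  cint setT (fun y => cint setT (fun x => F (x, y))).
Proof.
have swap (G : R * R -> R) : (mu \x mu)%E.-integrable setT (EFin \o G) ->
    Rintegral mu setT (fun x => Rintegral mu setT (fun y => G (x, y))) =
    Rintegral mu setT (fun y => Rintegral mu setT (fun x => G (x, y))).
  move=> iG; have mG : measurable_fun setT (EFin \o G) := measurable_int _ iG.
  rewrite Rintegral_Fubini// (Fubini iG); apply/esym.
  apply: (Rintegral_Fubini (G := fun p => G (p.2, p.1))).
  have mG' : measurable_fun setT (fun p : R * R => (EFin \o G) (p.2, p.1)).
    exact: (measurableT_comp mG (@measurable_pair_swap _ _ _ _)).
  apply: (@integrable12ltyP _ _ _ _ _ mu mu _ mG').2 => /=.
  exact: (@integrable21ltyP _ _ _ _ _ mu mu _ mG).1 iG.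
by have /= := swap _ iRe; have /= := swap _ iIm; rewrite /cint /Ref /Imf /= => -> ->.
Qed.

End complex_Fubini.

Section complex_Tonelli.
Context {R : realType}.
Local Notation mu := (@lebesgue_measure R).

Lemma Tonelli_cmodulus (F : R * R -> R[i]) : cmeas F ->
  (\int[mu]_x \int[mu]_y (cmodulus (F (x, y)))%:E =
   \int[mu]_y \int[mu]_x (cmodulus (F (x, y)))%:E)%E.
Proof.
move=> mF; apply: (@fubini_tonelli _ _ _ _ R mu mu (fun p => (cmodulus (F p))%:E)).
  by apply/measurable_EFinP; exact: measurable_cmodulus.
by move=> x; rewrite lee_fin cmodulus_ge0.
Qed.

End complex_Tonelli.

Section isometries_of_the_line.
Context {R : realType}.
Local Notation mu := (@lebesgue_measure R).

Let isometric (h : R -> R) := measurable_fun setT (h : _ -> measurableTypeR R) /\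
  forall a b, mu (h @^-1` `]a, b]) = mu `]a, b].

(** The pushforward of the Lebesgue measure under [h] agrees with it on half-open intervals, hence
    is the Lebesgue measure. *)
Let ge0_integral_isometric (h : R -> R) (f : R -> \bar R) : isometric h ->
  measurable_fun setT f -> (forall x, 0 <= f x)%E ->
  (\int[mu]_x f (h x) = \int[mu]_x f x)%E.
Proof.
move=> [mh hE] mf f0.
have := @ge0_integral_pushforward _ _ (measurableTypeR R) (measurableTypeR R) R h mh mu setT f.
rewrite preimage_setT => <-//.
apply: eq_measure_integral => A mA _.
apply/esym/lebesgue_measure_unique => //= _ [[a b]] _ <-.
by rewrite /pushforward hE.
Qed.

Let isometric_shift c : isometric (fun x => x + c).
Proof.
split; first exact: measurable_funD.
move=> a b; rewrite (_ : _ @^-1` _ = `]a - c, b - c]%classic); last first.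
  by apply/seteqP; split=> x /=; rewrite !in_itv/= ltrBlDr lerBrDr.
by rewrite !lebesgue_measure_itv/= !lte_fin ltrD2r -!EFinD opprB addrA subrK.
Qed.

Let isometric_reflect c : isometric (fun x => c - x).
Proof.
split; first exact: measurable_funB.
move=> a b; rewrite (_ : _ @^-1` _ = `[c - b, c - a[%classic); last first.
  apply/seteqP; split=> x /=; rewrite !in_itv/= => /andP[h1 h2]; apply/andP; split; lra.
rewrite !lebesgue_measure_itv/= !lte_fin ltrD2l ltrN2 -!EFinD.
by case: ifP => // _; congr EFin; ring.
Qed.

Lemma ge0_integral_shift (f : R -> \bar R) c : measurable_fun setT f ->
  (forall x, 0 <= f x)%E -> (\int[mu]_x f (x + c)%R = \int[mu]_x f x)%E.
Proof. exact: ge0_integral_isometric (isometric_shift c). Qed.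

Lemma ge0_integral_reflect (f : R -> \bar R) c : measurable_fun setT f ->
  (forall x, 0 <= f x)%E -> (\int[mu]_x f (c - x)%R = \int[mu]_x f x)%E.
Proof. exact: ge0_integral_isometric (isometric_reflect c). Qed.

Let cint_isometric (h : R -> R) (f : R -> R[i]) : isometric h ->
  cmeas f -> cint setT (fun x => f (h x)) = cint setT f.
Proof.
move=> ih [f1 f2].
have Rint (g : R -> R) : measurable_fun setT g ->
    Rintegral mu setT (fun x => g (h x)) = Rintegral mu setT g.
  move=> mg; have mg' : measurable_fun setT (EFin \o g) by exact/measurable_EFinP.
  rewrite /Rintegral integralE [in RHS]integralE; congr (fine (_ - _))%E.
  - rewrite -(ge0_integral_isometric ih (measurable_funepos mg'))//.
    by apply: eq_integral => x _; rewrite (funepos_comp (EFin \o g) h).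
  - rewrite -(ge0_integral_isometric ih (measurable_funeneg mg'))//.
    by apply: eq_integral => x _; rewrite (funeneg_comp (EFin \o g) h).
by rewrite /cint /Ref /Imf (Rint _ f1) (Rint _ f2).
Qed.

Lemma cint_shift (f : R -> R[i]) c : cmeas f ->
  cint setT (fun x => f (x + c)) = cint setT f.
Proof. exact: cint_isometric (isometric_shift c). Qed.

Lemma cint_reflect (f : R -> R[i]) c : cmeas f ->
  cint setT (fun x => f (c - x)) = cint setT f.
Proof. exact: cint_isometric (isometric_reflect c). Qed.

Lemma cL1_shift (f : R -> R[i]) c : cL1 f -> cL1 (fun x => f (x + c)).
Proof.
move=> [mf fi]; split.
  by apply: cmeas_comp => //; exact: measurable_funD.
rewrite (ge0_integral_shift (f := fun x => (cmodulus (f x))%:E))//.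
- by apply/measurable_EFinP; exact: measurable_cmodulus.
- by move=> x; rewrite lee_fin cmodulus_ge0.
Qed.

Lemma cL1_reflect (f : R -> R[i]) c : cL1 f -> cL1 (fun x => f (c - x)).
Proof.
move=> [mf fi]; split.
  by apply: cmeas_comp => //; exact: measurable_funB.
rewrite (ge0_integral_reflect (f := fun x => (cmodulus (f x))%:E))//.
- by apply/measurable_EFinP; exact: measurable_cmodulus.
- by move=> x; rewrite lee_fin cmodulus_ge0.
Qed.

Let ae_isometric (h : R -> R) (P : R -> Prop) : isometric h ->
  {ae mu, forall x, P x} -> {ae mu, forall x, P (h x)}.
Proof.
move=> [mh hE] [N [mN N0 PN]]; exists (h @^-1` N); split.
- by rewrite -[X in measurable X]setTI; exact: mh.
- rewrite -N0; apply/esym.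
  have := @lebesgue_measure_unique R (pushforward mu (h : measurableTypeR R -> measurableTypeR R)).
  by move=> /(_ mh) -> // _ [[a b]] _ <-; exact/esym/hE.
- by move=> x /= nPx; apply: PN.
Qed.

Lemma ae_shift (P : R -> Prop) c :
  {ae mu, forall x, P x} -> {ae mu, forall x, P (x + c)}.
Proof. exact: ae_isometric (isometric_shift c). Qed.

Lemma ae_reflect (P : R -> Prop) c :
  {ae mu, forall x, P x} -> {ae mu, forall x, P (c - x)}.
Proof. exact: ae_isometric (isometric_reflect c). Qed.

End isometries_of_the_line.

(** * Laplace transform and convolution *)

Section Laplace_uniqueness.
Context {R : realType}.
Local Notation mu := (@lebesgue_measure R).

Lemma norm_exp_series_le (y : R) N : `|series (exp_coeff y) N| <= expR `|y|.
Proof.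
rewrite /series /=; apply: le_trans (ler_norm_sum _ _ _) _.
rewrite (_ : \sum_(0 <= i < N) _ = series (exp_coeff `|y|) N).
  apply: nondecreasing_cvgn_le; last exact: is_cvg_series_exp_coeff.
  apply/nondecreasing_series => n _.
  by rewrite /exp_coeff /= divr_ge0 ?exprn_ge0// ler0n.
rewrite /series /=; apply: eq_bigr => i _.
by rewrite /exp_coeff /= normrM normrX normfV [`|_%:R|]ger0_norm// ler0n.
Qed.

Lemma measurable_mull (c : R) : measurable_fun setT (fun x => c * x).
Proof. exact: (@measurable_funM _ _ _ setT (cst c) id). Qed.

Variable h : R -> R.
Hypothesis ih : mu.-integrable setT (EFin \o h).
Hypothesis h0 : forall x, x <= 0 -> h x = 0.
Hypothesis laplace_h : forall l, 0 <= l ->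
  Rintegral mu setT (fun x => expR (- (l * x)) * h x) = 0.

Let mh : measurable_fun setT h.
Proof. by apply/measurable_EFinP; exact: (measurable_int _ ih). Qed.

Let ih_exp l : 0 <= l ->
  mu.-integrable setT (fun x => (expR (- (l * x)) * h x)%:E).
Proof.
move=> l0; apply: le_integrable ih => //.
  apply/measurable_EFinP; apply: measurable_funM => //.
  under eq_fun do rewrite -mulNr.
  exact: (measurableT_comp (@measurable_expR R) (measurable_mull (- l))).
move=> x _; rewrite /= lee_fin; have [x0|x0] := leP x 0.
  by rewrite h0// mulr0.
rewrite normrM ger0_norm ?expR_ge0// ler_piMl// -expR0 ler_expR oppr_le0.
by rewrite mulr_ge0// ltW.
Qed.

(** As [c] grows this double exponential tends to the indicator of []t, +oo[], except at [x = t]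
    where it stays [e^{-1}]. *)
Let smooth_step (c t x : R) := expR (- expR (c * (t - x))).

Let measurable_smooth_step c t : measurable_fun setT (smooth_step c t).
Proof.
apply: measurableT_comp => //; apply: measurableT_comp => //.
apply: measurableT_comp => //; apply: (measurableT_comp (measurable_mull c)).
exact: measurable_funB.
Qed.

(* The exponential series turns the double exponential into a combination of the
   exponentials [e^{- k c x}], against which [h] vanishes. *)
Let integral_smooth_step (c t : R) : 0 <= c ->
  (\int[mu]_x (smooth_step c t x * h x)%:E = 0)%E.
Proof.
move=> c0.
(* Chosen so that [(- e^{c (t - x)})^k / k! = a k * e^{- k c x}]: the terms of the exponential
   series are multiples of exponentials at the nonnegative points [k c]. *)
pose a k := (-1) ^+ k * expR (k%:R * c * t) / k`!%:R : R.
pose f_ N x := (\sum_(0 <= k < N) a k * (expR (- (k%:R * c * x)) * h x))%:E.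
have f_E N x : f_ N x = (series (exp_coeff (- expR (c * (t - x)))) N * h x)%:E.
  rewrite /f_ /series /= mulr_suml; congr EFin; apply: eq_bigr => k _.
  rewrite /a /exp_coeff /= mulrA; congr (_ * _).
  rewrite mulrAC [in RHS]exprNn -expRM_natl.
  rewrite -(mulrA _ (expR _) (expR _)) -expRD; congr (_ * expR _ / _).
  ring.
have kc0 k : 0 <= k%:R * c by rewrite mulr_ge0.
have ia k : mu.-integrable setT
    (fun x => (a k * (expR (- (k%:R * c * x)) * h x))%:E).
  exact: (integrableZl _ (a k) (ih_exp (kc0 k))).
have if_ N : mu.-integrable setT (f_ N).
  rewrite /f_; elim: N => [|N IHN].
    by under eq_fun do rewrite big_nil; exact: integrable0.
  under eq_fun do rewrite big_nat_recr//= EFinD.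
  exact: integrableD.
have int_f_ N : (\int[mu]_x f_ N x = 0)%E.
  elim: N => [|N IHN].
    by rewrite /f_; under eq_integral do rewrite big_nil; rewrite integral0.
  rewrite /f_; under eq_integral do rewrite big_nat_recr//= EFinD.
  rewrite integralD//; last by have := if_ N; rewrite /f_.
  rewrite [X in (X + _)%E]IHN add0e.
  under eq_integral do rewrite EFinM.
  rewrite (integralZl _ (ih_exp (kc0 N)))//.
  have -> : (\int[mu]_x (expR (- (N%:R * c * x)) * h x)%:E = 0)%E.
    rewrite -[LHS]fineK; last exact: integrable_fin_num (ih_exp (kc0 N)).
    by rewrite -[X in X%:E]/(Rintegral _ _ _) laplace_h.
  by rewrite mule0.
have [|||||_ _] := @dominated_convergence _ _ _ mu setT measurableT f_
    (fun x => (smooth_step c t x * h x)%:E)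
    (fun x => (expR (expR (c * t)) * `|h x|)%:E).
- by move=> n; exact: (measurable_int _ (if_ n)).
- apply/measurable_EFinP.
  exact: (measurable_funM (measurable_smooth_step _ _) mh).
- apply: aeW => x _; under eq_fun do rewrite f_E.
  apply: cvg_EFin; first by near=> n.
  apply: cvgM; last exact: cvg_cst.
  exact: is_cvg_series_exp_coeff.
- exact: (integrableZl _ (expR (expR (c * t))) (integrable_abse ih)).
- apply: aeW => x n _; rewrite f_E lee_fin normrM.
  (* For [x > 0] the partial sums are at most [exp (e^{c (t - x)})], which is below the constant
     [exp (e^{c t})]. *)
  have [x0|x0] := leP x 0; first by rewrite h0// normr0 !mulr0.
  rewrite ler_wpM2r//; apply: le_trans (norm_exp_series_le _ _) _.
  rewrite ler_expR normrN ger0_norm ?expR_ge0// ler_expR.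
  by rewrite ler_wpM2l// lerBlDr lerDl ltW.
rewrite (_ : (fun n => _) = fun=> 0%E); last first.
  by apply/funext => n; exact: int_f_.
by move=> /(cvg_unique _ (cvg_cst _)) <-.
Unshelve. all: by end_near. Qed.

Let integral_tail t : (\int[mu]_(x in `]t, +oo[) (h x)%:E = 0)%E.
Proof.
pose g x := if t < x then h x else if x < t then 0 else expR (- 1) * h x.
have mg : measurable_fun setT g.
  apply: measurable_fun_ifT => //; first exact: measurable_fun_ltr.
  apply: measurable_fun_ifT => //; first exact: measurable_fun_ltr.
  exact: measurable_funM.
have [|||||_ _] := @dominated_convergence _ _ _ mu setT measurableT
    (fun n x => (smooth_step n%:R t x * h x)%:E) (EFin \o g) (abse \o (EFin \o h)).
- move=> n; apply/measurable_EFinP.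
  exact: (measurable_funM (measurable_smooth_step _ _) mh).
- exact/measurable_EFinP.
- apply: aeW => x _; apply: cvg_EFin; first by near=> n.
  have scale_cvg (c : R) : 0 < c -> n%:R * c @[n --> \oo] --> +oo.
    move=> c0; apply/cvgryPge => A; near=> n; rewrite -ler_pdivrMr//.
    by near: n; exact: nbhs_infty_ger.
  rewrite /g /smooth_step; have [tx|xt|->] := ltgtP t x.
  + have e0 : n%:R * (x - t) @[n --> \oo] --> +oo by apply: scale_cvg; rewrite subr_gt0.
    have e1 : expR (n%:R * (t - x)) @[n --> \oo] --> 0.
      under eq_fun do rewrite -opprB mulrN.
      exact: (cvg_comp _ _ e0 (@cvgr_expR R)).
    have e2 : expR (- expR (n%:R * (t - x))) @[n --> \oo] --> expR (- (0 : R)).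
      exact: (cvg_comp _ _ (cvgN e1) (@continuous_expR R (- 0))).
    have := cvgM e2 (cvg_cst (h x)).
    by rewrite oppr0 expR0 mul1r; apply.
  + rewrite -[X in _ --> X](mul0r (h x)); apply: cvgM; last exact: cvg_cst.
    apply: (@cvg_comp _ _ _ _ (fun y => expR (- y)) _ +oo); last exact: cvgr_expR.
    have := scale_cvg (t - x); rewrite subr_gt0 => /(_ xt).
    apply: ger_cvgy; near=> n.
    by apply: le_trans (expR_ge1Dx _); rewrite lerDr.
  + by under eq_fun do rewrite subrr mulr0 expR0; exact: cvg_cst.
- exact: integrable_abse.
- apply: aeW => x n _; rewrite /= lee_fin normrM ler_piMl//.
  by rewrite ger0_norm ?expR_ge0// -expR0 ler_expR oppr_le0 expR_ge0.
rewrite (_ : (fun n => _) = fun=> 0%E); last first.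
  by apply/funext => n; rewrite integral_smooth_step.
move=> /(cvg_unique _ (cvg_cst _)) -> //.
rewrite [LHS]integral_mkcond.
apply: (@ae_eq_integral _ _ _ mu setT _ _ measurableT).
- apply/(measurable_restrictT _ (measurable_itv _)).
  by apply/measurable_EFinP; exact: measurable_funTS.
- exact/measurable_EFinP.
- exists [set t]; split => //; first exact: lebesgue_measure_set1.
  move=> x /= gx; apply: contrapT => /eqP xt; apply: gx => _.
  rewrite patchE /g; case: ltgtP xt => // tx _.
  + by rewrite mem_set//= in_itv/= andbT.
  + by rewrite memNset//= in_itv/= andbT => /(lt_trans tx); rewrite ltxx.
Unshelve. all: by end_near. Qed.

(** The tails of [h] have integral 0, and so has [h] over the line, by the case [l = 0]. Hence its
    primitive from [-oo] is 0, while the derivative of that primitive is [h] almost everywhere. *)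
Lemma Laplace_injective_real : {ae mu, forall x, h x = 0}.
Proof.
have iS y : mu.-integrable `]-oo, y] (EFin \o h).
  exact: integrableS ih.
have lh : locally_integrable setT h.
  by apply: open_integrable_locally => //; exact: openT.
have := FTC1Ny iS lh.
apply: ae_imply => x [_ <-].
rewrite (_ : (fun x => _) = cst 0) ?derive1_cst//.
apply/funext => y; rewrite /= /Rintegral.
have int0 : (\int[mu]_x (EFin \o h) x = 0)%E.
  rewrite -[LHS]fineK; last exact: integrable_fin_num ih.
  congr EFin; rewrite -(laplace_h (lexx 0)); congr fine.
  by apply: eq_integral => z _ /=; rewrite mul0r oppr0 expR0 mul1r.
have : (\int[mu]_(x in `]-oo, y] `|` `]y, +oo[) (EFin \o h) x = 0)%E.
  rewrite (_ : _ `|` _ = setT)//.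
  by rewrite -setCitvr setUC setUCr.
rewrite integral_setU//=; last 2 first.
- by apply/measurable_EFinP; exact: measurable_funTS.
- by rewrite -setCitvr disj_set2E setICl eqxx.
by rewrite integral_tail adde0 => ->.
Qed.

End Laplace_uniqueness.

Section exponential_kernel.
Context {R : realType}.
Implicit Types (z : R[i]) (x y : R).

Definition expz z x : R[i] := cexp (- (z * x%:C)).

Lemma expzD z x y : expz z (x + y) = expz z x * expz z y.
Proof. by rewrite /expz -cexpD; congr cexp; rewrite rmorphD/= mulrDr opprD. Qed.

Lemma cmodulus_expz z x : cmodulus (expz z x) = expR (- (complex.Re z * x)).
Proof. by rewrite cmodulus_cexp ReN ReM /= mulr0 subr0. Qed.

Lemma expz_neq0 z x : expz z x != 0.
Proof.
apply/eqP => e0; have := cmodulus_expz z x.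
by rewrite e0 cmodulus0 => /esym/eqP; rewrite expR_eq0.
Qed.

Lemma expz_real (a x : R) : expz a%:C x = (expR (- (a * x)))%:C.
Proof. by rewrite /expz -rmorphM -rmorphN cexpE. Qed.

Lemma cmeas_expz z : cmeas (expz z).
Proof.
apply: cmeas_cexp; apply: cmeasN; apply: cmeasM; first exact: cmeas_cst.
by apply: cmeas_real; exact: measurable_id.
Qed.

End exponential_kernel.

Section half_line.
Context {R : realType}.
Local Notation mu := (@lebesgue_measure R).
Implicit Types (f g : R -> R[i]).

(* Functions on the half-line are extended by 0 to the line, so that translations and
   convolutions need no boundary terms. *)
Definition hl f : R -> R[i] := cres halfline f.

Lemma measurable_halfline : measurable (halfline : set R).
Proof. exact: measurable_itv. Qed.

Lemma hlE f x : hl f x = if 0 < x then f x else 0.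
Proof. by rewrite /hl /cres /halfline mem_setE in_itv/= andbT. Qed.

Lemma laplaceE f z : laplace f z = cint setT (fun x => hl f x * expz z x).
Proof.
rewrite /laplace cint_cres; congr cint; apply/funext => x.
by rewrite hlE /cres /halfline mem_setE in_itv/= andbT; case: ifP => // _; rewrite mul0r.
Qed.

Lemma cmodulus_mul_expz (c : R[i]) z x :
  cmodulus (c * expz z x) = cmodulus c * expR (- (complex.Re z * x)).
Proof. by rewrite cmodulusM cmodulus_expz. Qed.

Lemma cL1_hl_expz f a z : a <= complex.Re z ->
  cL1 (fun x => hl f x * expz a%:C x) -> cL1 (fun x => hl f x * expz z x).
Proof.
move=> az Lf; have [mf _] := Lf.
apply: (cL1_le _ Lf).
  (* Measurability of [hl f] is recovered from the weighted product by dividing by the exponential,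
     which never vanishes. *)
  rewrite (_ : (fun x => _) = fun x =>
      hl f x * expz a%:C x * (expz a%:C x)^-1 * expz z x); last first.
    by apply/funext => x; rewrite mulfK// expz_neq0.
  apply: cmeasM; last exact: cmeas_expz.
  apply: cmeasM => //; rewrite (_ : (fun x => _) = expz (- a)%:C).
    exact: cmeas_expz.
  apply/funext => x; rewrite !expz_real -fmorphV -expRN; congr (expR _)%:C.
  by rewrite mulNr.
move=> x; rewrite !cmodulus_mul_expz hlE.
case: ifPn => [x0|_]; last by rewrite cmodulus0 !mul0r.
by rewrite ler_wpM2l ?cmodulus_ge0// ler_expR lerN2 ler_wpM2r// ltW.
Qed.

(** Multiplication by [expz a] makes the function integrable and translates the half-line [a <= l]
    to [0 <= l]; the real case then applies to both components. *)
Lemma Laplace_injective f a : cL1 (fun x => hl f x * expz a%:C x) ->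
  (forall l : R, a <= l -> laplace f l%:C = 0) ->
  {ae mu, forall x, hl f x = 0}.
Proof.
move=> Lf lap0; pose h x := hl f x * expz a%:C x.
have hE l x : (expR (- (l * x)))%:C * h x = hl f x * expz (a + l)%:C x.
  by rewrite /h !expz_real mulrCA -rmorphM -expRD; congr (_ * (expR _)%:C); ring.
have h0 x : x <= 0 -> h x = 0 by rewrite /h hlE ltNge => ->; rewrite mul0r.
have lap l : 0 <= l -> cint setT (fun x => (expR (- (l * x)))%:C * h x) = 0.
  move=> l0; rewrite -(lap0 (a + l)) ?lerDl// laplaceE.
  by congr cint; apply/funext => x; rewrite hE.
have [iRe iIm] := (cL1P _).1 Lf.
have aeRe : {ae mu, forall x, complex.Re (h x) = 0}.
  apply: (Laplace_injective_real iRe) => [x x0|l l0]; first by rewrite /Ref -/(h x) h0.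
  have := congr1 (@complex.Re R) (lap _ l0); rewrite /cint /= => <-.
  by apply: eq_Rintegral => x _; rewrite /Ref [RHS]ReM /= mul0r subr0.
have aeIm : {ae mu, forall x, complex.Im (h x) = 0}.
  apply: (Laplace_injective_real iIm) => [x x0|l l0]; first by rewrite /Imf -/(h x) h0.
  have := congr1 (@complex.Im R) (lap _ l0); rewrite /cint /= => <-.
  by apply: eq_Rintegral => x _; rewrite /Imf [RHS]ImM /= mul0r addr0.
apply: ae_imply2 aeRe aeIm => x re0 im0.
have /eqP : h x = 0 by apply: complex_ext.
by rewrite mulf_eq0 (negbTE (expz_neq0 _ _)) orbF => /eqP.
Qed.

End half_line.

Section convolution.
Context {R : realType}.
Local Notation mu := (@lebesgue_measure R).

Definition conv (f g : R -> R[i]) x : R[i] := cint setT (fun s => f (x - s) * g s).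

Variables (f g : R -> R[i]) (z : R[i]).
Hypotheses (mf : cmeas f) (mg : cmeas g).
Hypothesis Lf : cL1 (fun x => f x * expz z x).
Hypothesis Lg : cL1 (fun x => g x * expz z x).

Lemma cmeas_conv_integrand : cmeas (fun p : R * R => f (p.1 - p.2) * g p.2).
Proof.
apply: cmeasM; last by apply: cmeas_comp mg; exact: measurable_snd.
by apply: cmeas_comp mf; apply: measurable_funB; [exact: measurable_fst|exact: measurable_snd].
Qed.

Lemma cmeas_conv : cmeas (conv f g).
Proof. exact: (cmeas_cint_param cmeas_conv_integrand). Qed.

Let F (p : R * R) := (f (p.1 - p.2) * g p.2) * expz z p.1.

(** Multiplicativity of the exponential splits the weighted integrand into a factor in [x - s] and
    one in [s]; absolute convergence and the product formula for transforms both rest on this. *)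
Let FE x s : F (x, s) = (f (x - s) * expz z (x - s)) * (g s * expz z s).
Proof.
by rewrite /F /= [RHS]mulrACA -expzD subrK.
Qed.

Let mF : cmeas F.
Proof.
apply: cmeasM; first exact: cmeas_conv_integrand.
by apply: cmeas_comp (cmeas_expz z); exact: measurable_fst.
Qed.

Let int_section s : (\int[mu]_x (cmodulus (F (x, s)))%:E =
  (cmodulus (g s * expz z s))%:E * \int[mu]_x (cmodulus (f x * expz z x))%:E)%E.
Proof.
have mc : measurable_fun setT (fun x => (cmodulus (f x * expz z x))%:E).
  by apply/measurable_EFinP; apply: measurable_cmodulus; case: Lf.
rewrite -(ge0_integral_shift (- s) mc); last first.
  by move=> x; rewrite lee_fin cmodulus_ge0.
rewrite -ge0_integralZl_EFin ?cmodulus_ge0//.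
- by apply: eq_integral => x _; rewrite FE cmodulusM EFinM muleC.
- by move=> x _; rewrite lee_fin cmodulus_ge0.
- apply/measurable_EFinP; apply: measurable_cmodulus.
  by case: (cL1_shift (- s) Lf).
Qed.

Let iF : (\int[mu]_x \int[mu]_y (cmodulus (F (x, y)))%:E < +oo)%E.
Proof.
rewrite Tonelli_cmodulus//; under eq_integral do rewrite int_section.
rewrite ge0_integralZr//.
- apply: lte_mul_pinfty; last by case: Lf.
  + by apply: integral_ge0 => x _; rewrite lee_fin cmodulus_ge0.
  + exact: integrable_fin_num (cL1_integrable Lg).
- by apply/measurable_EFinP; apply: measurable_cmodulus; case: Lg.
- by move=> x _; rewrite lee_fin cmodulus_ge0.
- by apply: integral_ge0 => x _; rewrite lee_fin cmodulus_ge0.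
Qed.

Lemma ae_cL1_conv : {ae mu, forall x, cL1 (fun s => f (x - s) * g s)}.
Proof.
apply: ae_imply (ae_cL1_section mF iF) => x /(cL1Z (expz z x)^-1).
by congr cL1; apply/funext => s; rewrite mulrC mulfK// expz_neq0.
Qed.

Let conv_expz : {ae mu, forall x,
  cint setT (fun s => F (x, s)) = conv f g x * expz z x}.
Proof.
apply: ae_imply ae_cL1_conv => x Lx; rewrite mulrC /conv -cintZ//.
by congr cint; apply/funext => s; rewrite /F /= mulrC.
Qed.

Lemma cL1_conv : cL1 (fun x => conv f g x * expz z x).
Proof.
apply: eq_ae_cL1 conv_expz (cL1_cint_section mF iF).
by apply: cmeasM; [exact: cmeas_conv|exact: cmeas_expz].
Qed.

Lemma Laplace_conv : cint setT (fun x => conv f g x * expz z x) =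
  cint setT (fun x => f x * expz z x) * cint setT (fun x => g x * expz z x).
Proof.
have -> : cint setT (fun x => conv f g x * expz z x) =
    cint setT (fun x => cint setT (fun s => F (x, s))).
  apply: eq_ae_cint; [|exact: cmeas_cint_param|].
    by apply: cmeasM; [exact: cmeas_conv|exact: cmeas_expz].
  by apply: ae_imply conv_expz.
rewrite (cint_Fubini mF iF) -cintZ//; congr cint; apply/funext => s.
under [X in cint _ X]eq_fun do rewrite FE mulrC.
rewrite cintZ; last exact: (cL1_shift (- s) Lf).
by rewrite mulrC (cint_shift (- s) (proj1 Lf)).
Qed.

End convolution.

(** * Square-integrable functions and kernel operators *)

Section L2_norm.
Context {R : realType}.
Local Notation mu := (@lebesgue_measure R).
Implicit Types (f g : R -> R[i]).
Local Open Scope ereal_scope.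

Definition sqint f : \bar R := \int[mu]_x ((cmodulus (f x)) ^+ 2)%:E.

Lemma sqint_ge0 f : 0 <= sqint f.
Proof. by apply: integral_ge0 => x _; rewrite lee_fin sqr_ge0. Qed.

Lemma L2normE f : L2norm f = sqrte (sqint (hl f)).
Proof.
have E : L2norm f ^+ 2 = sqint (hl f).
  have <- : L2norm f `^ 2 = L2norm f ^+ 2.
    have := Lnorm_ge0 mu 2%:E (EFin \o ((cmodulus \o f) \_ halfline)).
    rewrite -/(L2norm f); case: (L2norm f) => // [r|_].
      by rewrite lee_fin => r0; rewrite poweR_EFin powR_mulrn// expe2.
    by rewrite poweRyr.
  rewrite /L2norm powR_Lnorm//; apply: eq_integral => x _ /=.
  rewrite powR_mulrn// patchE hlE /halfline mem_setE in_itv/= andbT.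
  by case: ifP => _; rewrite ?cmodulus0 ?normr0// ger0_norm// cmodulus_ge0.
by rewrite -E sqrte_sqr gee0_abs// Lnorm_ge0.
Qed.

Lemma L2norm_sqr f : L2norm f ^+ 2 = sqint (hl f).
Proof. by rewrite L2normE sqr_sqrte// sqint_ge0. Qed.

Lemma L2norm_ge0 f : 0 <= L2norm f.
Proof. by rewrite L2normE sqrte_ge0. Qed.

Lemma inL2P f : inL2 f <-> cmeas (hl f) /\ sqint (hl f) < +oo.
Proof.
rewrite /inL2 L2normE -(cmeasurable_cres _ measurable_halfline).
have fin (x : \bar R) : 0 <= x -> x < +oo <-> x \is a fin_num.
  by move=> x0; rewrite ge0_fin_numE.
by split=> -[mf] /fin; rewrite ?sqrte_ge0 ?sqint_ge0// => /(_ isT) h; split => //;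
  apply/fin; rewrite ?sqrte_ge0 ?sqint_ge0//; move: h; rewrite sqrte_fin_num// sqint_ge0.
Qed.

Lemma measurable_sqmod d (T : measurableType d) (f : T -> R[i]) : cmeas f ->
  measurable_fun setT (fun x => ((cmodulus (f x)) ^+ 2)%:E).
Proof.
by move=> mf; apply/measurable_EFinP; apply: measurable_funX; exact: measurable_cmodulus.
Qed.

Lemma le_sqint f g : cmeas f -> cmeas g ->
  (forall x, cmodulus (f x) <= cmodulus (g x))%R -> sqint f <= sqint g.
Proof.
move=> mf mg fg; apply: ge0_le_integral => //; try exact: measurable_sqmod.
  by move=> x _; rewrite lee_fin sqr_ge0.
by move=> x _; rewrite lee_fin ler_pXn2r// nnegrE cmodulus_ge0.
Qed.

Lemma eq_ae_sqint f g : cmeas f -> cmeas g ->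
  {ae mu, forall x, f x = g x} -> sqint f = sqint g.
Proof.
move=> mf mg fg; apply: ae_eq_integral => //; try exact: measurable_sqmod.
by apply: ae_imply fg => x ->.
Qed.

Lemma sqintZ (c : R[i]) f : cmeas f ->
  sqint (fun x => c * f x)%R = ((cmodulus c) ^+ 2)%:E * sqint f.
Proof.
move=> mf; rewrite /sqint -ge0_integralZl_EFin ?sqr_ge0//.
- by apply: eq_integral => x _; rewrite cmodulusM exprMn EFinM.
- by move=> x _; rewrite lee_fin sqr_ge0.
- exact: measurable_sqmod.
Qed.

Lemma sqintD f g : cmeas f -> cmeas g ->
  sqint (fun x => f x + g x)%R <= 2%:E * sqint f + 2%:E * sqint g.
Proof.
move=> mf mg; rewrite /sqint -!ge0_integralZl_EFin//; last 4 first.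
- by move=> x _; rewrite lee_fin sqr_ge0.
- exact: measurable_sqmod.
- by move=> x _; rewrite lee_fin sqr_ge0.
- exact: measurable_sqmod.
rewrite -ge0_integralD//; last 4 first.
- by move=> x _; rewrite mule_ge0// lee_fin sqr_ge0.
- by apply: emeasurable_funM => //; exact: measurable_sqmod.
- by move=> x _; rewrite mule_ge0// lee_fin sqr_ge0.
- by apply: emeasurable_funM => //; exact: measurable_sqmod.
apply: ge0_le_integral => //.
- by move=> x _; rewrite lee_fin sqr_ge0.
- by apply: measurable_sqmod; exact: cmeasD.
- by apply: emeasurable_funD; apply: emeasurable_funM => //; exact: measurable_sqmod.
move=> x _; rewrite -!EFinM -EFinD lee_fin.
apply: (@le_trans _ _ ((cmodulus (f x) + cmodulus (g x)) ^+ 2)%R).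
  by rewrite ler_pXn2r ?nnegrE ?addr_ge0 ?cmodulus_ge0// cmodulusD.
have := sqr_ge0 (cmodulus (f x) - cmodulus (g x)); lra.
Qed.

Lemma sqintN f : sqint (fun x => - f x)%R = sqint f.
Proof. by apply: eq_integral => x _; rewrite cmodulusN. Qed.

Lemma sqintB f g : cmeas f -> cmeas g ->
  sqint (fun x => f x - g x)%R <= 2%:E * sqint f + 2%:E * sqint g.
Proof.
by move=> mf mg; rewrite -(sqintN g); apply: sqintD => //; exact: cmeasN.
Qed.

Lemma lt2_add (a b : \bar R) : a < +oo -> b < +oo -> 2%:E * a + 2%:E * b < +oo.
Proof.
by move=> ay by_; apply: lte_add_pinfty; apply: lte_mul_pinfty.
Qed.

Lemma Cauchy_Schwarz f g : cmeas f -> cmeas g -> sqint f < +oo -> sqint g < +oo ->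
  cL1 (fun x => f x * g x)%R /\
  (\int[mu]_x (cmodulus (f x * g x))%:E) ^+ 2 <= sqint f * sqint g.
Proof.
move=> mf mg fi gi.
have mcf := measurable_cmodulus mf; have mcg := measurable_cmodulus mg.
have N2 (h : R -> R[i]) : 'N[mu]_2%:E[EFin \o (cmodulus \o h)] ^+ 2 = sqint h.
  set N := 'N[mu]_2%:E[_]; have <- : N `^ 2 = N ^+ 2.
    have := Lnorm_ge0 mu 2%:E (EFin \o (cmodulus \o h)).
    rewrite -/N; case: N => // [r|_].
      by rewrite lee_fin => r0; rewrite poweR_EFin powR_mulrn// expe2.
    by rewrite poweRyr.
  rewrite /N powR_Lnorm//; apply: eq_integral => x _ /=.
  by rewrite powR_mulrn// ger0_norm// cmodulus_ge0.
have := @hoelder _ _ R mu (cmodulus \o f) (cmodulus \o g) 2 2 mcf mcg.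
rewrite !ltr0n => /(_ isT isT); rewrite -div1r -splitr => /(_ erefl).
rewrite Lnorm1 => H.
have E : \int[mu]_x `|(EFin \o ((cmodulus \o f) \* (cmodulus \o g))%R) x| =
    \int[mu]_x (cmodulus (f x * g x))%:E.
  apply: eq_integral => x _ /=.
  by rewrite cmodulusM ger0_norm// mulr_ge0 ?cmodulus_ge0.
rewrite E in H.
have I0 : 0 <= \int[mu]_x (cmodulus (f x * g x))%:E.
  by apply: integral_ge0 => x _; rewrite lee_fin cmodulus_ge0.
have CS : (\int[mu]_x (cmodulus (f x * g x))%:E) ^+ 2 <= sqint f * sqint g.
  by rewrite -(N2 f) -(N2 g) !expe2 muleACA -!expe2 lee_sqr// mule_ge0// Lnorm_ge0.
split => //; split; first exact: cmeasM.
have : (\int[mu]_x (cmodulus (f x * g x))%:E) ^+ 2 < +oo.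
  apply: le_lt_trans CS _; rewrite -ge0_fin_numE ?mule_ge0 ?sqint_ge0//.
  by apply: fin_numM; rewrite ge0_fin_numE ?sqint_ge0.
by case: (\int[mu]_x _) I0 => [r _ _|_|//]; rewrite ?ltry// expe2 mulyy.
Qed.

Lemma Cauchy_Schwarz_cint f g : cmeas f -> cmeas g -> sqint f < +oo -> sqint g < +oo ->
  ((cmodulus (cint setT (fun x => f x * g x)%R)) ^+ 2)%:E <= sqint f * sqint g.
Proof.
move=> mf mg fi gi; have [Lfg CS] := Cauchy_Schwarz mf mg fi gi.
apply: le_trans CS; rewrite EFin_expe lee_sqr ?lee_fin ?cmodulus_ge0//.
  exact: le_cmodulus_cint.
by apply: integral_ge0 => x _; rewrite lee_fin cmodulus_ge0.
Qed.

Lemma cvge0P T (F : set_system T) (FF : Filter F) (u : T -> \bar R) :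
  (forall t, 0 <= u t) ->
  u t @[t --> F] --> 0 <-> forall e : R, (0 < e)%R -> \forall t \near F, u t <= e%:E.
Proof.
move=> u0; split=> [/fine_cvgP[fu cu] e e0|H].
  move/cvgrPdist_le : cu => /(_ e e0); apply: filterS2 fu => t ft.
  by rewrite sub0r normrN ger0_norm ?fine_ge0// -lee_fin fineK.
apply/fine_cvgP; split.
  apply: filterS (H _ ltr01) => t ut; rewrite ge0_fin_numE//.
  exact: le_lt_trans ut (ltry _).
apply/cvgrPdist_le => e e0; apply: filterS (H _ e0) => t ut.
rewrite sub0r normrN ger0_norm ?fine_ge0// -lee_fin fineK//.
by rewrite ge0_fin_numE//; exact: le_lt_trans ut (ltry _).
Qed.

Lemma L2norm_cvg0 T (F : set_system T) (FF : Filter F) (u : T -> R -> R[i]) :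
  L2norm (u t) @[t --> F] --> 0 <-> sqint (hl (u t)) @[t --> F] --> 0.
Proof.
rewrite !cvge0P//; [|by move=> t; exact: sqint_ge0|by move=> t; exact: L2norm_ge0].
split=> H e e0.
- have se0 : (0 < Num.sqrt e)%R by rewrite sqrtr_gt0.
  apply: filterS (H _ se0) => t; rewrite -L2norm_sqr => ut.
  rewrite -(sqr_sqrtr (ltW e0)) EFin_expe lee_sqr ?L2norm_ge0//.
- have ee0 : (0 < e ^+ 2)%R by rewrite exprn_gt0.
  apply: filterS (H _ ee0) => t; rewrite -L2norm_sqr EFin_expe lee_sqr ?L2norm_ge0//.
  by rewrite lee_fin ltW.
Qed.

End L2_norm.

Section Bessel_inequality.
Context {R : realType}.
Local Notation mu := (@lebesgue_measure R).
Implicit Types (f g k : R -> R[i]).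

Lemma cint_conj f : cL1 f -> cint setT (fun x => conjc (f x)) = conjc (cint setT f).
Proof.
move=> /cL1P[f1 f2]; rewrite /cint /=; congr (_ +i* _).
  by apply: eq_Rintegral => x _; rewrite /Ref; case: (f x).
rewrite -mulN1r -RintegralZl//; apply: eq_Rintegral => x _.
by rewrite /Imf mulN1r; case: (f x).
Qed.

Lemma sqint_conj f : sqint (fun x => conjc (f x)) = sqint f.
Proof. by apply: eq_integral => x _; rewrite cmodulus_conj. Qed.

Lemma cL1_mul f g : cmeas f -> cmeas g -> (sqint f < +oo)%E -> (sqint g < +oo)%E ->
  cL1 (fun x => f x * g x).
Proof. by move=> mf mg fi gi; case: (Cauchy_Schwarz mf mg fi gi). Qed.

Lemma sqint_cint f : cmeas f -> (sqint f < +oo)%E ->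
  (fine (sqint f))%:C = cint setT (fun x => f x * conjc (f x)).
Proof.
have E (z : R[i]) : z * conjc z = (cmodulus z ^+ 2)%:C.
  by apply: complex_ext; rewrite (ReM, ImM) cmodulus_sqr; case: z => a b /=; ring.
move=> mf fi; apply: complex_ext; rewrite /cint /=.
  by congr fine; apply: eq_integral => x _; rewrite /Ref E.
by under eq_Rintegral do rewrite /Imf E /=; rewrite /Rintegral integral0.
Qed.

Variable e : nat -> R -> R[i].
Hypothesis me : forall n, cmeas (e n).
Hypothesis ie : forall n, (sqint (e n) < +oo)%E.
Hypothesis orthonormal_e : forall m n,
  cint setT (fun x => e m x * conjc (e n x)) = (m == n)%:R.

(* Gram-Schmidt step: removing from [k] its component along [e n] lowers the
   square norm by the square of the corresponding coefficient. *)
Lemma Bessel k N : cmeas k -> (sqint k < +oo)%E ->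
  (\sum_(n < N) ((cmodulus (cint setT (fun x => k x * e n x)%R)) ^+ 2)%:E <= sqint k)%E.
Proof.
move=> mk ik.
suff [h [_ _ E _]] : exists h, [/\ cmeas h, (sqint h < +oo)%E,
   fine (sqint h) + \sum_(n < N) (cmodulus (cint setT (fun x => k x * e n x))) ^+ 2 =
     fine (sqint k)
   & forall n, (N <= n)%N ->
     cint setT (fun x => h x * e n x) = cint setT (fun x => k x * e n x)].
  have fk : sqint k \is a fin_num by rewrite ge0_fin_numE// sqint_ge0.
  by rewrite -[leRHS]fineK// sumEFin lee_fin -E lerDr fine_ge0// sqint_ge0.
elim: N => [|N [h [mh ih hk hN]]].
  by exists k; split => //; rewrite big_ord0 addr0.
set a := cint setT (fun x => k x * e N x).
(* The coefficients carry no conjugation, because they will be the values of a kernel operator at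
   [e n]; hence the component to remove is a multiple of [conjc (e N)]. *)
pose h' x := h x - a * conjc (e N x).
have mce n : cmeas (fun x => conjc (e n x)) by exact: cmeas_conj.
have ice n : (sqint (fun x => conjc (e n x)) < +oo)%E by rewrite sqint_conj.
have mae : cmeas (fun x => a * conjc (e N x)) by exact: (cmeasM (cmeas_cst a) (mce N)).
have iae : (sqint (fun x => (a * conjc (e N x))%R) < +oo)%E.
  by rewrite sqintZ//; apply: lte_mul_pinfty; rewrite ?lee_fin ?sqr_ge0.
have mh' : cmeas h' by exact: cmeasB.
have ih' : (sqint h' < +oo)%E.
  by apply: le_lt_trans (sqintB mh mae) _; exact: lt2_add.
have h'e n : cint setT (fun x => h' x * e n x) =
    cint setT (fun x => h x * e n x) - a * (n == N)%:R.
  have Lee := cL1_mul (me n) (mce N) (ie n) (ice N).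
  rewrite -(orthonormal_e n N) -cintZ// -cintB; last 2 first.
  - exact: (cL1_mul mh (me n) ih (ie n)).
  - exact: cL1Z.
  by congr cint; apply/funext => x; rewrite /h'; ring.
exists h'; split => //; last first.
  by move=> n Nn; rewrite h'e hN ?(ltnW Nn)// gtn_eqF// mulr0 subr0.
rewrite big_ord_recr /= -/a -hk addrCA [RHS]addrC; congr (_ + _).
apply: complexI; rewrite rmorphD/= !sqint_cint//.
have mch' : cmeas (fun x => conjc (h' x)) by exact: cmeas_conj.
have ich' : (sqint (fun x => conjc (h' x)) < +oo)%E by rewrite sqint_conj.
have mch : cmeas (fun x => conjc (h x)) by exact: cmeas_conj.
have ich : (sqint (fun x => conjc (h x)) < +oo)%E by rewrite sqint_conj.
have -> : cint setT (fun x => h' x * conjc (h' x)) = cint setT (fun x => h x * conjc (h' x)) -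
    a * conjc (cint setT (fun x => h' x * e N x)).
  rewrite -(cint_conj (cL1_mul mh' (me N) ih' (ie N))).
  rewrite -cintZ; last first.
    rewrite (_ : (fun x => _) = fun x => conjc (h' x) * conjc (e N x)); first exact: cL1_mul.
    by apply/funext => x; rewrite rmorphM.
  rewrite -cintB; last 2 first.
  - exact: cL1_mul.
  - apply: cL1Z.
    rewrite (_ : (fun x => _) = fun x => conjc (h' x) * conjc (e N x)); first exact: cL1_mul.
    by apply/funext => x; rewrite rmorphM.
  congr cint; apply/funext => x; rewrite rmorphM {1}/h' mulrBl -mulrA.
  by rewrite [conjc (h' x) * _]mulrC.
rewrite h'e eqxx mulr1 hN// -/a subrr rmorph0 mulr0 subr0.
have -> : cint setT (fun x => h x * conjc (h' x)) = cint setT (fun x => h x * conjc (h x)) -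
    conjc a * cint setT (fun x => h x * e N x).
  rewrite -cintZ; last exact: cL1_mul.
  rewrite -cintB; [|exact: cL1_mul|by apply: cL1Z; exact: cL1_mul].
  congr cint; apply/funext => x; rewrite rmorphB rmorphM/= conjcK.
  ring.
rewrite hN// -/a.
have -> : (cmodulus a ^+ 2)%:C = conjc a * a.
  by apply: complex_ext; rewrite (ReM, ImM) cmodulus_sqr; case: (a) => b c /=; ring.
by rewrite subrK.
Qed.

End Bessel_inequality.

Section kernel_operator.
Context {R : realType}.
Local Notation mu := (@lebesgue_measure R).
Implicit Types (f g : R -> R[i]).
Local Open Scope ereal_scope.

Definition kop (k : R * R -> R[i]) f x : R[i] :=
  cint setT (fun y => k (x, y) * f y)%R.

Definition hs_norm2 (k : R * R -> R[i]) : \bar R :=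
  \int[mu]_x sqint (fun y => k (x, y)).

Definition adjoint_kernel (k : R * R -> R[i]) (p : R * R) : R[i] := conjc (k (p.2, p.1)).

Lemma cmeas_section (k : R * R -> R[i]) x : cmeas k -> cmeas (fun y => k (x, y)).
Proof. by move=> mk; apply: (cmeas_comp (h := pair x)). Qed.

Lemma measurable_sqint_section (k : R * R -> R[i]) : cmeas k ->
  measurable_fun setT (fun x => sqint (fun y => k (x, y))).
Proof.
move=> mk; have mE := measurable_sqmod mk.
apply: (@measurable_fun_fubini_tonelli_F _ _ _ _ R mu _ mE) => p.
by rewrite lee_fin sqr_ge0.
Qed.

Lemma cmeas_adjoint_kernel k : cmeas k -> cmeas (adjoint_kernel k).
Proof.
move=> mk; apply: cmeas_conj; apply: (cmeas_comp _ mk).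
exact: measurable_pair_swap.
Qed.

Lemma hs_norm2_adjoint k : cmeas k -> hs_norm2 (adjoint_kernel k) = hs_norm2 k.
Proof.
move=> mk; rewrite /hs_norm2 /sqint.
have mE := measurable_sqmod (cmeas_adjoint_kernel mk).
rewrite (@fubini_tonelli _ _ _ _ R mu mu _ mE) => [|p]; last by rewrite lee_fin sqr_ge0.
by under eq_integral do under eq_integral do rewrite cmodulus_conj.
Qed.

Lemma ae_sqint_section (k : R * R -> R[i]) : cmeas k -> hs_norm2 k < +oo ->
  {ae mu, forall x, sqint (fun y => k (x, y)) < +oo}.
Proof.
move=> mk hk; have : mu.-integrable setT (fun x => sqint (fun y => k (x, y))).
  apply/integrableP; split; first exact: measurable_sqint_section.
  by under eq_integral do rewrite gee0_abs ?sqint_ge0//.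
move/integrable_ae => /(_ measurableT); apply: ae_imply => x /(_ I).
by rewrite ge0_fin_numE// sqint_ge0.
Qed.

Lemma cmeas_kop (k : R * R -> R[i]) f : cmeas k -> cmeas f -> cmeas (kop k f).
Proof.
move=> mk mf; apply: (cmeas_cint_param (F := fun p => k p * f p.2)%R).
by apply: cmeasM => //; apply: (cmeas_comp _ mf); exact: measurable_snd.
Qed.

Variable k : R * R -> R[i].
Hypothesis mk : cmeas k.
Hypothesis hk : hs_norm2 k < +oo.

Section one_function.
Variable f : R -> R[i].
Hypotheses (mf : cmeas f) (fi : sqint f < +oo).

Lemma sqint_kop : sqint (kop k f) <= hs_norm2 k * sqint f.
Proof.
rewrite /hs_norm2 -ge0_integralZr//; last 3 first.
- exact: measurable_sqint_section.
- by move=> x _; exact: sqint_ge0.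
- exact: sqint_ge0.
apply: ae_ge0_le_integral => //.
- by move=> x _; rewrite lee_fin sqr_ge0.
- by apply: measurable_sqmod; exact: cmeas_kop.
- by move=> x _; rewrite mule_ge0// sqint_ge0.
- by apply: emeasurable_funM => //; exact: measurable_sqint_section.
apply: ae_imply (ae_sqint_section mk hk) => x xi _.
by apply: Cauchy_Schwarz_cint => //; exact: cmeas_section.
Qed.

Lemma sqint_kop_lty : sqint (kop k f) < +oo.
Proof.
apply: le_lt_trans sqint_kop _; apply: lte_mul_pinfty => //.
  by apply: integral_ge0 => x _; exact: sqint_ge0.
by rewrite ge0_fin_numE//; apply: integral_ge0 => x _; exact: sqint_ge0.
Qed.

End one_function.

Lemma kop_linear (a b : R[i]) f g : cmeas f -> cmeas g ->
  sqint f < +oo -> sqint g < +oo ->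
  {ae mu, forall x, kop k (fun y => a * f y + b * g y)%R x =
                    (a * kop k f x + b * kop k g x)%R}.
Proof.
move=> mf mg fi gi; apply: ae_imply (ae_sqint_section mk hk) => x xi.
have mkx := cmeas_section x mk.
have Lf : cL1 (fun y => k (x, y) * f y)%R by exact: cL1_mul.
have Lg : cL1 (fun y => k (x, y) * g y)%R by exact: cL1_mul.
rewrite /kop -cintZ// -cintZ// -cintD; [|exact: cL1Z|exact: cL1Z].
by congr cint; apply/funext => y; rewrite mulrDr !(mulrCA (k _)).
Qed.

Lemma kop_adjoint f g : cmeas f -> cmeas g -> sqint f < +oo -> sqint g < +oo ->
  cint setT (fun x => kop k f x * conjc (g x))%R =
  cint setT (fun y => f y * conjc (kop (adjoint_kernel k) g y))%R.
Proof.
move=> mf mg fi gi.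
pose F (p : R * R) := (k p * f p.2 * conjc (g p.1))%R.
have mF : cmeas F.
  apply: cmeasM; last by apply: cmeas_conj; apply: (cmeas_comp _ mg); exact: measurable_fst.
  by apply: cmeasM => //; apply: (cmeas_comp _ mf); exact: measurable_snd.
have iF : \int[mu]_x \int[mu]_y (cmodulus (F (x, y)))%:E < +oo.
  (* Absolute convergence on the plane comes from [|k f g| <= |k|^2 + |g|^2 |f|^2], whose right-hand
     side has integral [hs_norm2 k + sqint g * sqint f]. *)
  apply: (@le_lt_trans _ _ (\int[mu]_x (sqint (fun y => k (x, y)) +
      ((cmodulus (g x)) ^+ 2)%:E * sqint f))).
    apply: ge0_le_integral => //.
    - by move=> x _; apply: integral_ge0 => y _; rewrite lee_fin cmodulus_ge0.
    - have mE : measurable_fun setT (fun p => (cmodulus (F p))%:E).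
        by apply/measurable_EFinP; exact: measurable_cmodulus.
      apply: (@measurable_fun_fubini_tonelli_F _ _ _ _ R mu _ mE) => p.
      by rewrite lee_fin cmodulus_ge0.
    - apply: emeasurable_funD; first exact: measurable_sqint_section.
      by apply: emeasurable_funM => //; exact: measurable_sqmod.
    move=> x _; rewrite /sqint -ge0_integralZl_EFin ?sqr_ge0//; last 2 first.
    - by move=> y _; rewrite lee_fin sqr_ge0.
    - exact: measurable_sqmod.
    rewrite -ge0_integralD//; last 4 first.
    - by move=> y _; rewrite lee_fin sqr_ge0.
    - by apply: measurable_sqmod; exact: cmeas_section.
    - by move=> y _; rewrite mule_ge0// lee_fin sqr_ge0.
    - by apply: emeasurable_funM => //; exact: measurable_sqmod.
    apply: ge0_le_integral => //.
    - by move=> y _; rewrite lee_fin cmodulus_ge0.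
    - apply/measurable_EFinP; apply: measurable_cmodulus.
      exact: (cmeas_section x mF).
    - apply: emeasurable_funD; last by apply: emeasurable_funM => //; exact: measurable_sqmod.
      by apply: measurable_sqmod; exact: cmeas_section.
    move=> y _; rewrite -EFinM -EFinD lee_fin !cmodulusM cmodulus_conj.
    have := sqr_ge0 (cmodulus (k (x, y)) - cmodulus (f y) * cmodulus (g x)).
    have := cmodulus_ge0 (k (x, y)); have := cmodulus_ge0 (f y).
    have := cmodulus_ge0 (g x); set A := cmodulus (k _); set B := cmodulus _; set C := cmodulus _.
    by move=> *; nra.
  rewrite ge0_integralD//; last 4 first.
  - by move=> x _; exact: sqint_ge0.
  - exact: measurable_sqint_section.
  - by move=> x _; rewrite mule_ge0// ?lee_fin ?sqr_ge0// sqint_ge0.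
  - by apply: emeasurable_funM => //; exact: measurable_sqmod.
  apply: lte_add_pinfty => //.
  rewrite ge0_integralZr//; [|exact: measurable_sqmod|by move=> x _; rewrite lee_fin
    sqr_ge0|exact: sqint_ge0].
  by apply: lte_mul_pinfty => //; [exact: sqint_ge0|rewrite ge0_fin_numE// sqint_ge0].
transitivity (cint setT (fun x => cint setT (fun y => F (x, y)))).
  apply: eq_ae_cint.
  - by apply: cmeasM; [exact: cmeas_kop|exact: cmeas_conj].
  - exact: cmeas_cint_param.
  apply: ae_imply (ae_sqint_section mk hk) => x xi.
  rewrite mulrC -cintZ; last by apply: cL1_mul => //; exact: cmeas_section.
  by congr cint; apply/funext => y; rewrite /F mulrC.
rewrite cint_Fubini//.
have mk' := cmeas_adjoint_kernel mk.
apply: eq_ae_cint.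
- have mS : cmeas (fun p : R * R => F (p.2, p.1)).
    by apply: (cmeas_comp _ mF); exact: measurable_pair_swap.
  exact: (cmeas_cint_param mS).
- exact: (cmeasM mf (cmeas_conj (cmeas_kop mk' mg))).
have hk' : hs_norm2 (adjoint_kernel k) < +oo by rewrite hs_norm2_adjoint.
apply: ae_imply (ae_sqint_section mk' hk') => y yi.
have Ly : cL1 (fun x => adjoint_kernel k (y, x) * g x)%R.
  by apply: cL1_mul => //; exact: cmeas_section.
rewrite /kop -cint_conj// -cintZ; last first.
  split; first by apply: cmeas_conj; case: Ly.
  by case: Ly => _; under eq_integral do rewrite -cmodulus_conj.
by congr cint; apply/funext => x; rewrite /F /= rmorphM/= conjcK; ring.
Qed.

(** The value [kop k (e n) x] is the coefficient of the row [k (x, _)] along [e n], so Bessel's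
    inequality in almost every row bounds each partial sum after integration over [x]. *)
Lemma kop_hilbert_schmidt (e : nat -> R -> R[i]) :
  (forall n, cmeas (e n)) -> (forall n, sqint (e n) < +oo) ->
  (forall m n, cint setT (fun x => e m x * conjc (e n x))%R = (m == n)%:R) ->
  \sum_(0 <= n <oo) sqint (kop k (e n)) <= hs_norm2 k.
Proof.
move=> me ie oe; apply: lime_le.
  by apply: is_cvg_nneseries => n _ _; exact: sqint_ge0.
apply: nearW => N; rewrite /sqint big_mkord -ge0_integral_sum//; last 2 first.
- by move=> n; apply: measurable_sqmod; exact: cmeas_kop.
- by move=> n x _; rewrite lee_fin sqr_ge0.
apply: ae_ge0_le_integral => //.
- by move=> x _; apply: sume_ge0 => n _; rewrite lee_fin sqr_ge0.
- by apply: emeasurable_sum => n; apply: measurable_sqmod; exact: cmeas_kop.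
- by move=> x _; exact: sqint_ge0.
- exact: measurable_sqint_section.
apply: ae_imply (ae_sqint_section mk hk) => x xi _.
by apply: Bessel => //; exact: cmeas_section.
Qed.

End kernel_operator.

(** * The renewal equation *)

Section half_line_estimates.
Context {R : realType}.
Local Notation mu := (@lebesgue_measure R).
Local Open Scope ereal_scope.

Lemma measurable_gt0 : measurable_fun setT (fun x : R => (0 < x)%R).
Proof. by apply: measurable_fun_ltr. Qed.

Lemma integral_exp_halfline (a : R) : (0 < a)%R ->
  \int[mu]_x (if (0 < x)%R then expR (- (a * x)) else 0)%:E = (a^-1)%:E.
Proof.
move=> a0; have := integral_exponential_pdf a0 => H.
have mf : measurable_fun setT
    (fun x : R => (if (0 < x)%R then expR (- (a * x)) else 0)%:E).
  apply/measurable_EFinP; apply: measurable_fun_ifT => //; first exact: measurable_gt0.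
  under eq_fun do rewrite -mulNr.
  exact: (measurableT_comp (@measurable_expR R) (measurable_mull (- a))).
have f0 x : 0 <= (if (0 < x)%R then expR (- (a * x)) else 0)%:E :> \bar R.
  by rewrite lee_fin; case: ifP => // _; rewrite expR_ge0.
have : a%:E * \int[mu]_x (if (0 < x)%R then expR (- (a * x)) else 0)%:E = 1.
  rewrite -H -ge0_integralZl_EFin// ?ltW//.
  apply: ae_eq_integral => //.
  - by apply: emeasurable_funM.
  - by apply/measurable_EFinP; exact: measurable_exponential_pdf.
  exists [set 0%R]; split => //; first exact: lebesgue_measure_set1.
  move=> x /= nx; apply: contrapT => /eqP x0; apply: nx => _.
  rewrite /exponential_pdf patchE mem_setE in_itv/= andbT le_eqVlt eq_sym (negbTE x0)/=.
  by case: ifP => // _; rewrite ?mule0// -EFinM mulNr.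
have : 0 <= \int[mu]_x (if (0 < x)%R then expR (- (a * x)) else 0)%:E.
  by apply: integral_ge0 => x _; exact: f0.
case: (\int[mu]_x _) => [r _|_|//]; last by rewrite gt0_muley.
move=> /eqP; rewrite -EFinM eqe => /eqP ar; congr EFin.
by rewrite -[RHS]mulr1 -ar mulKf// gt_eqF.
Qed.

Lemma ge0_integral_conv (A B : R -> \bar R) :
  measurable_fun setT A -> measurable_fun setT B ->
  (forall x, 0 <= A x) -> (forall x, 0 <= B x) ->
  \int[mu]_u \int[mu]_r (A (u - r)%R * B r) = \int[mu]_x A x * \int[mu]_x B x.
Proof.
move=> mA mB A0 B0.
have mF : measurable_fun setT (fun p : R * R => A (p.1 - p.2)%R * B p.2).
  apply: emeasurable_funM.
  - apply: (measurableT_comp mA); apply: measurable_funB; [exact: measurable_fst|exact: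
    measurable_snd].
  - exact: (measurableT_comp mB measurable_snd).
rewrite (@fubini_tonelli _ _ _ _ R mu mu _ mF) => [|p]; last exact: mule_ge0.
rewrite -ge0_integralZl//; last exact: integral_ge0.
apply: eq_integral => r _ /=.
rewrite -(ge0_integral_shift (- r) mA)// -ge0_integralZr//.
have ms : measurable_fun setT (fun x : R => (x - r)%R) by exact: measurable_funB.
exact: (measurableT_comp mA ms).
Qed.

End half_line_estimates.

Section head_integrals.
Context {R : realType}.
Local Notation mu := (@lebesgue_measure R).

Lemma integral_head_small (h : R -> R) : measurable_fun setT h ->
  (forall u, 0 <= h u)%R -> (forall u, u <= 0 -> h u = 0)%R ->
  (\int[mu]_u (if (u < 1)%R then h u else 0%R)%:E < +oo)%E ->
  forall e : R, (0 < e)%R -> exists2 d : R, (0 < d)%R & forall t, (t <= d)%R ->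
    (\int[mu]_u (if (u < t)%R then h u else 0%R)%:E <= e%:E)%E.
Proof.
move=> mh h0 hneg hfin e e0; pose H u := if (u < 1)%R then h u else 0%R.
have H0 u : (0 <= H u)%R by rewrite /H; case: ifP.
have mH : measurable_fun setT H.
  by apply: measurable_fun_ifT => //; exact: measurable_fun_ltr.
have iH : mu.-integrable setT (EFin \o H).
  apply/integrableP; split; first exact/measurable_EFinP.
  by under eq_integral do rewrite /= ger0_norm//.
have [d [d0 hd]] := integral_normr_continuous iH e0.
(* The cap 1 ensures that the truncation [H] agrees with [h] below [t]; halving [d] turns
   [t <= d / 2] into the strict inequality on the measure of []0, t[]. *)
exists (Num.min (d / 2) 1)%R => [|t]; first by rewrite lt_min ltr01 divr_gt0.
rewrite le_min => /andP[td t1].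
have hI := hd `]0%R, t[%classic (measurable_itv _).
have [t0|t0] := leP t 0%R.
  rewrite integral0_eq ?lee_fin ?ltW// => u _; case: ltP => // ut.
  by rewrite hneg// ltW// (lt_le_trans ut).
have mt : (mu `]0%R, t[%classic < d%:E)%E.
  have /= := lebesgue_measure_itv `]0%R, t[; rewrite lte_fin t0 sube0 => ->.
  by rewrite lte_fin (le_lt_trans td)// ltr_pdivrMr// ltr_pMr// ltr1n.
have -> : (\int[mu]_u (if (u < t)%R then h u else 0%R)%:E
    = \int[mu]_(u in `]0%R, t[) (`|H u|)%:E)%E.
  rewrite [RHS]integral_mkcond; apply: eq_integral => u _.
  rewrite patchE mem_setE/= in_itv/= ger0_norm// /H; case: (ltP u t) => ut.
    rewrite andbT (lt_le_trans ut t1); case: ltP => // u0; rewrite hneg//.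
  by rewrite andbF.
have iI : mu.-integrable `]0%R, t[%classic (EFin \o (fun u => `|H u|)%R).
  have iN : mu.-integrable setT (abse \o (EFin \o H)) by exact: integrable_abse.
  by apply: (integrableS _ _ _ iN).
have fn : (\int[mu]_(u in `]0%R, t[) (`|H u|)%:E)%E \is a fin_num.
  by apply: integrable_fin_num iI.
by rewrite -(fineK fn) lee_fin; exact: ltW (hI mt).
Qed.

Definition head_integral (t : R) (g : R -> R[i]) : \bar R :=
  (\int[mu]_u (if (0 < u < t)%R then cmodulus (g u) else 0%R)%:E)%E.

Lemma measurable_head_integrand t (g : R -> R[i]) : cmeas g ->
  measurable_fun setT (fun u : R => (if (0 < u < t)%R then cmodulus (g u) else 0%R)%:E).
Proof.
move=> mg; apply/measurable_EFinP; apply: measurable_fun_ifT => //.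
  by apply: measurable_and; exact: measurable_fun_ltr.
exact: measurable_cmodulus.
Qed.

Lemma head_integral_cst t (c : R[i]) : 0 < t ->
  head_integral t (fun=> c) = (cmodulus c * t)%:E.
Proof.
move=> t0; rewrite /head_integral.
transitivity (\int[mu]_(u in `]0%R, t[) (cmodulus c)%:E)%E.
  rewrite [RHS]integral_mkcond; apply: eq_integral => u _.
  by rewrite patchE mem_setE/= in_itv/=; case: ifP.
rewrite integral_cst//=; have /= := lebesgue_measure_itv `]0%R, t[.
by rewrite lte_fin t0 sube0 => ->; rewrite EFinM.
Qed.

Lemma le_head_integral3 t (g g1 g2 g3 : R -> R[i]) :
  cmeas g -> cmeas g1 -> cmeas g2 -> cmeas g3 ->
  {ae mu, forall u, 0 < u < t -> cmodulus (g u) <= cmodulus (g1 u) + cmodulus (g2 u) + cmodulus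
    (g3 u)} ->
  (head_integral t g <= head_integral t g1 + head_integral t g2 + head_integral t g3)%E.
Proof.
move=> mg m1 m2 m3 le.
have H0 (h : R -> R[i]) u : (0 <= (if (0 < u < t)%R then cmodulus (h u) else 0%R)%:E)%E.
  by rewrite lee_fin; case: ifP => // _; exact: cmodulus_ge0.
have M h mh := @measurable_head_integrand t h mh.
rewrite /head_integral -ge0_integralD//; [|exact: M..].
rewrite -ge0_integralD//; [|by move=> u _; exact: adde_ge0|by apply: emeasurable_funD; exact:
  M|exact: M].
apply: ae_ge0_le_integral => //; [exact: M|by move=> u _; rewrite !adde_ge0|
  by apply: emeasurable_funD; [apply: emeasurable_funD|]; exact: M|].
apply: ae_imply le => u + _; case: ifP => [_ /(_ isT)|_ _]; last by rewrite !adde0.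
by rewrite -!EFinD lee_fin.
Qed.

Lemma head_integral_small (g : R -> R[i]) : cL1 g -> forall e : R, 0 < e ->
  exists2 d : R, 0 < d & forall t, t <= d -> (head_integral t g <= e%:E)%E.
Proof.
move=> Lg e e0; pose h u := if 0 < u then cmodulus (g u) else 0.
have [mg ig] := Lg.
have mh : measurable_fun setT h.
  by apply: measurable_fun_ifT => //; [exact: measurable_fun_ltr|exact: measurable_cmodulus].
have h0 u : 0 <= h u by rewrite /h; case: ifP => // _; exact: cmodulus_ge0.
have [||d d0 hd] := @integral_head_small h mh h0 _ _ e e0.
- by move=> u; rewrite /h ltNge => ->.
- apply: le_lt_trans ig; apply: ge0_le_integral => //.
  + by move=> u _; rewrite lee_fin; case: ifP.
  + apply/measurable_EFinP; apply: measurable_fun_ifT => //; exact: measurable_fun_ltr.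
  + by apply/measurable_EFinP; exact: measurable_cmodulus.
  + by move=> u _; rewrite lee_fin /h; do ?[case: ifP => // _]; rewrite cmodulus_ge0.
exists d => // t td; rewrite -[leLHS](_ : (\int[mu]_u (if (u < t)%R then h u else 0%R)%:E)%E =
  _) ?hd//.
by apply: eq_integral => u _; rewrite /h andbC; case: (u < t).
Qed.

(** By causality only [0 < r < u < t] contributes, and then [u - r] and [r] both lie in []0, t[].
    The convolution is thus dominated by that of the two truncated moduli, whose integral is the
    product. *)
Lemma head_integral_conv t (g h : R -> R[i]) : cmeas g -> cmeas h ->
  (forall x, x <= 0 -> g x = 0) -> (forall x, x <= 0 -> h x = 0) ->
  (head_integral t (conv g h) <= head_integral t g * head_integral t h)%E.
Proof.
move=> mg mh g0 h0.
have H0 (k : R -> R[i]) u : (0 <= (if (0 < u < t)%R then cmodulus (k u) else 0%R)%:E)%E.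
  by rewrite lee_fin; case: ifP => // _; exact: cmodulus_ge0.
have Mg := @measurable_head_integrand t g mg.
have Mh := @measurable_head_integrand t h mh.
rewrite /head_integral -(ge0_integral_conv Mg Mh)//.
have mc := cmeas_conv_integrand mg mh.
have mF : measurable_fun setT (fun q : R * R =>
    (if (0 < q.1 - q.2 < t)%R then cmodulus (g (q.1 - q.2)) else 0%R)%:E *
    (if (0 < q.2 < t)%R then cmodulus (h q.2) else 0%R)%:E)%E.
  apply: emeasurable_funM; last exact: (measurableT_comp Mh measurable_snd).
  apply: (measurableT_comp Mg).
  by apply: measurable_funB; [exact: measurable_fst|exact: measurable_snd].
apply: ge0_le_integral => //; first exact: (measurable_head_integrand t (cmeas_conv mg mh)).
  exact: (@measurable_fun_fubini_tonelli_F _ _ _ _ R mu _ mF (fun q => mule_ge0 (H0 g _) (H0 h _))).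
move=> u _; case: ifP => [/andP[u0 ut]|_]; last by apply: integral_ge0 => r _; exact: mule_ge0.
have mgh : cmeas (fun r : R => g (u - r) * h r) by exact: (cmeas_section u (cmeas_conv_integrand
  mg mh)).
have le : (\int[mu]_r (cmodulus (g (u - r) * h r)%R)%:E <=
   \int[mu]_r ((if (0 < u - r < t)%R then cmodulus (g (u - r)) else 0%R)%:E *
    (if (0 < r < t)%R then cmodulus (h r) else 0%R)%:E))%E.
  apply: ge0_le_integral => //.
  - by move=> r _; rewrite lee_fin cmodulus_ge0.
  - by apply/measurable_EFinP; exact: measurable_cmodulus.
  - by apply: emeasurable_funM => //; apply: (measurableT_comp Mg); exact: measurable_funB.
  move=> r _; have [r0|r0] := leP r 0.
    by rewrite h0// mulr0 cmodulus0 mule_ge0.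
  have [ur|ru] := leP u r.
    have -> : g (u - r) * h r = 0 by rewrite g0 ?mul0r// subr_le0.
    rewrite cmodulus0; apply: mule_ge0; first exact: (H0 g (u - r)).
    by rewrite lee_fin; case: ifP => // _; exact: cmodulus_ge0.
  by rewrite subr_gt0 ru (lt_trans ru ut) ltrBlDr (lt_trans ut) ?ltrDl// cmodulusM.
apply: le_trans le.
(* Where the defining integral of the convolution diverges, its value is a default one and the bound
   is trivially infinite. *)
have [cu|cu] := ltP (\int[mu]_r (cmodulus (g (u - r) * h r)%R)%:E)%E +oo%E.
  exact: (le_cmodulus_cint (conj mgh cu)).
exact: le_trans (leey _) cu.
Qed.

End head_integrals.

Section renewal.
Context {R : realType}.
Local Notation mu := (@lebesgue_measure R).
Variables (p s : R -> R[i]) (a : R).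
Hypotheses (causal_p : forall x, x <= 0 -> p x = 0)
  (causal_s : forall x, x <= 0 -> s x = 0).
Hypotheses (mp : cmeas p) (ms : cmeas s) (a_gt0 : 0 < a).
Hypothesis Lp : cL1 (fun x => p x * expz a%:C x).
Hypothesis Ls : cL1 (fun x => s x * expz a%:C x).
Hypothesis Wp : (\int[mu]_x ((cmodulus (p x)) ^+ 2 * Num.min 1 x)%:E < +oo)%E.

(* In the paper's notation, [hankel (x, y)] is [phi (x + y)], [renewal_kernel] is
   [k], and [op_kernel t] is the kernel [k (t - x, y)] of [K_t]. *)
Definition hankel (q : R * R) : R[i] :=
  if 0 < q.1 then (if 0 < q.2 then p (q.1 + q.2) else 0) else 0.

Lemma cmeas_hankel : cmeas hankel.
Proof.
apply: cmeas_if; [|apply: cmeas_if|exact: cmeas_cst].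
- by apply: measurable_fun_ltr => //; exact: measurable_fst.
- by apply: measurable_fun_ltr => //; exact: measurable_snd.
- apply: (cmeas_comp _ mp); apply: measurable_funD; [exact: measurable_fst|exact: measurable_snd].
- exact: cmeas_cst.
Qed.

Lemma hankel_le0 u y : u <= 0 -> hankel (u, y) = 0.
Proof. by rewrite /hankel /= ltNge => ->. Qed.

(** For [u > 0] this is the tail [\int_u^oo |phi|^2], which may be unbounded as [u] tends to 0. *)
Definition hankel_sq u : \bar R := sqint (fun y => hankel (u, y)).

Lemma hankel_sq_ge0 u : (0 <= hankel_sq u)%E. Proof. exact: sqint_ge0. Qed.

Lemma measurable_hankel_sq : measurable_fun setT hankel_sq.
Proof. exact: (measurable_sqint_section cmeas_hankel). Qed.

Definition weight (x : R) := expR (- (a * x)).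

Lemma measurable_weight : measurable_fun setT weight.
Proof.
rewrite /weight; under eq_fun do rewrite -mulNr.
exact: (measurableT_comp (@measurable_expR R) (measurable_mull (- a))).
Qed.

(* Fubini reduces this to [\int_0^w e^{- a u} du <= (1 + 1/a) min(1, w)]. *)
Lemma weighted_hankel_sq : (\int[mu]_u ((weight u)%:E * hankel_sq u) < +oo)%E.
Proof.
(* [E] is [hankel] in the coordinates [(u, w)] with [w = u + y]: the value [p w] no longer depends
   on [u], which enters only through [0 < u < w]. *)
pose E (q : R * R) : R[i] := if 0 < q.1 then (if q.1 < q.2 then p q.2 else 0) else 0.
have mE : cmeas E.
  apply: cmeas_if; [|apply: cmeas_if|exact: cmeas_cst].
  - by apply: measurable_fun_ltr => //; exact: measurable_fst.
  - exact: (measurable_fun_ltr measurable_fst measurable_snd).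
  - by apply: (cmeas_comp _ mp); exact: measurable_snd.
  - exact: cmeas_cst.
pose H (q : R * R) := ((weight q.1)%:E * ((cmodulus (E q)) ^+ 2)%:E)%E.
have mH : measurable_fun setT H.
  apply: emeasurable_funM; last exact: measurable_sqmod.
  apply/measurable_EFinP; apply: (measurableT_comp measurable_weight).
  exact: measurable_fst.
have H0 q : (0 <= H q)%E by rewrite mule_ge0 ?lee_fin ?sqr_ge0 ?expR_ge0.
have -> : (\int[mu]_u ((weight u)%:E * hankel_sq u) = \int[mu]_u \int[mu]_w H (u, w))%E.
  apply: eq_integral => u _.
  have mHu : measurable_fun setT (fun w => ((cmodulus (E (u, w))) ^+ 2)%:E).
    by apply: measurable_sqmod; exact: (cmeas_section u mE).
  rewrite /H /= [RHS]ge0_integralZl_EFin ?expR_ge0//; last first.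
    by move=> y _; rewrite lee_fin sqr_ge0.
  congr (_ * _)%E; rewrite -(ge0_integral_shift u mHu); last first.
    by move=> y; rewrite lee_fin sqr_ge0.
  apply: eq_integral => y _; congr ((cmodulus _) ^+ 2)%:E.
  by rewrite /hankel /E /= ltrDr addrC.
rewrite (@fubini_tonelli _ _ _ _ R mu mu _ mH)//.
apply: (@le_lt_trans _ _ (\int[mu]_w ((1 + a^-1)%:E * ((cmodulus (p w)) ^+ 2 * Num.min 1 w)%:E))%E).
  apply: ge0_le_integral => //.
  - by move=> w _; exact: integral_ge0.
  - exact: (@measurable_fun_fubini_tonelli_G _ _ _ _ R mu _ mH).
  - apply: emeasurable_funM => //; apply/measurable_EFinP; apply: measurable_funM.
      by apply: measurable_funX; exact: measurable_cmodulus.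
    by apply: measurable_minr => //; exact: measurable_cst.
  move=> w _; have [w0|w0] := leP w 0.
    rewrite causal_p// cmodulus0 expr0n/= mul0r mule0.
    rewrite (_ : (\int[mu]_x _)%E = 0%E)//.
    rewrite -[RHS](integral0 mu setT); apply: eq_integral => u _.
    rewrite /H /E /=; case: ifP => u0; last by rewrite cmodulus0 expr0n mule0.
    by rewrite ltNge (le_trans w0 (ltW u0)) cmodulus0 expr0n mule0.
  pose J u := if (0 < u) && (u < w) then weight u else 0.
  have mJ : measurable_fun setT (fun u => (J u)%:E).
    apply/measurable_EFinP; apply: measurable_fun_ifT => //; last exact: measurable_weight.
    by apply: measurable_and; exact: measurable_fun_ltr.
  have J0 u : (0 <= (J u)%:E)%E by rewrite lee_fin /J; case: ifP => // _; exact: expR_ge0.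
  have -> : (\int[mu]_u H (u, w) = ((cmodulus (p w)) ^+ 2)%:E * \int[mu]_u (J u)%:E)%E.
    rewrite -ge0_integralZl_EFin ?sqr_ge0//.
    apply: eq_integral => u _.
    rewrite /H /E /J /=; case: ifP => _ /=; last by rewrite cmodulus0 expr0n !mule0.
    by case: ifP => _ /=; [rewrite muleC|rewrite cmodulus0 expr0n !mule0].
  rewrite (EFinM (cmodulus (p w) ^+ 2)) muleCA; apply: lee_wpmul2l; first by rewrite lee_fin
    sqr_ge0.
  have I1 : (\int[mu]_u (J u)%:E <= w%:E)%E.
    apply: (@le_trans _ _ (\int[mu]_u (\1_(`]0, w[) u)%:E)%E).
      have mI : measurable_fun setT (fun u : R => (\1_(`]0, w[) u : R)%:E).
        by apply/measurable_EFinP; exact: measurable_indic.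
      apply: ge0_le_integral => //.
      move=> u _; rewrite lee_fin /J indicE mem_setE in_itv/=.
      case: ifP => // /andP[u0 uw]; rewrite -expR0 /weight ler_expR oppr_le0.
      by rewrite mulr_ge0// ltW.
    rewrite integral_indic// setIT.
    by have /= := lebesgue_measure_itv `]0, w[; rewrite lte_fin w0 sube0 => ->.
  have I2 : (\int[mu]_u (J u)%:E <= (a^-1)%:E)%E.
    rewrite -(integral_exp_halfline a_gt0); apply: ge0_le_integral => //.
      apply/measurable_EFinP; apply: measurable_fun_ifT => //; last exact: measurable_weight.
      exact: measurable_gt0.
    move=> u _; rewrite lee_fin /J; case: (0 < u) => //=; case: ifP => // _.
  have ia0 : 0 <= a^-1 by rewrite invr_ge0 ltW.
  rewrite -EFinM; have [w1|w1] := leP 1 w.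
    by rewrite mulr1; apply: le_trans I2 _; rewrite lee_fin lerDr.
  by apply: le_trans I1 _; rewrite lee_fin mulrDl mul1r lerDl mulr_ge0// ltW.
rewrite ge0_integralZl_EFin ?addr_ge0// ?invr_ge0 ?ltW//.
- by apply: lte_mul_pinfty; rewrite ?lee_fin ?addr_ge0 ?invr_ge0 ?ltW.
- move=> w _; rewrite lee_fin; have [w0|w0] := leP w 0.
    by rewrite causal_p// cmodulus0 expr0n mul0r.
  by rewrite mulr_ge0 ?sqr_ge0// le_min ler01 ltW.
- apply/measurable_EFinP; apply: measurable_funM.
    by apply: measurable_funX; exact: measurable_cmodulus.
  by apply: measurable_minr => //; exact: measurable_cst.
Qed.

(** * Square integrability of the renewal kernel *)

Definition memory_kernel (q : R * R) : R[i] :=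
  cint setT (fun r => hankel (q.1 - r, q.2) * s r).

Definition renewal_kernel (q : R * R) : R[i] := hankel q + memory_kernel q.

Let cmeas_memory_integrand :
  cmeas (fun t : (R * R) * R => hankel (t.1.1 - t.2, t.1.2) * s t.2).
Proof.
apply: cmeasM; last by apply: (cmeas_comp _ ms); exact: measurable_snd.
apply: (cmeas_comp _ cmeas_hankel); apply: measurable_fun_pair.
  apply: measurable_funB; last exact: measurable_snd.
  exact: (measurableT_comp measurable_fst measurable_fst).
exact: (measurableT_comp measurable_snd measurable_fst).
Qed.

Lemma cmeas_memory_kernel : cmeas memory_kernel.
Proof. exact: (cmeas_cint_param cmeas_memory_integrand). Qed.

Lemma cmeas_renewal_kernel : cmeas renewal_kernel.
Proof. by apply: cmeasD; [exact: cmeas_hankel|exact: cmeas_memory_kernel]. Qed.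

Lemma renewal_kernel_le0 u y : u <= 0 -> renewal_kernel (u, y) = 0.
Proof.
move=> u0; rewrite /renewal_kernel hankel_le0// add0r /memory_kernel /=.
rewrite -[RHS](@cint0 R setT); congr cint; apply/funext => r.
have [r0|r0] := leP r 0; first by rewrite causal_s// mulr0.
by rewrite hankel_le0 ?mul0r// subr_le0 (le_trans u0)// ltW.
Qed.

Definition mass (t : R) : \bar R :=
  (\int[mu]_r (if r < t then cmodulus (s r) else 0)%:E)%E.

Let measurable_mass t : measurable_fun setT (fun r : R => (if r < t then cmodulus (s r) else 0)%:E).
Proof.
apply/measurable_EFinP; apply: measurable_fun_ifT => //; last exact: measurable_cmodulus.
exact: measurable_fun_ltr.
Qed.

Lemma mass_ge0 t : (0 <= mass t)%E.
Proof. by apply: integral_ge0 => r _; rewrite lee_fin; case: ifP => // _; exact: cmodulus_ge0. Qed.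

Lemma le_mass t t' : t <= t' -> (mass t <= mass t')%E.
Proof.
move=> tt'; apply: ge0_le_integral => //.
- by move=> r _; rewrite lee_fin; case: ifP => // _; exact: cmodulus_ge0.
- exact: measurable_mass.
- exact: measurable_mass.
- move=> r _; rewrite lee_fin; case: ifP => [rt|_]; first by rewrite (lt_le_trans rt).
  by case: ifP => // _; exact: cmodulus_ge0.
Qed.

Lemma mass_lty t : (mass t < +oo)%E.
Proof.
have [_] := cL1Z (expR (a * t))%:C Ls; apply: le_lt_trans.
apply: ge0_le_integral => //.
- by move=> r _; rewrite lee_fin; case: ifP => // _; exact: cmodulus_ge0.
- exact: measurable_mass.
- apply/measurable_EFinP; apply: measurable_cmodulus.
  by case: (cL1Z (expR (a * t))%:C Ls).
move=> r _; rewrite lee_fin; case: ifP => [rt|_]; last exact: cmodulus_ge0.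
rewrite cmodulusM cmodulus_mul_expz cmodulus_exp mulrCA ler_peMr ?cmodulus_ge0//.
rewrite -expRD -expR0 ler_expR /= -mulrBr mulr_ge0 ?ltW// subr_gt0//.
Qed.

(** Cauchy-Schwarz with respect to [|s r| dr] on [r < u], obtained by splitting [|s|] into two
    square roots. The [+ 1] keeps the factor positive: when the integral is infinite the bound must
    be infinite too, whereas [0 * +oo = 0]. *)
Lemma memory_kernel_sq u y : (((cmodulus (memory_kernel (u, y))) ^+ 2)%:E <=
  (mass u + 1) * \int[mu]_r ((cmodulus (hankel (u - r, y))) ^+ 2 * cmodulus (s r))%:E)%E.
Proof.
set A := (\int[mu]_r _)%E.
have A0 : (0 <= A)%E.
  by apply: integral_ge0 => r _; rewrite lee_fin mulr_ge0 ?sqr_ge0 ?cmodulus_ge0.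
have [Ay|/negPf Ay] := eqVneq A +oo%E.
  rewrite Ay gt0_muley ?leey//; apply: (@lt_le_trans _ _ 1%E); first exact: lte01.
  by rewrite leeDr// mass_ge0.
have {}Ay : (A < +oo)%E by rewrite ltey Ay.
have mh : cmeas (fun r : R => hankel (u - r, y)).
  apply: (cmeas_comp _ cmeas_hankel); apply: measurable_fun_pair => //.
  exact: measurable_funB.
have mcs := measurable_cmodulus ms; have mch := measurable_cmodulus mh.
have mq : measurable_fun setT (fun r => Num.sqrt (cmodulus (s r))).
  exact: (measurableT_comp (continuous_measurable_fun (@sqrt_continuous R)) mcs).
pose f1 r : R[i] := (cmodulus (hankel (u - r, y)) * Num.sqrt (cmodulus (s r)))%:C.
pose f2 r : R[i] := (if r < u then Num.sqrt (cmodulus (s r)) else 0)%:C.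
have mf1 : cmeas f1 by apply: cmeas_real; exact: measurable_funM.
have mf2 : cmeas f2.
  apply: cmeas_real; apply: measurable_fun_ifT => //; exact: measurable_fun_ltr.
have E1 : sqint f1 = A.
  apply: eq_integral => r _; congr EFin.
  by rewrite /f1 cmodulusC real_normK ?num_real// exprMn sqr_sqrtr ?cmodulus_ge0.
have E2 : sqint f2 = mass u.
  apply: eq_integral => r _; congr EFin.
  rewrite /f2 cmodulusC real_normK ?num_real//; case: ifP => _; last by rewrite expr0n.
  by rewrite sqr_sqrtr ?cmodulus_ge0.
have E12 r : cmodulus (f1 r * f2 r) = cmodulus (hankel (u - r, y) * s r).
  rewrite /f1 /f2 -rmorphM cmodulusC cmodulusM ger0_norm; last first.
    by rewrite !mulr_ge0 ?cmodulus_ge0 ?sqrtr_ge0//; case: ifP => // _; exact: sqrtr_ge0.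
  case: ltP => ru; first by rewrite -mulrA -expr2 sqr_sqrtr ?cmodulus_ge0.
  by rewrite mulr0 hankel_le0 ?subr_le0// cmodulus0 mul0r.
have [||[L1 L2] CS] := @Cauchy_Schwarz R f1 f2 mf1 mf2.
- by rewrite E1.
- by rewrite E2 mass_lty.
have Lh : cL1 (fun r => hankel (u - r, y) * s r).
  by split; [exact: cmeasM|under eq_integral do rewrite -E12].
rewrite EFin_expe.
apply: (@le_trans _ _ ((\int[mu]_x (cmodulus (f1 x * f2 x))%:E) ^+ 2)%E).
  rewrite lee_sqr ?lee_fin ?cmodulus_ge0//; last first.
    by apply: integral_ge0 => r _; rewrite lee_fin cmodulus_ge0.
  apply: le_trans (le_cmodulus_cint Lh) _.
  by under [leRHS]eq_integral do rewrite E12.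
apply: le_trans CS _; rewrite E1 E2 muleC; apply: lee_wpmul2r => //.
by rewrite leeDl.
Qed.

Let measurable_hankel_s u : measurable_fun setT (fun r : R => (hankel_sq (u - r) * (cmodulus (s
  r))%:E)%E).
Proof.
have msub : measurable_fun setT (fun r : R => u - r) by exact: measurable_funB.
apply: emeasurable_funM; first exact: (measurableT_comp measurable_hankel_sq msub).
by apply/measurable_EFinP; exact: measurable_cmodulus.
Qed.

Definition hankel_conv u : \bar R :=
  (\int[mu]_r (hankel_sq (u - r) * (cmodulus (s r))%:E))%E.

Lemma hankel_conv_ge0 u : (0 <= hankel_conv u)%E.
Proof.
by apply: integral_ge0 => r _; rewrite mule_ge0 ?hankel_sq_ge0// lee_fin cmodulus_ge0.
Qed.

Lemma sqint_memory_kernel u :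
  (sqint (fun y => memory_kernel (u, y)) <= (mass u + 1) * hankel_conv u)%E.
Proof.
have mF : measurable_fun setT (fun q : R * R =>
    ((cmodulus (hankel (u - q.2, q.1))) ^+ 2 * cmodulus (s q.2))%:E).
  apply/measurable_EFinP; apply: measurable_funM.
    apply: measurable_funX; apply: measurable_cmodulus.
    apply: (cmeas_comp _ cmeas_hankel); apply: measurable_fun_pair; last exact: measurable_fst.
    by apply: measurable_funB => //; exact: measurable_snd.
  exact: (measurableT_comp (measurable_cmodulus ms) measurable_snd).
have F0 (q : R * R) : (0 <= ((cmodulus (hankel (u - q.2, q.1))) ^+ 2 * cmodulus (s q.2))%:E)%E.
  by rewrite lee_fin mulr_ge0 ?sqr_ge0 ?cmodulus_ge0.
have m1 : (0 <= mass u + 1)%E by rewrite adde_ge0 ?mass_ge0.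
apply: (@le_trans _ _ (\int[mu]_y ((mass u + 1) *
    \int[mu]_r ((cmodulus (hankel (u - r, y))) ^+ 2 * cmodulus (s r))%:E))%E).
  apply: ge0_le_integral => //.
  - by move=> y _; rewrite lee_fin sqr_ge0.
  - by apply: measurable_sqmod; exact: (cmeas_section u cmeas_memory_kernel).
  - apply: emeasurable_funM => //.
    exact: (@measurable_fun_fubini_tonelli_F _ _ _ _ R mu _ mF F0).
  - by move=> y _; exact: memory_kernel_sq.
rewrite ge0_integralZl//; last 2 first.
- exact: (@measurable_fun_fubini_tonelli_F _ _ _ _ R mu _ mF F0).
- by move=> y _; apply: integral_ge0 => r _; exact: (F0 (y, r)).
apply: lee_wpmul2l => //.
rewrite (@fubini_tonelli _ _ _ _ R mu mu _ mF F0) /=.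
apply: ge0_le_integral => //.
- by move=> r _; apply: integral_ge0 => y _; exact: (F0 (y, r)).
- exact: (@measurable_fun_fubini_tonelli_G _ _ _ _ R mu _ mF F0).
- exact: measurable_hankel_s.
move=> r _; under eq_integral do rewrite EFinM.
rewrite ge0_integralZr//.
- by apply: measurable_sqmod; exact: (cmeas_section (u - r) cmeas_hankel).
- by move=> y _; rewrite lee_fin sqr_ge0.
- by rewrite lee_fin cmodulus_ge0.
Qed.

Lemma weightD x y : weight (x + y) = weight x * weight y.
Proof. by rewrite /weight -expRD; congr expR; ring. Qed.

(** Since the weight is multiplicative, the weighted integral of this convolution is the product of
    the weighted integrals of [hankel_sq] and of [|s|]. *)
Lemma weighted_hankel_conv : (\int[mu]_u ((weight u)%:E * hankel_conv u) < +oo)%E.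
Proof.
have mA : measurable_fun setT (fun u => (weight u)%:E * hankel_sq u)%E.
  apply: emeasurable_funM; last exact: measurable_hankel_sq.
  by apply/measurable_EFinP; exact: measurable_weight.
have mB : measurable_fun setT (fun r => (cmodulus (s r * expz a%:C r))%:E).
  by apply/measurable_EFinP; apply: measurable_cmodulus; case: Ls.
have A0 u : (0 <= (weight u)%:E * hankel_sq u)%E.
  by rewrite mule_ge0 ?lee_fin ?expR_ge0// hankel_sq_ge0.
have B0 r : (0 <= (cmodulus (s r * expz a%:C r))%:E)%E by rewrite lee_fin cmodulus_ge0.
have -> : (\int[mu]_u ((weight u)%:E * hankel_conv u) =
    \int[mu]_u \int[mu]_r (((weight (u - r)%R)%:E * hankel_sq (u - r)%R) *
                            (cmodulus (s r * expz a%:C r))%:E))%E.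
  apply: eq_integral => u _; rewrite -ge0_integralZl_EFin ?expR_ge0//; last 2 first.
  - by move=> r _; rewrite mule_ge0 ?hankel_sq_ge0// lee_fin cmodulus_ge0.
  - exact: measurable_hankel_s.
  apply: eq_integral => r _; rewrite cmodulus_mul_expz /= -/(weight r) EFinM.
  have -> : weight u = weight (u - r) * weight r by rewrite -weightD subrK.
  by rewrite EFinM muleACA [((weight r)%:E * _)%E]muleC.
rewrite (ge0_integral_conv mA mB A0 B0); apply: lte_mul_pinfty.
- exact: integral_ge0.
- by rewrite ge0_fin_numE ?weighted_hankel_sq//; exact: integral_ge0.
- by case: Ls.
Qed.

(** On [u < t] the weight is at least [e^{- a t}] and [mass u <= mass t], so the weighted global
    bounds yield an unweighted bound up to [t]. *)
Lemma sqint_renewal_kernel_lty t :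
  (\int[mu]_u (if (u < t)%R then sqint (fun y => renewal_kernel (u, y)) else 0) < +oo)%E.
Proof.
have mt : (mass t + 1)%E \is a fin_num.
  by rewrite fin_numD ge0_fin_numE ?mass_ge0// mass_lty.
have mt0 : (0 <= mass t + 1)%E by rewrite adde_ge0 ?mass_ge0.
set C := fine (mass t + 1)%E.
have C0 : 0 <= C by exact: fine_ge0.
have mhc : measurable_fun setT hankel_conv.
  have mG : measurable_fun setT (fun q : R * R => (hankel_sq (q.1 - q.2) * (cmodulus (s
    q.2))%:E)%E).
    apply: emeasurable_funM.
      apply: (measurableT_comp measurable_hankel_sq).
      by apply: measurable_funB; [exact: measurable_fst|exact: measurable_snd].
    apply/measurable_EFinP.
    exact: (measurableT_comp (measurable_cmodulus ms) measurable_snd).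
  apply: (@measurable_fun_fubini_tonelli_F _ _ _ _ R mu _ mG) => q.
  by rewrite mule_ge0 ?hankel_sq_ge0// lee_fin cmodulus_ge0.
have mwt : measurable_fun setT (EFin \o weight).
  by apply/measurable_EFinP; exact: measurable_weight.
have m1 : measurable_fun setT (fun u => (weight u)%:E * hankel_sq u)%E.
  by apply: emeasurable_funM => //; exact: measurable_hankel_sq.
have m2 : measurable_fun setT (fun u => (weight u)%:E * hankel_conv u)%E.
  by apply: emeasurable_funM.
have w1 u : (0 <= (weight u)%:E * hankel_sq u)%E.
  by rewrite mule_ge0 ?hankel_sq_ge0// lee_fin expR_ge0.
have w2 u : (0 <= (weight u)%:E * hankel_conv u)%E.
  by rewrite mule_ge0 ?hankel_conv_ge0// lee_fin expR_ge0.
apply: (@le_lt_trans _ _ (\int[mu]_u (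
    (expR (a * t) * 2)%:E * ((weight u)%:E * hankel_sq u) +
    (expR (a * t) * (2 * C))%:E * ((weight u)%:E * hankel_conv u)))%E).
  apply: ge0_le_integral => //.
  - by move=> u _; case: ifP => // _; exact: sqint_ge0.
  - apply: measurable_fun_ifT => //; first exact: measurable_fun_ltr.
    exact: (measurable_sqint_section cmeas_renewal_kernel).
  - by apply: emeasurable_funD; apply: emeasurable_funM.
  move=> u _; have R0 : (0 <= (expR (a * t) * 2)%:E * ((weight u)%:E * hankel_sq u) +
    (expR (a * t) * (2 * C))%:E * ((weight u)%:E * hankel_conv u))%E.
    by rewrite adde_ge0// mule_ge0// lee_fin !mulr_ge0// expR_ge0.
  case: ifP => // ut.
  apply: le_trans (sqintD (cmeas_section u cmeas_hankel) (cmeas_section u cmeas_memory_kernel)) _.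
  have ew : 1 <= expR (a * t) * weight u.
    by rewrite /weight -expRD -expR0 ler_expR -mulrBr mulr_ge0 ?subr_ge0 ?ltW.
  apply: leeD.
  - rewrite -/(hankel_sq u) muleA -EFinM; apply: lee_wpmul2r; first exact: hankel_sq_ge0.
    by rewrite lee_fin mulrAC ler_peMl.
  - rewrite muleA -EFinM.
    apply: (@le_trans _ _ (2%:E * (C%:E * hankel_conv u))%E).
      apply: lee_wpmul2l => //; apply: le_trans (sqint_memory_kernel u) _.
      apply: lee_wpmul2r; first exact: hankel_conv_ge0.
      by rewrite /C fineK//; apply: leeD => //; apply: le_mass; exact: ltW.
    rewrite muleA -EFinM; apply: lee_wpmul2r; first exact: hankel_conv_ge0.
    by rewrite lee_fin mulrAC ler_peMl// mulr_ge0.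
rewrite ge0_integralD//; last 4 first.
- by move=> u _; rewrite mule_ge0// lee_fin mulr_ge0// expR_ge0.
- by apply: emeasurable_funM.
- by move=> u _; rewrite mule_ge0// lee_fin !mulr_ge0// expR_ge0.
- by apply: emeasurable_funM.
rewrite !ge0_integralZl_EFin//; try by rewrite !mulr_ge0// expR_ge0.
apply: lte_add_pinfty; apply: lte_mul_pinfty => //;
  rewrite ?lee_fin ?mulr_ge0 ?expR_ge0//.
- exact: weighted_hankel_sq.
- exact: weighted_hankel_conv.
Qed.

Definition op_kernel t (q : R * R) : R[i] :=
  if 0 < q.1 then renewal_kernel (t - q.1, q.2) else 0.

Lemma cmeas_op_kernel t : cmeas (op_kernel t).
Proof.
apply: cmeas_if; [|apply: (cmeas_comp _ cmeas_renewal_kernel)|exact: cmeas_cst].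
  by apply: measurable_fun_ltr => //; exact: measurable_fst.
apply: measurable_fun_pair; last exact: measurable_snd.
by apply: measurable_funB => //; exact: measurable_fst.
Qed.

(** The reflection [u = t - x] turns the row at [x > 0] into the row of [renewal_kernel] at
    [u < t]. *)
Lemma hs_norm2_op_kernel t : (hs_norm2 (op_kernel t) < +oo)%E.
Proof.
apply: le_lt_trans (sqint_renewal_kernel_lty t).
pose g (u : R) := (if (u < t)%R then sqint (fun y => renewal_kernel (u, y)) else 0)%E.
have mg : measurable_fun setT g.
  apply: measurable_fun_ifT => //; first exact: measurable_fun_ltr.
  exact: (measurable_sqint_section cmeas_renewal_kernel).
have g0 u : (0 <= g u)%E by rewrite /g; case: ifP => // _; exact: sqint_ge0.
rewrite -/g -(ge0_integral_reflect t mg g0) /hs_norm2 le_eqVlt; apply/orP; left.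
apply/eqP/eq_integral => x _; rewrite /g /op_kernel /= ltrBlDr ltrDl.
case: ifP => // _; rewrite /sqint; under eq_integral do rewrite cmodulus0 expr0n.
by rewrite integral0.
Qed.

(** Fubini provides integrability of the product only, at points where the factor [c] may well
    vanish and [f] need not be integrable. *)
Lemma cintZ_cL1 (c : R[i]) f : cL1 (fun x => c * f x) ->
  cint setT (fun x => c * f x) = c * cint setT f.
Proof.
move=> Lcf; have [c0|c0] := eqVneq c 0.
  rewrite c0 mul0r -[RHS](@cint0 R setT); congr cint.
  by apply/funext => x; rewrite mul0r.
rewrite cintZ//; move: Lcf => /(cL1Z c^-1); congr cL1.
by apply/funext => x; rewrite mulKf.
Qed.

Section one_function.
Variable f : R -> R[i].
Hypotheses (mf : cmeas f) (fi : (sqint f < +oo)%E).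

(** The function [w] of the overview; [forcing] is its [F f]. *)
Definition response : R -> R[i] := kop renewal_kernel f.

Definition forcing : R -> R[i] := kop hankel f.

Lemma cmeas_response : cmeas response.
Proof. exact: (cmeas_kop cmeas_renewal_kernel mf). Qed.

Lemma cmeas_forcing : cmeas forcing.
Proof. exact: (cmeas_kop cmeas_hankel mf). Qed.

Lemma response_le0 u : u <= 0 -> response u = 0.
Proof.
move=> u0; rewrite /response /kop -[RHS](@cint0 R setT); congr cint.
by apply/funext => y; rewrite renewal_kernel_le0// mul0r.
Qed.

Lemma forcing_le0 u : u <= 0 -> forcing u = 0.
Proof.
move=> u0; rewrite /forcing /kop -[RHS](@cint0 R setT); congr cint.
by apply/funext => y; rewrite hankel_le0// mul0r.
Qed.

Lemma kop_op_kernel t x :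
  kop (op_kernel t) f x = if 0 < x then response (t - x) else 0.
Proof.
rewrite /kop /op_kernel /=; case: ifP => // _.
by rewrite -[RHS](@cint0 R setT); congr cint; apply/funext => y; rewrite mul0r.
Qed.

Lemma integral_hankel_mul u :
  (\int[mu]_y (cmodulus (hankel (u, y) * f y))%:E <= hankel_sq u + sqint f)%E.
Proof.
rewrite /hankel_sq /sqint -ge0_integralD//; last 4 first.
- by move=> y _; rewrite lee_fin sqr_ge0.
- by apply: measurable_sqmod; exact: (cmeas_section u cmeas_hankel).
- by move=> y _; rewrite lee_fin sqr_ge0.
- exact: measurable_sqmod.
apply: ge0_le_integral => //.
- by move=> y _; rewrite lee_fin cmodulus_ge0.
- apply/measurable_EFinP; apply: measurable_cmodulus; apply: cmeasM => //.
  exact: (cmeas_section u cmeas_hankel).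
- apply: emeasurable_funD; apply: measurable_sqmod => //.
  exact: (cmeas_section u cmeas_hankel).
move=> y _; rewrite -EFinD lee_fin cmodulusM.
have := sqr_ge0 (cmodulus (hankel (u, y)) - cmodulus (f y)).
have := cmodulus_ge0 (hankel (u, y)); have := cmodulus_ge0 (f y).
by move: (cmodulus _) (cmodulus _) => *; nra.
Qed.

Lemma ae_hankel_sq_lty : {ae mu, forall u, (hankel_sq u < +oo)%E}.
Proof.
have : mu.-integrable setT (fun u => (weight u)%:E * hankel_sq u)%E.
  apply/integrableP; split.
    apply: emeasurable_funM; last exact: measurable_hankel_sq.
    by apply/measurable_EFinP; exact: measurable_weight.
  under eq_integral do rewrite gee0_abs ?mule_ge0 ?hankel_sq_ge0 ?lee_fin ?expR_ge0//.
  exact: weighted_hankel_sq.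
move/integrable_ae => /(_ measurableT); apply: ae_imply => u /(_ I).
case: (hankel_sq u) (hankel_sq_ge0 u) => [r|_|//]; first by rewrite ltry.
by rewrite gt0_muley// lte_fin expR_gt0.
Qed.

Lemma ae_hankel_conv_lty : {ae mu, forall u, (hankel_conv u < +oo)%E}.
Proof.
have mG : measurable_fun setT (fun q : R * R => (hankel_sq (q.1 - q.2) * (cmodulus (s q.2))%:E)%E).
  apply: emeasurable_funM.
    apply: (measurableT_comp measurable_hankel_sq).
    by apply: measurable_funB; [exact: measurable_fst|exact: measurable_snd].
  apply/measurable_EFinP.
  exact: (measurableT_comp (measurable_cmodulus ms) measurable_snd).
have : mu.-integrable setT (fun u => (weight u)%:E * hankel_conv u)%E.
  apply/integrableP; split.
    apply: emeasurable_funM; first by apply/measurable_EFinP; exact: measurable_weight.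
    apply: (@measurable_fun_fubini_tonelli_F _ _ _ _ R mu _ mG) => q.
    by rewrite mule_ge0 ?hankel_sq_ge0// lee_fin cmodulus_ge0.
  under eq_integral do rewrite gee0_abs ?mule_ge0 ?hankel_conv_ge0 ?lee_fin ?expR_ge0//.
  exact: weighted_hankel_conv.
move/integrable_ae => /(_ measurableT); apply: ae_imply => u /(_ I).
case: (hankel_conv u) (hankel_conv_ge0 u) => [r|_|//]; first by rewrite ltry.
by rewrite gt0_muley// lte_fin expR_gt0.
Qed.

Lemma cL1_hankel_mul u : (hankel_sq u < +oo)%E -> cL1 (fun y => hankel (u, y) * f y).
Proof. by move=> hu; apply: cL1_mul => //; exact: (cmeas_section u cmeas_hankel). Qed.

(** Fubini moves the integral over the memory variable [r] outside the one over [y]. The integrand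
    is at most [|s r| (|hankel (u - r, y)|^2 + |f y|^2)] and vanishes for [r >= u], so this is
    legitimate wherever [hankel_conv u] is finite, the mass of [s] below [u] being finite. *)
Lemma ae_response : {ae mu, forall u, response u = forcing u + conv forcing s u}.
Proof.
apply: ae_imply2 ae_hankel_sq_lty ae_hankel_conv_lty => u hu cu.
pose F (q : R * R) := hankel (u - q.2, q.1) * s q.2 * f q.1.
have mhs : cmeas (fun q : R * R => hankel (u - q.2, q.1) * s q.2).
  apply: cmeasM; last by apply: (cmeas_comp _ ms); exact: measurable_snd.
  apply: (cmeas_comp _ cmeas_hankel); apply: measurable_fun_pair; last exact: measurable_fst.
  by apply: measurable_funB => //; exact: measurable_snd.
have mF : cmeas F by apply: cmeasM => //; apply: (cmeas_comp _ mf); exact: measurable_fst.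
have iF : (\int[mu]_y \int[mu]_r (cmodulus (F (y, r)))%:E < +oo)%E.
  rewrite Tonelli_cmodulus//.
  apply: (@le_lt_trans _ _ (\int[mu]_r (hankel_sq (u - r)%R * (cmodulus (s r))%:E +
      (if (r < u)%R then cmodulus (s r) else 0)%:E * sqint f))%E).
    apply: ge0_le_integral => //.
    - by move=> r _; apply: integral_ge0 => y _; rewrite lee_fin cmodulus_ge0.
    - have mE : measurable_fun setT (fun q => (cmodulus (F q))%:E).
        by apply/measurable_EFinP; exact: measurable_cmodulus.
      apply: (@measurable_fun_fubini_tonelli_G _ _ _ _ R mu _ mE) => q.
      by rewrite lee_fin cmodulus_ge0.
    - apply: emeasurable_funD; first exact: measurable_hankel_s.
      by apply: emeasurable_funM => //; exact: measurable_mass.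
    move=> r _; have mfr : measurable_fun setT (fun y => (cmodulus (hankel (u - r, y) * f y))%:E).
      apply/measurable_EFinP; apply: measurable_cmodulus; apply: cmeasM => //.
      exact: (cmeas_section (u - r) cmeas_hankel).
    have -> : (\int[mu]_y (cmodulus (F (y, r)))%:E =
        (cmodulus (s r))%:E * \int[mu]_y (cmodulus (hankel (u - r, y) * f y))%:E)%E.
      rewrite -ge0_integralZl_EFin ?cmodulus_ge0//; last first.
        by move=> y _; rewrite lee_fin cmodulus_ge0.
      by apply: eq_integral => y _; rewrite -EFinM -cmodulusM /F /=; congr (cmodulus _)%:E; ring.
    case: ltP => ru.
      rewrite [X in (_ <= X + _)%E]muleC -ge0_muleDr ?hankel_sq_ge0 ?sqint_ge0//.
      by apply: lee_wpmul2l; [rewrite lee_fin cmodulus_ge0|exact: integral_hankel_mul].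
    rewrite mul0e adde0 (_ : (\int[mu]_y _)%E = 0%E).
      by rewrite mule0 mule_ge0 ?hankel_sq_ge0// lee_fin cmodulus_ge0.
    rewrite -[RHS](integral0 mu setT); apply: eq_integral => y _.
    by rewrite hankel_le0 ?subr_le0// mul0r cmodulus0.
  rewrite ge0_integralD//; last 4 first.
  - by move=> r _; rewrite mule_ge0 ?hankel_sq_ge0// lee_fin cmodulus_ge0.
  - exact: measurable_hankel_s.
  - move=> r _; rewrite mule_ge0 ?sqint_ge0// lee_fin.
    by case: ifP => // _; exact: cmodulus_ge0.
  - by apply: emeasurable_funM => //; exact: measurable_mass.
  apply: lte_add_pinfty => //.
  rewrite ge0_integralZr ?sqint_ge0//; last 2 first.
  - exact: measurable_mass.
  - by move=> r _; rewrite lee_fin; case: ifP => // _; exact: cmodulus_ge0.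
  apply: lte_mul_pinfty => //; first exact: mass_ge0.
  by rewrite ge0_fin_numE ?mass_lty// mass_ge0.
have mF' : cmeas (fun q : R * R => F (q.2, q.1)).
  by apply: (cmeas_comp _ mF); exact: measurable_pair_swap.
have aeF : {ae mu, forall r, cL1 (fun y => F (y, r))}.
  apply: (ae_cL1_section mF'); move: iF; rewrite Tonelli_cmodulus//.
have memE : {ae mu, forall y, cint setT (fun r => F (y, r)) = memory_kernel (u, y) * f y}.
  apply: ae_imply (ae_cL1_section mF iF) => y Ly.
  rewrite mulrC -cintZ_cL1; last first.
    by move: Ly; congr cL1; apply/funext => r; rewrite /F /= mulrC.
  by congr cint; apply/funext => r; rewrite /F /= mulrC.
have Lmem : cL1 (fun y => memory_kernel (u, y) * f y).
  apply: eq_ae_cL1 memE (cL1_cint_section mF iF).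
  by apply: cmeasM => //; exact: (cmeas_section u cmeas_memory_kernel).
rewrite /response /kop.
under [X in cint _ X]eq_fun do rewrite mulrDl.
rewrite cintD//; last exact: cL1_hankel_mul.
congr (_ + _); transitivity (cint setT (fun y => cint setT (fun r => F (y, r)))).
  apply: eq_ae_cint; [|exact: cmeas_cint_param|].
    by apply: cmeasM => //; exact: (cmeas_section u cmeas_memory_kernel).
  by apply: ae_imply memE.
rewrite cint_Fubini//; apply: eq_ae_cint.
- exact: (cmeas_cint_param mF').
- apply: cmeasM => //; apply: (cmeas_comp _ cmeas_forcing); exact: measurable_funB.
apply: ae_imply aeF => r Lr; rewrite mulrC /forcing /kop -cintZ_cL1; last first.
  by move: Lr; congr cL1; apply/funext => y; rewrite /F /=; ring.
by congr cint; apply/funext => y; rewrite /F /=; ring.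
Qed.

Lemma cL1_forcing : cL1 (fun u => forcing u * expz a%:C u).
Proof.
split; first by apply: cmeasM; [exact: cmeas_forcing|exact: cmeas_expz].
apply: (@le_lt_trans _ _ (\int[mu]_u ((weight u)%:E * hankel_sq u +
    (if (0 < u)%R then expR (- (a * u)) else 0)%:E * sqint f))%E).
  have mw0 : measurable_fun setT (fun u : R => (if 0 < u then expR (- (a * u)) else 0)%:E).
    apply/measurable_EFinP; apply: measurable_fun_ifT => //; first exact: measurable_gt0.
    exact: measurable_weight.
  apply: ge0_le_integral => //.
  - by move=> u _; rewrite lee_fin cmodulus_ge0.
  - apply/measurable_EFinP; apply: measurable_cmodulus.
    by apply: cmeasM; [exact: cmeas_forcing|exact: cmeas_expz].
  - apply: emeasurable_funD; last exact: emeasurable_funM.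
    apply: emeasurable_funM; last exact: measurable_hankel_sq.
    by apply/measurable_EFinP; exact: measurable_weight.
  move=> u _; rewrite cmodulus_mul_expz /= -/(weight u).
  case: ltP => u0; last first.
    rewrite forcing_le0// cmodulus0 mul0r mul0e adde0.
    by rewrite mule_ge0 ?hankel_sq_ge0// lee_fin expR_ge0.
  rewrite -/(weight u) -ge0_muleDr ?hankel_sq_ge0 ?sqint_ge0// EFinM muleC.
  apply: lee_wpmul2l; first by rewrite lee_fin expR_ge0.
  have [hu|hu] := ltP (hankel_sq u) +oo%E; last first.
    by move: hu; rewrite leye_eq => /eqP ->; rewrite addye ?leey// gt_eqF// (lt_le_trans _
      (sqint_ge0 _))// ltNy0.
  by apply: le_trans (le_cmodulus_cint (cL1_hankel_mul hu)) _; exact: integral_hankel_mul.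
rewrite ge0_integralD//; last 4 first.
- by move=> u _; rewrite mule_ge0 ?hankel_sq_ge0// lee_fin expR_ge0.
- apply: emeasurable_funM; last exact: measurable_hankel_sq.
  by apply/measurable_EFinP; exact: measurable_weight.
- move=> u _; rewrite mule_ge0 ?sqint_ge0// lee_fin; case: ifP => // _; exact: expR_ge0.
- apply: emeasurable_funM => //; apply/measurable_EFinP; apply: measurable_fun_ifT => //.
    exact: measurable_gt0.
  exact: measurable_weight.
apply: lte_add_pinfty; first exact: weighted_hankel_sq.
rewrite ge0_integralZr ?sqint_ge0//; last 2 first.
- apply/measurable_EFinP; apply: measurable_fun_ifT => //; first exact: measurable_gt0.
  exact: measurable_weight.
- by move=> u _; rewrite lee_fin; case: ifP => // _; exact: expR_ge0.
rewrite integral_exp_halfline//; apply: lte_mul_pinfty => //.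
by rewrite lee_fin invr_ge0 ltW.
Qed.

Lemma cL1_response : cL1 (fun u => response u * expz a%:C u).
Proof.
have L := cL1D cL1_forcing (cL1_conv cmeas_forcing ms cL1_forcing Ls).
apply: eq_ae_cL1 L; first by apply: cmeasM; [exact: cmeas_response|exact: cmeas_expz].
by apply: ae_imply ae_response => u ->; rewrite mulrDl.
Qed.

End one_function.

(** * The renewal equation and its uniqueness, on the Laplace side *)

Definition Lap (g : R -> R[i]) (l : R) : R[i] :=
  cint setT (fun x => g x * expz l%:C x).

Lemma hl_causal (g : R -> R[i]) : (forall x, x <= 0 -> g x = 0) -> hl g = g.
Proof. by move=> g0; apply/funext => x; rewrite hlE; case: ltP => // /g0. Qed.

Lemma conv_le0 (g h : R -> R[i]) : (forall x, x <= 0 -> g x = 0) ->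
  (forall x, x <= 0 -> h x = 0) -> forall x, x <= 0 -> conv g h x = 0.
Proof.
move=> g0 h0 x x0; rewrite /conv -[RHS](@cint0 R setT); congr cint.
apply/funext => r; have [r0|r0] := leP r 0; first by rewrite h0// mulr0.
by rewrite g0 ?mul0r// subr_le0 (le_trans x0)// ltW.
Qed.

Lemma cL1_Lap (g : R -> R[i]) l : (forall x, x <= 0 -> g x = 0) -> a <= l ->
  cL1 (fun x => g x * expz a%:C x) -> cL1 (fun x => g x * expz l%:C x).
Proof.
by move=> g0 al; rewrite -(hl_causal g0); apply: cL1_hl_expz.
Qed.

Lemma Lap_injective (g : R -> R[i]) : (forall x, x <= 0 -> g x = 0) ->
  cL1 (fun x => g x * expz a%:C x) -> (forall l, a <= l -> Lap g l = 0) ->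
  {ae mu, forall x, g x = 0}.
Proof.
move=> g0; rewrite -(hl_causal g0) => Lg lap0.
by apply: Laplace_injective Lg _ => l al; rewrite laplaceE -/(Lap (hl g) l) lap0.
Qed.

Hypothesis p_s : forall l, a <= l ->
  1 - Lap p l != 0 /\ Lap s l = Lap p l / (1 - Lap p l).

Lemma ae_neq (t : R) : {ae mu, forall x, x != t}.
Proof.
exists [set t]; split => //; first exact: lebesgue_measure_set1.
by move=> x /= /negP; rewrite negbK => /eqP.
Qed.

Section one_function_Laplace.
Variable f : R -> R[i].
Hypotheses (mf : cmeas f) (fi : (sqint f < +oo)%E).

Lemma Lap_response l : a <= l ->
  Lap (response f) l * (1 - Lap p l) = Lap (forcing f) l.
Proof.
move=> al; have [P0 Sl] := p_s al.
have Lf := cL1_Lap (@forcing_le0 f) al (cL1_forcing mf fi).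
have Lsl := cL1_Lap causal_s al Ls.
have mfo := cmeas_forcing mf.
have -> : Lap (response f) l = Lap (forcing f) l + Lap (forcing f) l * Lap s l.
  rewrite /Lap -(Laplace_conv mfo ms Lf Lsl) -(cintD Lf (cL1_conv mfo ms Lf Lsl)).
  apply: eq_ae_cint.
  - by apply: cmeasM; [exact: cmeas_response|exact: cmeas_expz].
  - apply: cmeasD; apply: cmeasM => //; try exact: cmeas_expz.
    exact: cmeas_conv.
  by apply: ae_imply (ae_response mf fi) => u ->; rewrite mulrDl.
by rewrite Sl; field.
Qed.

(* Both sides have the same Laplace transform, since [1 - Lap p l] does not vanish. *)
Lemma renewal_unique (v : R -> R[i]) : cmeas v -> (forall x, x <= 0 -> v x = 0) ->
  cL1 (fun x => v x * expz a%:C x) ->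
  {ae mu, forall u, v u = forcing f u + conv p v u} ->
  {ae mu, forall u, v u = response f u}.
Proof.
move=> mv v0 Lv vE.
have mr := cmeas_response mf; have r0 := @response_le0 f.
have Lr := cL1_response mf fi; have Lf := cL1_forcing mf fi.
pose d u := v u - response f u.
suff : {ae mu, forall u, d u = 0}.
  by apply: ae_imply => u /eqP; rewrite subr_eq0 => /eqP.
apply: Lap_injective => [x x0||l al]; first by rewrite /d v0// r0// subr0.
  rewrite /d; under eq_fun do rewrite mulrBl.
  exact: (cL1B Lv Lr).
have Lvl := cL1_Lap v0 al Lv; have Lrl := cL1_Lap r0 al Lr.
have Lfl := cL1_Lap (@forcing_le0 f) al Lf; have Lpl := cL1_Lap causal_p al Lp.
rewrite /Lap /d; under [X in cint _ X]eq_fun do rewrite mulrBl.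
rewrite (cintB Lvl Lrl) -/(Lap v l) -/(Lap (response f) l).
have [P0 _] := p_s al.
have Ev : Lap v l = Lap (forcing f) l + Lap p l * Lap v l.
  rewrite /Lap -(Laplace_conv mp mv Lpl Lvl) -(cintD Lfl (cL1_conv mp mv Lpl Lvl)).
  apply: eq_ae_cint.
  - by apply: cmeasM => //; exact: cmeas_expz.
  - apply: cmeasD; apply: cmeasM; try exact: cmeas_expz.
      exact: cmeas_forcing.
    exact: cmeas_conv.
  by apply: ae_imply vE => u {1}->; rewrite mulrDl.
apply: (mulIf P0); rewrite mul0r mulrBl (Lap_response al).
by rewrite mulrBr mulr1 {1}Ev; ring.
Qed.

(** This trades the resolvent [s] for [p] itself: both sides are causal with an integrable
    exponential weight, so it is enough to compare transforms, where the identity is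
    [Lap_response]. *)
Lemma renewal_equation :
  {ae mu, forall u, response f u = forcing f u + conv p (response f) u}.
Proof.
have mr := cmeas_response mf; have r0 := @response_le0 f.
have Lr := cL1_response mf fi; have Lf := cL1_forcing mf fi.
have mfo := cmeas_forcing mf.
have Lc := cL1_conv mp mr Lp Lr.
pose d u := response f u - (forcing f u + conv p (response f) u).
suff : {ae mu, forall u, d u = 0}.
  by apply: ae_imply => u /eqP; rewrite subr_eq0 => /eqP.
apply: Lap_injective => [x x0||l al].
- by rewrite /d r0// forcing_le0// conv_le0// addr0 subr0.
- rewrite /d; under eq_fun do rewrite mulrBl mulrDl.
  exact: (cL1B Lr (cL1D Lf Lc)).
have Lrl := cL1_Lap r0 al Lr; have Lpl := cL1_Lap causal_p al Lp.
have Lfl := cL1_Lap (@forcing_le0 f) al Lf.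
have Lcl := cL1_conv mp mr Lpl Lrl.
rewrite /Lap /d; under [X in cint _ X]eq_fun do rewrite mulrBl mulrDl.
rewrite (cintB Lrl (cL1D Lfl Lcl)) (cintD Lfl Lcl) (Laplace_conv mp mr Lpl Lrl) -/(Lap (response
  f) l) -/(Lap p l) -/(Lap (forcing f) l).
by rewrite -(Lap_response al); ring.
Qed.

End one_function_Laplace.

(* [op_T] for functions on the line that vanish on the negative half-line. *)
Definition T_op t f x : R[i] := f (x - t) + kop (op_kernel t) f x.

Section T_op_theory.
Variable f : R -> R[i].
Hypotheses (mf : cmeas f) (fi : (sqint f < +oo)%E)
  (f0 : forall x, x <= 0 -> f x = 0).

Lemma cmeas_T_op t : cmeas (T_op t f).
Proof.
apply: cmeasD; last exact: (cmeas_kop (cmeas_op_kernel t) mf).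
by apply: (cmeas_comp _ mf); exact: measurable_funB.
Qed.

Lemma sqint_shift t : sqint (fun x => f (x - t)) = sqint f.
Proof.
rewrite /sqint (ge0_integral_shift (- t) (measurable_sqmod mf))// => x.
by rewrite lee_fin sqr_ge0.
Qed.

Lemma sqint_T_op_lty t : (sqint (T_op t f) < +oo)%E.
Proof.
have msh : cmeas (fun x : R => f (x - t)).
  by apply: (cmeas_comp _ mf); exact: measurable_funB.
apply: le_lt_trans (sqintD msh (cmeas_kop (cmeas_op_kernel t) mf)) _.
apply: lt2_add; first by rewrite sqint_shift.
exact: (sqint_kop_lty (cmeas_op_kernel t) (hs_norm2_op_kernel t) mf fi).
Qed.

Lemma T_op_le0 t x : 0 <= t -> x <= 0 -> T_op t f x = 0.
Proof.
move=> t0 x0; rewrite /T_op kop_op_kernel [0 < x]ltNge x0 /= addr0 f0//.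
by rewrite subr_le0 (le_trans x0).
Qed.

(* Splitting the convolution at [t], the part of the past of [response f] before [t]
   turns the forcing term of [f] into that of [T_op t f]. *)
Lemma response_T_op t : 0 <= t ->
  {ae mu, forall u, (if 0 < u then response f (u + t) else 0) = response (T_op t f) u}.
Proof.
move=> t0; set w := response f; pose v u := if 0 < u then w (u + t) else 0.
have mw : cmeas w by exact: cmeas_response.
have msh : cmeas (fun u : R => w (u + t)).
  by apply: (cmeas_comp _ mw); exact: measurable_funD.
have mv : cmeas v.
  exact: (cmeas_if measurable_gt0 msh (cmeas_cst 0)).
have v0 x : x <= 0 -> v x = 0 by rewrite /v ltNge => ->.
have Lw : cL1 (fun u => w u * expz a%:C u) by exact: cL1_response.
apply: (renewal_unique (cmeas_T_op t) (sqint_T_op_lty t) mv v0).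
  have Lsh := cL1Z (expz a%:C (- t)) (cL1_shift t Lw); apply: (cL1_le _ Lsh).
    by apply: cmeasM => //; exact: cmeas_expz.
  move=> x; rewrite /v; case: ifP => _; last by rewrite mul0r cmodulus0 cmodulus_ge0.
  by rewrite [X in _ <= cmodulus X]mulrCA -expzD (addrC (- t)) addrK.
have aeh := ae_shift t ae_hankel_sq_lty.
have aec := ae_shift t (ae_cL1_conv mp mw Lp Lw).
have aer := ae_shift t (renewal_equation mf fi).
apply: ae_imply2 (ae_imply2 (fun=> @conj _ _) aeh aec) aer => u [hu cu] Eu.
have [u0|u0] := leP u 0.
  rewrite /v ltNge u0 /= forcing_le0// conv_le0// addr0//.
(* In what follows [B], translated by [t], is the convolution of [p] with the future [v]. Reflected
   at [t], [A] is the forcing by the part of [T_op t f] on []0, t[], and [forcing f (u + t)],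
   translated by [t], is the forcing by its part beyond [t]. *)
have -> : v u = forcing f (u + t) + conv p w (u + t) by rewrite /v u0.
pose A r := if r < t then p (u + t - r) * w r else 0.
pose B r := if t < r then p (u + t - r) * w r else 0.
have mc : cmeas (fun r : R => p (u + t - r) * w r) by case: cu.
have LA : cL1 A.
  apply: cL1_le cu _; first by apply: (cmeas_if _ mc (cmeas_cst 0)); exact: measurable_fun_ltr.
  by move=> r; rewrite /A; case: ifP => // _; rewrite cmodulus0 cmodulus_ge0.
have LB : cL1 B.
  apply: cL1_le cu _; first by apply: (cmeas_if _ mc (cmeas_cst 0)); exact: measurable_fun_ltr.
  by move=> r; rewrite /B; case: ifP => // _; rewrite cmodulus0 cmodulus_ge0.
have -> : conv p w (u + t) = cint setT A + cint setT B.
  rewrite -cintD//; apply: eq_ae_cint => //; first by case: (cL1D LA LB).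
  apply: ae_imply (ae_neq t) => r; rewrite /A /B.
  by case: ltgtP => // _ _; rewrite ?addr0 ?add0r.
have -> : cint setT B = conv p v u.
  have [mB _] := LB; rewrite -(cint_shift t mB) /conv; congr cint; apply/funext => r.
  rewrite /B /v ltrDr; case: ifP => _; last by rewrite mulr0.
  by congr (p _ * _); ring.
rewrite addrA; congr (_ + _).
have [mA _] := LA; rewrite -(cint_reflect t mA).
have Lf := cL1_hankel_mul mf fi hu.
have Lft := cL1_shift (- t) Lf.
have -> : forcing f (u + t) = cint setT (fun y => hankel (u + t, y - t) * f (y - t)).
  by have [mF _] := Lf; symmetry; exact: (cint_shift (- t) mF).
apply: etrans (esym (cintD Lft (cL1_reflect t LA))) _.
rewrite /forcing /kop; congr cint; apply/funext => y.
rewrite /A /T_op kop_op_kernel -/w /hankel /= u0 (ltr_wpDr t0 u0).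
have -> : u + t + (y - t) = u + y by ring.
have -> : u + t - (t - y) = u + y by ring.
rewrite gtrBl; have [y0|y0] := ltP 0 (y - t); last first.
  rewrite f0// mulr0 !add0r; case: ifP => _; last by rewrite mul0r.
  by [].
have ty : t < y by rewrite -subr_gt0.
have wty : w (t - y) = 0 by apply: (@response_le0 f); rewrite subr_le0 ltW.
by rewrite (le_lt_trans t0 ty) wty mulr0 !addr0.
Qed.

(** For [0 < x < s'] both sides are values of responses, compared by [response_T_op] at
    [u = s' - x]; hence the reflection of an almost everywhere identity. For [x > s'] both sides are
    the translate of [T_op t f] by [s']. *)
Lemma T_op_semigroup s' t : 0 <= s' -> 0 <= t ->
  {ae mu, forall x, T_op (s' + t) f x = T_op s' (T_op t f) x}.
Proof.
move=> s0 t0.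
apply: ae_imply2 (ae_reflect s' (response_T_op t0)) (ae_neq s') => x Ex xs.
rewrite /T_op !kop_op_kernel -/(T_op t f).
have -> : x - (s' + t) = x - s' - t by ring.
rewrite -[RHS]addrA; congr (_ + _); rewrite subr_gt0.
have -> : t - (x - s') = s' + t - x by ring.
case: (ltgtP x s') xs => // xs _.
- case: ltP => x0; last by rewrite addr0.
  rewrite add0r; apply: etrans Ex.
  rewrite subr_gt0 xs; congr (response _ _); ring.
- by rewrite (le_lt_trans s0 xs) (@response_le0 (T_op t f)) ?addr0// subr_le0 ltW.
Qed.

End T_op_theory.

Section small_time.
Variable f : R -> R[i].
Hypotheses (mf : cmeas f) (fi : (sqint f < +oo)%E).

Lemma sqint_kop_op_kernel t : sqint (kop (op_kernel t) f) =
  (\int[mu]_u (if (u < t)%R then (cmodulus (response f u) ^+ 2)%R else 0%R)%:E)%E.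
Proof.
set F := fun u : R => (if (u < t)%R then (cmodulus (response f u) ^+ 2)%R else 0%R)%:E.
have mF : measurable_fun setT F.
  apply/measurable_EFinP; apply: measurable_fun_ifT => //; first exact: measurable_fun_ltr.
  by apply/measurable_EFinP; exact: (measurable_sqmod (cmeas_response mf)).
have F0 x : (0 <= F x)%E by rewrite lee_fin; case: ifP => // _; exact: sqr_ge0.
rewrite -[RHS](ge0_integral_reflect t mF F0); apply: eq_integral => x _.
rewrite kop_op_kernel /F gtrBl; case: ifP => // _.
by rewrite cmodulus0 expr0n.
Qed.

Lemma kop_op_kernel_small (e : R) : 0 < e ->
  exists2 d, 0 < d & forall t, t <= d -> (sqint (kop (op_kernel t) f) <= e%:E)%E.
Proof.
move=> e0; have [] := @integral_head_small R (fun u => cmodulus (response f u) ^+ 2) _ _ _ _ e e0.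
- by apply/measurable_EFinP; exact: (measurable_sqmod (cmeas_response mf)).
- by move=> u; exact: sqr_ge0.
- by move=> u u0; rewrite response_le0// cmodulus0 expr0n.
- rewrite -sqint_kop_op_kernel.
  exact: (sqint_kop_lty (cmeas_op_kernel 1) (hs_norm2_op_kernel 1) mf fi).
by move=> d d0 hd; exists d => // t td; rewrite sqint_kop_op_kernel hd.
Qed.

End small_time.

(* In the renewal equation the convolution term is negligible as [u -> 0]. *)
Lemma response_forcing_at0 f (c L : R[i]) : cmeas f -> (sqint f < +oo)%E ->
  (forall e : R, 0 < e -> exists2 d : R, 0 < d & forall t, 0 < t -> t <= d ->
     (head_integral t (fun u => response f u - c)%R <= (e * t)%:E)%E) ->
  (forall e : R, 0 < e -> exists2 d : R, 0 < d & forall u, 0 < u -> u <= d ->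
     cmodulus (forcing f u - L) <= e) ->
  c = L.
Proof.
move=> mf fi hw hL; set w := response f in hw *.
have mw : cmeas w by exact: cmeas_response.
have mF : cmeas (forcing f) by exact: cmeas_forcing.
have mcL : cmeas (fun _ : R => c - L) by exact: cmeas_cst.
have mwc : cmeas (fun u : R => w u - c) by exact: (cmeasB mw (cmeas_cst c)).
have mFL : cmeas (fun u : R => forcing f u - L) by exact: (cmeasB mF (cmeas_cst L)).
have mpw : cmeas (conv p w) by exact: cmeas_conv.
apply/eqP; rewrite -subr_eq0; apply/eqP; apply: cmodulus_eq0; apply/eqP.
rewrite eq_le cmodulus_ge0 andbT; apply/ler_addgt0Pr => e' e'0; rewrite add0r.
(* The three errors, divided by [t], are [e], [e] and [e (e + |c|)]; as [e <= 1], their sum is at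
   most [e (|c| + 3)]. *)
pose e := Num.min 1 (e' / (cmodulus c + 3)).
have k0 : 0 < cmodulus c + 3 by rewrite ltr_wpDl// cmodulus_ge0.
have e0 : 0 < e by rewrite lt_min ltr01 divr_gt0.
have e1 : e <= 1 by rewrite ge_min lexx.
have ek : e * (cmodulus c + 3) <= e' by rewrite -ler_pdivlMr// ge_min lexx orbT.
have [d1 d10 h1] := hw e e0; have [d2 d20 h2] := hL e e0.
have [d3 d30 h3] : exists2 d : R, 0 < d & forall t, t <= d -> (head_integral t p <= e%:E)%E.
  (* Integrability of [p] is known only with the weight [e^{- a u}], which is at least [e^{- a}]
     below 1. *)
  have Lp1 : cL1 (fun u => if u < 1 then p u else 0).
    apply: (cL1_le _ (cL1Z (expR a)%:C Lp)).
      by apply: (cmeas_if _ mp (cmeas_cst 0)); exact: measurable_fun_ltr.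
    move=> u; case: ifP => u1; last by rewrite cmodulus0 cmodulus_ge0.
    rewrite cmodulusM cmodulus_exp cmodulus_mul_expz mulrCA ler_peMr ?cmodulus_ge0//.
    by rewrite -expRD -expR0 ler_expR subr_ge0 /= ger_pMr// ltW.
  have [d d0 hd] := head_integral_small Lp1 e0.
  exists (Num.min d 1) => [|t]; first by rewrite lt_min d0 ltr01.
  rewrite le_min => /andP[td t1]; apply: le_trans (hd t td).
  rewrite le_eqVlt; apply/orP; left; apply/eqP; apply: eq_integral => u _.
  by case: ifP => // /andP[_ ut]; rewrite (lt_le_trans ut t1).
pose t := Num.min d1 (Num.min d2 d3).
have t0 : 0 < t by rewrite !lt_min d10 d20.
have td1 : t <= d1 by rewrite ge_min lexx.
have td2 : t <= d2 by rewrite !ge_min lexx orbT.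
have td3 : t <= d3 by rewrite !ge_min lexx !orbT.
have Hw : (head_integral t w <= ((e + cmodulus c) * t)%:E)%E.
  have -> : ((e + cmodulus c) * t)%:E = ((e * t)%:E + head_integral t (fun=> c) + head_integral
    t (fun=> (0 : R[i])%R))%E.
    by rewrite !head_integral_cst// cmodulus0 mul0r adde0 -EFinD mulrDl.
  apply: le_trans (le_head_integral3 mw mwc (cmeas_cst c) (cmeas_cst 0) _) _.
    apply: aeW => u _; rewrite cmodulus0 addr0.
    by rewrite -[X in cmodulus X <= _](subrK c); exact: cmodulusD.
  by rewrite !leeD2r// h1.
have HF : (head_integral t (fun u => forcing f u - L)%R <= (e * t)%:E)%E.
  have <- : head_integral t (fun=> e%:C) = (e * t)%:E.
    by rewrite head_integral_cst// cmodulusC ger0_norm// ltW.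
  apply: ge0_le_integral => //.
  - by move=> u _; rewrite lee_fin; case: ifP => // _; exact: cmodulus_ge0.
  - exact: measurable_head_integrand.
  - exact: (measurable_head_integrand t (cmeas_cst e%:C)).
  move=> u _; case: ifP => // /andP[u0 ut].
  by rewrite lee_fin cmodulusC (ger0_norm (ltW e0)) h2// (le_trans (ltW ut)).
have Hpw : (head_integral t (conv p w) <= (e * ((e + cmodulus c) * t))%:E)%E.
  apply: le_trans (head_integral_conv t mp mw causal_p _) _; first by move=> x x0; exact:
    response_le0.
  rewrite EFinM; apply: lee_pmul => //; last exact: h3.
  - by apply: integral_ge0 => u _; rewrite lee_fin; case: ifP => // _; exact: cmodulus_ge0.
  - by apply: integral_ge0 => u _; rewrite lee_fin; case: ifP => // _; exact: cmodulus_ge0.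
have : (head_integral t (fun=> (c - L)%R) <= (e' * t)%:E)%E.
  apply: le_trans (le_head_integral3 mcL mwc mFL mpw _) _.
    apply: ae_imply (renewal_equation mf fi) => u Eu _.
    have -> : c - L = - (w u - c) + (forcing f u - L) + conv p w u by rewrite {1}/w Eu; ring.
    apply: le_trans (cmodulusD _ _) _; rewrite lerD2r.
    by apply: le_trans (cmodulusD _ _) _; rewrite cmodulusN.
  apply: (@le_trans _ _ ((e * t)%:E + (e * t)%:E + (e * ((e + cmodulus c) * t))%:E)%E).
    by rewrite !leeD// h1.
  rewrite -!EFinD lee_fin -!mulrDl mulrA -mulrDl ler_pM2r//.
  apply: le_trans ek; have : e * e <= e by rewrite ger_pMr.
  move: (cmodulus c) => x; nra.
by rewrite head_integral_cst// lee_fin ler_pM2r.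
Qed.

End renewal.

(** * The perturbed shift semigroup *)

Section translation.
Context {R : realType}.
Local Notation mu := (@lebesgue_measure R).

(** Compactness in its near-covering form: the estimate holds near [(x, 0)] for each [x] of the
    segment, hence for all [x] at once when [t] is near 0. *)
Lemma uniformly_continuous_translation (g : R -> R) (a b e : R) :
  continuous g -> 0 < e -> exists2 d : R, 0 < d & forall t, `|t| < d ->
    forall x, a <= x <= b -> `|g (x - t) - g x| <= e.
Proof.
move=> gc e0; have e2 : 0 < e / 2 by rewrite divr_gt0.
have /compact_near_coveringP ncov := @segment_compact R a b.
have : \forall t \near (0 : R), `[a, b]%classic `<=` (fun x => `|g (x - t) - g x| <= e).
  apply: (ncov R (nbhs (0 : R)) (fun t x => `|g (x - t) - g x| <= e)) => x _ /=.
  have gx : \forall y \near x, `|g x - g y| <= e / 2.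
    by move/cvgrPdist_le: (gc x); apply.
  have sx : (fun q : R * R => q.1 - q.2) q @[q --> (x, 0 : R)] --> x.
    rewrite -[X in _ --> X]subr0; apply: (@cvgB _ _ _ _ _ fst snd); [exact: cvg_fst|exact: cvg_snd].
  have h1 : \forall q \near (x, 0 : R), `|g x - g (q.1 - q.2)| <= e / 2 by exact: (sx _ gx).
  have h2 : \forall q \near (x, 0 : R), `|g x - g q.1| <= e / 2.
    by have c1 : (fun q : R * R => q.1) q @[q --> (x, 0 : R)] --> x by [exact: cvg_fst]; exact:
      (c1 _ gx).
  near=> q => /=.
  have -> : g (q.1 - q.2) - g q.1 = (g x - g q.1) - (g x - g (q.1 - q.2)) by ring.
  apply: le_trans (ler_normB _ _) _; rewrite [leRHS]splitr lerD//; by near: q.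
move=> /nbhs_ballP[d /= d0 hd]; exists d => // t td x xab.
by apply: (hd t) => /=; [rewrite /ball/= sub0r normrN|rewrite in_itv].
Unshelve. all: by end_near.
Qed.

(** The segment [[-1, N + 1]] leaves a margin of 1 on both sides of the support: for [0 <= t < 1],
    either both [u x] and [u (x - t)] vanish or both points lie in the segment. There [u] is
    approximated in L^1 by a continuous function. *)
Lemma translation_L1 (u : R -> R) (N : R) : 0 < N ->
  measurable_fun setT u -> (forall x, `|u x| <= N) ->
  (forall x, ~~ (0 < x < N) -> u x = 0) ->
  forall e : R, 0 < e -> exists2 d : R, 0 < d & forall t, 0 <= t -> t < d ->
    (\int[mu]_x (`|u (x - t) - u x|)%:E <= e%:E)%E.
Proof.
move=> N0 mu_ uN u0 e e0; pose a : R := -1; pose b : R := N + 1.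
have ab : a < b by rewrite /a /b; lra.
have mE : measurable (`[a, b]%classic : set R) by exact: measurable_itv.
have muE : mu `[a, b]%classic = (N + 2)%:E.
  have /= := lebesgue_measure_itv `[a, b]; rewrite lte_fin ab => ->.
  by rewrite -EFinD /a /b; congr EFin; ring.
have Efin : (mu `[a, b]%classic < +oo)%E by rewrite muE ltry.
have iu : mu.-integrable (`[a, b]%classic : set R) (EFin \o u).
  apply: measurable_bounded_integrable => //; first exact: (measurable_funS measurableT _ mu_).
  by exists N; split=> [|y Ny x _ /=]; [exact: num_real|rewrite (le_trans (uN x))// ltW].
have [g [gc gi gcvg]] := approximation_continuous_integrable mE Efin iu.
have e4 : 0 < e / 4 by rewrite divr_gt0.
have : \forall n \near \oo, (\int[mu]_(z in `[a, b]) (`|u z - g n z|)%:E <= (e / 4)%:E)%E.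
  by move/cvge0P: gcvg; apply => // n; apply: integral_ge0.
move=> [n _ /(_ n (leqnn n)) /= gn]; set G := g n in gn.
(* The segment has length [N + 2], so the uniform error [k] integrates to [e / 2]; the two
   approximation errors take [e / 4] each. *)
pose k := e / (2 * (N + 2)).
have k0 : 0 < k by rewrite divr_gt0// mulr_gt0//; lra.
have [d d0 hd] := @uniformly_continuous_translation G a b k (gc n) k0.
exists (Num.min d 1) => [|t t0]; first by rewrite lt_min d0 ltr01.
rewrite lt_min => /andP[td t1].
pose D x := if a <= x <= b then `|u x - G x| else 0.
have D0 x : 0 <= D x by rewrite /D; case: ifP.
have mG : measurable_fun setT G by apply: continuous_measurable_fun; exact: gc.
have mitv : measurable_fun setT (fun x : R => a <= x <= b).
  by apply: measurable_and; exact: measurable_fun_ler.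
have mD : measurable_fun setT D.
  apply: measurable_fun_ifT => //; apply: measurableT_comp => //; exact: measurable_funB.
have iD : (\int[mu]_x (D x)%:E <= (e / 4)%:E)%E.
  apply: le_trans gn; rewrite [leRHS]integral_mkcond le_eqVlt; apply/orP; left; apply/eqP.
  by apply: eq_integral => x _; rewrite patchE mem_setE/= in_itv/= /D; case: ifP.
pose K x := if a <= x <= b then k else 0.
have mK : measurable_fun setT K by apply: measurable_fun_ifT.
have K0 x : 0 <= K x by rewrite /K; case: ifP => // _; exact: ltW.
have iK : (\int[mu]_x (K x)%:E = (e / 2)%:E)%E.
  transitivity (\int[mu]_(x in `[a, b]) (k)%:E)%E.
    rewrite [RHS]integral_mkcond.
    by apply: eq_integral => x _; rewrite patchE mem_setE/= in_itv/= /K; case: ifP.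
  by rewrite integral_cst//; apply: (etrans (congr1 (mule k%:E) muE)); rewrite -EFinM; congr
    EFin; rewrite /k; field; lra.
have msh : measurable_fun setT (fun x : R => x - t) by exact: measurable_funB.
have mDt : measurable_fun setT (fun x : R => D (x - t)) by exact: measurableT_comp.
apply: (@le_trans _ _ (\int[mu]_x ((D (x - t))%:E + (D x)%:E + (K x)%:E))%E).
  apply: ge0_le_integral => //.
  - apply/measurable_EFinP; apply: measurableT_comp => //; apply: measurable_funB => //.
    exact: measurableT_comp.
  - by apply/measurable_EFinP; apply: measurable_funD => //; exact: measurable_funD.
  move=> x _; rewrite -!EFinD lee_fin.
  have [/andP[x0 xb]|nx] := boolP (0 <= x <= N + 1); last first.
    have -> : u x = 0 by apply: u0; apply: contra nx => /andP[? ?]; apply/andP; split; lra.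
    have -> : u (x - t) = 0 by apply: u0; apply: contra nx => /andP[? ?]; apply/andP; split; lra.
    by rewrite subrr normr0 !addr_ge0.
  have xab : a <= x <= b by rewrite /a /b; lra.
  have xtab : a <= x - t <= b by rewrite /a /b; lra.
  rewrite /D /K xab xtab.
  have := hd t _ x xab; rewrite ger0_norm// => /(_ td) hx.
  have -> : u (x - t) - u x = (u (x - t) - G (x - t)) - (u x - G x) + (G (x - t) - G x) by ring.
  by apply: le_trans (ler_normD _ _) _; rewrite lerD// ler_normB.
rewrite ge0_integralD//; [|by move=> x _; rewrite -EFinD lee_fin addr_ge0|
  by apply/measurable_EFinP; exact: measurable_funD|by move=> x _; rewrite
    lee_fin|exact/measurable_EFinP].
rewrite ge0_integralD//; [|by move=> x _; rewrite lee_fin|exact/measurable_EFinP|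
  by move=> x _; rewrite lee_fin|exact/measurable_EFinP].
have mDE : measurable_fun setT (EFin \o D) by exact/measurable_EFinP.
rewrite (ge0_integral_shift (- t) mDE)//.
apply: (@le_trans _ _ ((e / 4)%:E + (e / 4)%:E + (e / 2)%:E)%E).
  by rewrite iK leeD2r// leeD.
by rewrite -!EFinD lee_fin; lra.
Qed.

(** Truncation in height and in support reduces to a function with components bounded by [N], for
    which [|y - z|^2 <= 2 N |y - z|] turns the L^1 estimate into an L^2 one. *)
Lemma translation_L2 (f : R -> R[i]) : cmeas f -> (sqint f < +oo)%E ->
  (forall x, x <= 0 -> f x = 0) -> forall e : R, 0 < e ->
  exists2 d : R, 0 < d & forall t, 0 <= t -> t < d ->
    (sqint (fun x => f (x - t) - f x)%R <= e%:E)%E.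
Proof.
move=> mf fi f0 e e0.
pose T (n : nat) x := if (cmodulus (f x) <= n.+1%:R) && (x < n.+1%:R) then f x else 0.
have mb n : measurable_fun setT (fun x => (cmodulus (f x) <= n.+1%:R) && (x < n.+1%:R)).
  apply: measurable_and; last exact: measurable_fun_ltr.
  by apply: measurable_fun_ler => //; exact: measurable_cmodulus.
have mT n : cmeas (T n) by exact: (cmeas_if (mb n) mf (cmeas_cst 0)).
have e16 : 0 < e / 16 by rewrite divr_gt0.
have mfT n : cmeas (fun x => f x - T n x) by exact: (cmeasB mf (mT n)).
have Tcvg x : \forall n \near \oo, T n x = f x.
  near=> n; rewrite /T; case: ifP => // /negP[]; apply/andP; split.
    apply: (@le_trans _ _ n%:R); last by rewrite ler_nat.
    by near: n; exact: nbhs_infty_ger.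
  apply: (@le_lt_trans _ _ n%:R); last by rewrite ltr_nat.
  by near: n; exact: nbhs_infty_ger.
have : \forall n \near \oo, (sqint (fun x => f x - T n x)%R <= (e / 16)%:E)%E.
  suff : sqint (fun x => f x - T n x)%R @[n --> \oo] --> 0%E.
    by move/cvge0P => /(_ (fun n => sqint_ge0 _)); apply.
  have [|||||_ _] := @dominated_convergence _ _ _ mu setT measurableT
    (fun n x => ((cmodulus (f x - T n x)) ^+ 2)%:E) (fun=> 0%E) (fun x => ((cmodulus (f x)) ^+
      2)%:E).
  - by move=> n; exact: (measurable_sqmod (mfT n)).
  - exact: measurable_cst.
  - apply: aeW => x _; apply: cvg_near_cst; near=> n.
    by rewrite (near (Tcvg x) n)// subrr cmodulus0 expr0n.
  - apply/integrableP; split; first exact: measurable_sqmod.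
    under eq_integral do rewrite gee0_abs ?lee_fin ?sqr_ge0//.
    exact: fi.
  - apply: aeW => x n _; rewrite gee0_abs ?lee_fin ?sqr_ge0// lerXn2r ?nnegrE ?cmodulus_ge0//.
    by rewrite /T; case: ifP => // _; rewrite ?subrr ?subr0 ?cmodulus0 ?cmodulus_ge0.
  by rewrite integral0.
move=> [n _ /(_ n (leqnn n)) /= hn]; set g := T n in hn.
have mg : cmeas g by exact: mT.
pose N : R := n.+1%:R.
have N0 : 0 < N by rewrite ltr0n.
have g0 x : ~~ (0 < x < N) -> g x = 0.
  rewrite negb_and -!leNgt => /orP[x0|xN]; rewrite /g /T; first by case: ifP => // _; exact: f0.
  by rewrite [x < _]ltNge xN andbF.
have gN x : cmodulus (g x) <= N by rewrite /g /T; case: ifP => [/andP[]//|_]; rewrite cmodulus0 ltW.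
(* Each component of [g] contributes [2 N k = e / 8]. The two terms of the final splitting are then
   at most [e / 4], and [sqintD] doubles both. *)
pose k := e / (16 * N).
have k0 : 0 < k by rewrite divr_gt0// mulr_gt0.
have ru x : `|Ref g x| <= N by rewrite (le_trans (Re_le_cmodulus _)).
have iu x : `|Imf g x| <= N by rewrite (le_trans (Im_le_cmodulus _)).
have [mR mI] := mg.
have [d1 d10 h1] := @translation_L1 (Ref g) N N0 mR ru (fun x nx => congr1 (@complex.Re R) (g0 x
  nx)) k k0.
have [d2 d20 h2] := @translation_L1 (Imf g) N N0 mI iu (fun x nx => congr1 (@complex.Im R) (g0 x
  nx)) k k0.
exists (Num.min d1 d2) => [|t t0]; first by rewrite lt_min d10.
rewrite lt_min => /andP[td1 td2].
have msh : measurable_fun setT (fun x : R => x - t) by exact: measurable_funB.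
have mgt : cmeas (fun x : R => g (x - t)) by exact: (cmeas_comp msh mg).
have mh : cmeas (fun x : R => f x - g x) by exact: mfT.
have mht : cmeas (fun x : R => f (x - t) - g (x - t)) by exact: (cmeas_comp msh mh).
have mA : cmeas (fun x : R => (f (x - t) - g (x - t)) - (f x - g x)) by exact: (cmeasB mht mh).
have mB : cmeas (fun x : R => g (x - t) - g x) by exact: (cmeasB mgt mg).
have -> : (fun x => f (x - t) - f x) =
    (fun x => ((f (x - t) - g (x - t)) - (f x - g x)) + (g (x - t) - g x)).
  by apply/funext => x; ring.
apply: le_trans (sqintD mA mB) _.
have HA : (sqint (fun x : R => (f (x - t) - g (x - t)) - (f x - g x))%R <= (e / 4)%:E)%E.
  apply: le_trans (sqintB mht mh) _.
  have -> : sqint (fun x : R => f (x - t) - g (x - t))%R = sqint (fun x : R => f x - g x)%R.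
    rewrite /sqint (ge0_integral_shift (- t) (measurable_sqmod mh))// => x.
    by rewrite lee_fin sqr_ge0.
  apply: (@le_trans _ _ (2%:E * (e / 16)%:E + 2%:E * (e / 16)%:E)%E).
    by rewrite leeD// lee_pmul2l.
  by rewrite -!EFinM -EFinD lee_fin; lra.
have HB : (sqint (fun x : R => g (x - t) - g x)%R <= (e / 4)%:E)%E.
  apply: (@le_trans _ _ ((2 * N)%:E * \int[mu]_x (`|Ref g (x - t) - Ref g x|)%:E +
      (2 * N)%:E * \int[mu]_x (`|Imf g (x - t) - Imf g x|)%:E)%E).
    have mr (r : R -> R) : measurable_fun setT r ->
        measurable_fun setT (fun x : R => (`|r (x - t) - r x|)%:E).
      move=> mr; apply/measurable_EFinP; apply: measurableT_comp => //.
      by apply: measurable_funB => //; exact: (measurableT_comp mr msh).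
    have N2 : (0 <= (2 * N)%:E)%E by rewrite lee_fin mulr_ge0// ltW.
    rewrite -!ge0_integralZl//; [|exact: mr..].
    rewrite -ge0_integralD//; [|by move=> x _; rewrite mule_ge0|
      by apply: measurable_funeM; exact: mr|by move=> x _; rewrite mule_ge0|
      by apply: measurable_funeM; exact: mr].
    apply: ge0_le_integral => //.
    - by move=> x _; rewrite lee_fin sqr_ge0.
    - exact: measurable_sqmod.
    - by apply: emeasurable_funD; apply: measurable_funeM; exact: mr.
    move=> x _; rewrite -!EFinM -EFinD lee_fin cmodulus_sqr ReD ReN ImD ImN.
    have aux (y z : R) : `|y| <= N -> `|z| <= N -> (y - z) ^+ 2 <= 2 * N * `|y - z|.
      move=> yN zN; rewrite -real_normK ?num_real// expr2 ler_wpM2r//.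
      by apply: le_trans (ler_normB _ _) _; lra.
    by apply: lerD; [exact: (aux _ _ (ru _) (ru _))|exact: (aux _ _ (iu _) (iu _))].
  apply: (@le_trans _ _ ((2 * N)%:E * k%:E + (2 * N)%:E * k%:E)%E).
    have N2 : (0 < (2 * N)%:E)%E by rewrite lte_fin mulr_gt0.
    by rewrite leeD// lee_pmul2l// ?h1 ?h2.
  have E (M : R) : M != 0 -> 2 * M * (e / (16 * M)) + 2 * M * (e / (16 * M)) = e / 4.
    by move=> M0; field.
  by rewrite -!EFinM -EFinD E// gt_eqF.
apply: (@le_trans _ _ (2%:E * (e / 4)%:E + 2%:E * (e / 4)%:E)%E).
  by rewrite leeD// lee_pmul2l.
by rewrite -!EFinM -EFinD lee_fin; lra.
Unshelve. all: by end_near.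
Qed.

End translation.

Section almost_everywhere_operators.
Context {R : realType}.
Local Notation mu := (@lebesgue_measure R).
Implicit Types f g : R -> R[i].

Lemma eqaeP f g : eqae f g <-> {ae mu, forall x, hl f x = hl g x}.
Proof.
split; apply: ae_imply => x.
  rewrite !hlE => h; case: ifP => // x0; apply: h.
  by rewrite /halfline /= in_itv /= x0.
by rewrite !hlE /halfline /= in_itv /= andbT => h x0; move: h; rewrite x0.
Qed.

Lemma hl_le0 f x : x <= 0 -> hl f x = 0.
Proof. by rewrite hlE ltNge => ->. Qed.

Lemma hlD f g : hl (fun x => f x + g x) = (fun x => hl f x + hl g x).
Proof. by apply/funext => x; rewrite !hlE; case: ifP; rewrite ?addr0. Qed.

Lemma hlN f : hl (fun x => - f x) = (fun x => - hl f x).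
Proof. by apply/funext => x; rewrite !hlE; case: ifP; rewrite ?oppr0. Qed.

Lemma hlM f g : hl (fun x => f x * g x) = (fun x => hl f x * hl g x).
Proof. by apply/funext => x; rewrite !hlE; case: ifP; rewrite ?mulr0. Qed.

Lemma hlZ (c : R[i]) f : hl (fun x => c * f x) = (fun x => c * hl f x).
Proof. by apply/funext => x; rewrite !hlE; case: ifP; rewrite ?mulr0. Qed.

Lemma hl_conj f : hl (fun x => conjc (f x)) = (fun x => conjc (hl f x)).
Proof. by apply/funext => x; rewrite !hlE; case: ifP => //; rewrite rmorph0. Qed.

Lemma innerE f g : inner f g = cint setT (fun x => hl f x * conjc (hl g x)).
Proof. by rewrite /inner cint_cres -/(hl _) hlM hl_conj. Qed.

Lemma ae_hl f g : {ae mu, forall x, 0 < x -> f x = g x} -> {ae mu, forall x, hl f x = hl g x}.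
Proof. by apply: ae_imply => x fg; rewrite !hlE; case: ifP => // /fg. Qed.

Lemma cmeas_hl f : cmeas f -> cmeas (hl f).
Proof.
move=> mf; rewrite (_ : hl f = (fun x => if 0 < x then f x else 0)); last first.
  by apply/funext => x; rewrite hlE.
exact: (cmeas_if measurable_gt0 mf (cmeas_cst 0)).
Qed.

Lemma le_sqrte (x y : \bar R) : (x <= y -> sqrte x <= sqrte y)%E.
Proof.
case: x y => [x| |] [y| |] //=; rewrite ?lee_fin ?leey// ?sqrtr_ge0 => // h.
exact: ler_wsqrtr.
Qed.

Lemma le_sqint_hl f : cmeas f -> (sqint (hl f) <= sqint f)%E.
Proof.
move=> mf; apply: le_sqint => //; first exact: cmeas_hl.
by move=> x; rewrite hlE; case: ifP => // _; rewrite cmodulus0 cmodulus_ge0.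
Qed.

Lemma eq_kop (k : R * R -> R[i]) f g x : cmeas k -> cmeas f -> cmeas g ->
  {ae mu, forall y, f y = g y} -> kop k f x = kop k g x.
Proof.
move=> mk mf mg fg; apply: eq_ae_cint.
- exact: (cmeasM (cmeas_section x mk) mf).
- exact: (cmeasM (cmeas_section x mk) mg).
- by apply: ae_imply fg => y ->.
Qed.

(** Common form of [T_t] ([c = 1]), of [K_t] ([c = 0]) and of the adjoint of [T_t] ([c = 1],
    translation by [- t]). *)
Lemma bounded_shift_kernel (B : (R -> R[i]) -> R -> R[i]) (c : R[i]) (t : R)
    (k : R * R -> R[i]) : cmeas k -> (hs_norm2 k < +oo)%E ->
  (forall f, inL2 f -> cmeas (hl (B f))) ->
  (forall f, inL2 f -> {ae mu, forall x, 0 < x -> B f x = c * hl f (x - t) + kop k (hl f) x}) ->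
  bounded_operator B.
Proof.
move=> mk hk mB HB.
have msh : measurable_fun setT (fun x : R => x - t) by exact: measurable_funB.
have HB' f : inL2 f -> {ae mu, forall x, hl (B f) x = hl (fun x => c * hl f (x - t) + kop k (hl
  f) x) x}.
  by move=> Lf; exact: ae_hl (HB f Lf).
have mU f : inL2 f -> cmeas (fun x : R => c * hl f (x - t) + kop k (hl f) x).
  move=> /inL2P[mf _]; apply: (cmeasD _ (cmeas_kop mk mf)).
  exact: (cmeasM (cmeas_cst c) (cmeas_comp msh mf)).
pose C := ((2 * cmodulus c ^+ 2)%:E + 2%:E * hs_norm2 k)%E.
have hk0 : (0 <= hs_norm2 k)%E by apply: integral_ge0 => x _; exact: sqint_ge0.
have bd f : inL2 f -> (sqint (hl (B f)) <= C * sqint (hl f))%E.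
  move=> Lf; have [mf fi] := (inL2P f).1 Lf.
  have mhU : cmeas (hl (fun x : R => c * hl f (x - t) + kop k (hl f) x)).
    exact: cmeas_hl (mU f Lf).
  rewrite (eq_ae_sqint (mB f Lf) mhU (HB' f Lf)).
  apply: le_trans (le_sqint_hl (mU f Lf)) _.
  apply: le_trans (sqintD (cmeasM (cmeas_cst c) (cmeas_comp msh mf)) (cmeas_kop mk mf)) _.
  rewrite (sqintZ c (cmeas_comp msh mf)) (sqint_shift mf t).
  rewrite /C ge0_muleDl; [|by rewrite lee_fin mulr_ge0 ?sqr_ge0|by rewrite mule_ge0].
  rewrite (EFinM 2) -!muleA.
  by rewrite leeD2l// lee_pmul2l// sqint_kop.
have C0 : (0 <= C)%E by rewrite adde_ge0 ?mule_ge0// lee_fin mulr_ge0 ?sqr_ge0.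
have Cy : (C < +oo)%E by rewrite lte_add_pinfty ?ltry// lte_mul_pinfty.
split.
- move=> f Lf; apply/inL2P; split; first exact: mB.
  have [mf fi] := (inL2P f).1 Lf.
  apply: le_lt_trans (bd f Lf) _; apply: lte_mul_pinfty => //.
  by rewrite ge0_fin_numE.
- move=> f g Lf Lg /eqaeP fg; apply/eqaeP.
  have [mf fi] := (inL2P f).1 Lf; have [mg gi] := (inL2P g).1 Lg.
  apply: ae_imply2 (ae_imply2 (fun=> @conj _ _) (HB' f Lf) (HB' g Lg)) (ae_shift (- t) fg) => x
    [-> ->] E.
  by rewrite !(hlE (fun _ => _ + kop _ _ _)) E (eq_kop x mk mf mg fg).
- move=> a b f g Lf Lg; apply/eqaeP.
  have [mf fi] := (inL2P f).1 Lf; have [mg gi] := (inL2P g).1 Lg.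
  have Lfg : inL2 (fun x => a * f x + b * g x).
    apply/inL2P; rewrite hlD !hlZ; split.
      by apply: cmeasD; exact: (cmeasM (cmeas_cst _)).
    apply: le_lt_trans (sqintD (cmeasM (cmeas_cst a) mf) (cmeasM (cmeas_cst b) mg)) _.
    by apply: lt2_add; rewrite sqintZ// lte_mul_pinfty// lee_fin sqr_ge0.
  have kl := kop_linear mk hk a b mf mg fi gi.
  have H3 := ae_imply2 (fun=> @conj _ _) (HB' f Lf) (HB' g Lg).
  have H4 := ae_imply2 (fun=> @conj _ _) (HB' _ Lfg) kl.
  apply: ae_imply2 H3 H4 => x [Ef Eg] [-> K].
  rewrite (hlE (B _)) (hlE (fun _ => _ + kop _ _ _)) in Ef.
  rewrite (hlE (B _)) (hlE (fun _ => _ + kop _ _ _)) in Eg.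
  rewrite (hlE (fun _ => _ + kop _ _ _)) (hlE (fun _ => _ * B f _ + _)).
  case: ifP Ef Eg => // x0 -> ->.
  rewrite hlD !hlZ K; ring.
- exists (Num.sqrt (fine C)) => f Lf.
  rewrite !L2normE (_ : (Num.sqrt (fine C))%:E = sqrte C); last first.
    by rewrite -[in RHS](@fineK _ C)// ge0_fin_numE.
  by rewrite -sqrteM// le_sqrte// bd.
Qed.

Lemma inL2_comb a b f g : inL2 f -> inL2 g -> inL2 (fun x => a * f x + b * g x).
Proof.
move=> /inL2P[mf fi] /inL2P[mg gi]; apply/inL2P; rewrite hlD !hlZ; split.
  by apply: cmeasD; exact: (cmeasM (cmeas_cst _)).
apply: le_lt_trans (sqintD (cmeasM (cmeas_cst a) mf) (cmeasM (cmeas_cst b) mg)) _.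
by apply: lt2_add; rewrite sqintZ// lte_mul_pinfty// lee_fin sqr_ge0.
Qed.

(** At [x = t] the two sides may differ: [shift_op] takes the value [f 0] there, while [hl f]
    vanishes at 0. *)
Lemma hl_shift_op t f : 0 <= t -> {ae mu, forall x, hl (shift_op t f) x = hl f (x - t)}.
Proof.
move=> t0; apply: ae_imply (ae_neq t) => x xt; rewrite !hlE subr_gt0 /shift_op.
case: (ltgtP x t) xt => // [xt|tx] _; first by rewrite if_same.
by rewrite (le_lt_trans t0 tx).
Qed.

(** Borel measurability does not pass through almost everywhere equality, so the value at [x = t] is
    restored explicitly. *)
Lemma cmeas_shift_op t f : 0 <= t -> cmeas (hl f) -> cmeas (hl (shift_op t f)).
Proof.
move=> t0 mf.
have -> : hl (shift_op t f) = (fun x => if x == t then (if 0 < t then f 0 else 0) else hl f (x -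
  t)).
  apply/funext => x; rewrite !hlE subr_gt0 /shift_op.
  case: (ltgtP x t) => [xt|tx|->]; [by rewrite if_same|by rewrite (le_lt_trans t0 tx)|].
  by rewrite subrr; case: ifP.
apply: cmeas_if; [exact: measurable_fun_eqr|exact: cmeas_cst|].
by apply: (cmeas_comp _ mf); exact: measurable_funB.
Qed.

End almost_everywhere_operators.

Section perturbed_shift.
Context {R : realType}.
Local Notation mu := (@lebesgue_measure R).
Variables phi psi : R -> R[i].
Hypotheses (phi_loc : L1loc phi) (phi_L2 : finite_weighted_L2 phi).
Hypothesis psiP : is_psi phi psi.
Local Notation p := (hl phi).
Local Notation s := (hl psi).

Let causal_p : forall x, x <= 0 -> p x = 0. Proof. exact: hl_le0. Qed.
Let causal_s : forall x, x <= 0 -> s x = 0. Proof. exact: hl_le0. Qed.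

Lemma L1loc_cmeas (f : R -> R[i]) : L1loc f -> cmeas (cres `[0, +oo[ f).
Proof. by move=> [/cmeasurable_cres + _]; apply. Qed.

Lemma L1loc_cmeas_hl (f : R -> R[i]) : L1loc f -> cmeas (hl f).
Proof.
move=> /L1loc_cmeas mf.
have -> : hl f = hl (cres `[0, +oo[ f).
  apply/funext => x; rewrite !hlE; case: ifP => // x0.
  by rewrite /cres mem_setE in_itv/= andbT ltW.
exact: cmeas_hl.
Qed.

Let mp : cmeas p. Proof. exact: L1loc_cmeas_hl. Qed.

Let ms : cmeas s. Proof. by case: psiP => /L1loc_cmeas_hl. Qed.

Lemma weighted_L2_hl : (\int[mu]_x ((cmodulus (p x)) ^+ 2 * Num.min 1 x)%:E < +oo)%E.
Proof.
move: phi_L2; rewrite /finite_weighted_L2 integral_mkcond.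
rewrite (_ : (\int[mu]_x _)%E = (\int[mu]_x ((cmodulus (p x)) ^+ 2 * Num.min 1 x)%:E)%E)//.
apply: eq_integral => x _; rewrite patchE hlE /halfline mem_setE in_itv/= andbT.
by case: ifP => // _; rewrite cmodulus0 expr0n mul0r.
Qed.

(** On []0, 1]] local integrability suffices; beyond 1 the weight [1 /\ x] is 1 and
    [|phi| e^{- l x} <= |phi|^2 + e^{- 2 l x}]. Hence every [l > 0] is allowed, and not only those
    beyond the abscissa [a] of [psi]. *)
Lemma cL1_phi_expz (l : R) : 0 < l -> cL1 (fun x => p x * expz l%:C x).
Proof.
move=> l0.
have [_ /(_ `[0, 1]%classic (@segment_compact _ 0 1))] := phi_loc.
have sub : `[0, 1]%classic `<=` (`[0, +oo[%classic : set R).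
  by move=> x /=; rewrite !in_itv/= andbT => /andP[].
move=> /(_ sub) /(cintegrable_cres _ (measurable_itv _)) L01.
pose h (x : R) := cmodulus (cres `[0, 1]%classic phi x) +
   (cmodulus (p x) ^+ 2 * Num.min 1 x + (if 0 < x then expR (- (2 * l * x)) else 0)).
have w0 x : 0 <= cmodulus (p x) ^+ 2 * Num.min 1 x.
  have [x0|x0] := leP x 0; first by rewrite hl_le0// cmodulus0 expr0n mul0r.
  by rewrite mulr_ge0 ?sqr_ge0// le_min ler01 ltW.
have mw : measurable_fun setT (fun x : R => cmodulus (p x) ^+ 2 * Num.min 1 x).
  apply: measurable_funM; last exact: measurable_minr.
  by apply/measurable_EFinP; exact: (measurable_sqmod mp).
have me : measurable_fun setT (fun x : R => if 0 < x then expR (- (2 * l * x)) else 0).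
  apply: measurable_fun_ifT => //; first exact: measurable_gt0.
  apply: measurableT_comp => //; apply: measurableT_comp => //; exact: measurable_mull.
have ih : mu.-integrable setT (EFin \o h).
  apply: (@eq_integrable _ _ _ mu setT measurableT (fun x => (cmodulus (cres `[0, 1]%classic phi
    x))%:E + ((cmodulus (p x) ^+ 2 * Num.min 1 x)%:E + (if 0 < x then expR (- (2 * l * x)) else
      0)%:E))%E) => //.
  apply: integrableD => //; first exact: cL1_integrable.
  apply: integrableD => //; apply/integrableP; split.
  - exact/measurable_EFinP.
  - under eq_integral do rewrite gee0_abs ?lee_fin//.
    exact: weighted_L2_hl.
  - exact/measurable_EFinP.
  - have e0 (x : R) : 0 <= (if 0 < x then expR (- (2 * l * x)) else 0).
      by case: ifP => // _; exact: expR_ge0.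
    under eq_integral do rewrite gee0_abs ?lee_fin//.
    by rewrite integral_exp_halfline ?ltry// mulr_gt0.
apply: le_cL1 ih _; first exact: cmeasM (cmeas_expz _).
move=> x; rewrite cmodulus_mul_expz /= /h; have [x0|x0] := leP x 0.
  by rewrite hl_le0// cmodulus0 mul0r expr0n mul0r !addr0 cmodulus_ge0.
have [x1|x1] := leP x 1.
  rewrite /cres mem_setE in_itv/= (ltW x0) x1 hlE x0 ler_wpDr//.
    by rewrite addr_ge0 ?expR_ge0// mulr_ge0 ?sqr_ge0// ltW.
  by rewrite ler_piMr ?cmodulus_ge0// -expR0 ler_expR oppr_le0 mulr_ge0// ltW.
rewrite mulr1 ler_wpDl ?cmodulus_ge0//.
have -> : expR (- (2 * l * x)) = expR (- (l * x)) ^+ 2.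
  by rewrite -expRM_natl; congr expR; ring.
have := sqr_ge0 (cmodulus (p x) - expR (- (l * x))).
move: (cmodulus (p x)) (expR _) (cmodulus_ge0 (p x)) (expR_ge0 (- (l * x))) => y z y0 z0; nra.
Qed.

Lemma psi_laplace : exists2 a : R, 0 < a & cL1 (fun x => s x * expz a%:C x) /\
  forall l, a <= l -> 1 - Lap p l != 0 /\ Lap s l = Lap p l / (1 - Lap p l).
Proof.
have [_ [a [a0 ia hl_psi]]] := psiP; exists a => //; split.
  move: ia => /(cintegrable_cres _ measurable_halfline); congr cL1; apply/funext => x.
  rewrite -/(hl _) !hlE; case: ifP => _; last by rewrite mul0r.
  by rewrite expz_real mulrC.
by move=> l al; have := hl_psi l%:C al; rewrite !laplaceE.
Qed.

Lemma kernel_kE u y : 0 < u -> 0 < y -> kernel_k phi psi u y = renewal_kernel p s (u, y).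
Proof.
move=> u0 y0; have [loc_psi _] := psiP.
have mpsi := L1loc_cmeas loc_psi; have mphi := L1loc_cmeas phi_loc.
rewrite /kernel_k /renewal_kernel /memory_kernel /= cint_cres.
have -> : phi (u + y) = hankel p (u, y).
  by rewrite /hankel /= u0 y0 hlE addr_gt0.
congr (_ + _); apply: eq_ae_cint.
- have -> : cres `[0, u]%classic (fun r => phi (u + y - r) * psi r) = (fun r : R => if 0 <= r <=
  u then
     cres `[0, +oo[%classic phi (u + y - r) * cres `[0, +oo[%classic psi r else 0).
    apply/funext => r; rewrite /cres !mem_setE !in_itv/= !andbT.
    case: ifP => // /andP[r0 ru]; rewrite r0 subr_ge0.
    by rewrite (le_trans ru)// lerDl ltW.
  apply: cmeas_if; last exact: cmeas_cst.
    by apply: measurable_and; exact: measurable_fun_ler.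
  by apply: (cmeasM _ mpsi); apply: (cmeas_comp _ mphi); exact: measurable_funB.
- apply: (cmeasM _ ms); apply: (cmeas_comp _ (cmeas_hankel mp)); apply: measurable_fun_pair => //.
  exact: measurable_funB.
(* The endpoints of the closed interval are discarded: there [hl psi] and [hankel] vanish by
   convention, unlike [phi] and [psi]. *)
apply: ae_imply2 (ae_neq 0) (ae_neq u) => r r0 ru.
rewrite /cres mem_setE in_itv/= /hankel /= subr_gt0 y0 hlE (hlE psi).
case: (ltgtP r 0) r0 => // r0 _; first by rewrite mulr0.
case: (ltgtP r u) ru => //= ru _; last by rewrite mul0r.
by rewrite addrAC addrAC subr_gt0 (lt_trans ru) ?ltrDl// addrAC.
Qed.

Lemma op_KE t f x : 0 < x -> op_K phi psi t f x = kop (op_kernel p s t) (hl f) x.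
Proof.
move=> x0; rewrite kop_op_kernel x0 /op_K; case: ltP => xt; last first.
  by rewrite response_le0// subr_le0.
rewrite /response /kop cint_cres; congr cint; apply/funext => y.
rewrite -/(hl _ y) !hlE; case: ifP => y0; last by rewrite mulr0.
by rewrite kernel_kE// subr_gt0.
Qed.

Lemma op_TE t f : 0 <= t -> {ae mu, forall x, hl (op_T phi psi t f) x = T_op p s t (hl f) x}.
Proof.
move=> t0; apply: ae_imply (hl_shift_op f t0) => x E.
have [x0|x0] := leP x 0; first by rewrite hl_le0// T_op_le0//; exact: hl_le0.
by rewrite hlE x0 /op_T op_KE// /T_op -E hlE x0.
Qed.

Lemma cmeas_op_K t f : inL2 f -> cmeas (hl (op_K phi psi t f)).
Proof.
move=> /inL2P[mf _].
have -> : hl (op_K phi psi t f) = hl (kop (op_kernel p s t) (hl f)).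
  by apply/funext => x; rewrite !(hlE _ x); case: ifP => // x0; rewrite op_KE.
by apply: cmeas_hl; apply: (cmeas_kop _ mf); exact: cmeas_op_kernel.
Qed.

Lemma cmeas_op_T t f : 0 <= t -> inL2 f -> cmeas (hl (op_T phi psi t f)).
Proof.
move=> t0 Lf; rewrite hlD; apply: cmeasD; last exact: cmeas_op_K.
by have [mf _] := (inL2P f).1 Lf; exact: cmeas_shift_op.
Qed.

Let mk t : cmeas (op_kernel p s t). Proof. exact: cmeas_op_kernel. Qed.

Let hsk t : (hs_norm2 (op_kernel p s t) < +oo)%E.
Proof.
have [a a0 [Ls _]] := psi_laplace.
exact: (hs_norm2_op_kernel causal_p mp ms a0 Ls weighted_L2_hl).
Qed.

Lemma bounded_op_T t : 0 <= t -> bounded_operator (op_T phi psi t).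
Proof.
move=> t0; apply: (@bounded_shift_kernel _ _ 1 t _ (mk t) (hsk t)) => f Lf.
  exact: cmeas_op_T.
by apply: ae_imply (op_TE f t0) => x; rewrite hlE mul1r => + x0; rewrite x0.
Qed.

Lemma bounded_op_K t : bounded_operator (op_K phi psi t).
Proof.
apply: (@bounded_shift_kernel _ _ 0 t _ (mk t) (hsk t)) => f Lf.
  exact: cmeas_op_K.
by apply: aeW => x x0; rewrite mul0r add0r op_KE.
Qed.

Lemma op_T_semigroup t t' f : 0 <= t -> 0 <= t' -> inL2 f ->
  eqae (op_T phi psi (t + t') f) (op_T phi psi t (op_T phi psi t' f)).
Proof.
move=> t0 t'0 Lf; apply/eqaeP; have [a a0 [Ls ps]] := psi_laplace.
have [mf fi] := (inL2P f).1 Lf.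
have Lp := cL1_phi_expz a0.
have E := T_op_semigroup causal_p causal_s mp ms a0 Lp Ls weighted_L2_hl ps mf fi
  (fun x => @hl_le0 _ f x) t0 t'0.
have E' := ae_imply2 (fun=> @conj _ _) (op_TE f (addr_ge0 t0 t'0)) (op_TE (op_T phi psi t' f) t0).
have Esh := ae_shift (- t) (op_TE f t'0).
have E2 := ae_imply2 (fun=> @conj _ _) E' Esh.
apply: (ae_imply2 _ E E2) => x Ex [[Ea Eb] Ec].
rewrite Ea Eb Ex /T_op Ec; congr (_ + _); apply: eq_kop => //.
- exact: (cmeas_T_op mp ms mf).
- exact: cmeas_op_T.
by apply: (ae_imply _ (op_TE f t'0)) => y Ey; exact: esym Ey.
Qed.

Lemma op_T0 f : inL2 f -> eqae (op_T phi psi 0 f) f.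
Proof.
move=> Lf; apply/eqaeP; apply: ae_imply (op_TE f (lexx 0)) => x ->.
rewrite /T_op subr0 kop_op_kernel sub0r; case: ifP => x0; last by rewrite addr0.
by rewrite response_le0 ?addr0// oppr_le0 ltW.
Qed.

Lemma op_T_continuous f : inL2 f ->
  L2norm (fun x => op_T phi psi t f x - f x) @[t --> 0^'+] --> 0%E.
Proof.
move=> Lf; apply/L2norm_cvg0; apply/cvge0P => [t|e e0]; first exact: sqint_ge0.
have [a a0 [Ls ps]] := psi_laplace; have [mf fi] := (inL2P f).1 Lf.
have e4 : 0 < e / 4 by rewrite divr_gt0.
have [d1 d10 h1] := translation_L2 mf fi (fun x => @hl_le0 _ f x) e4.
have [d2 d20 h2] := kop_op_kernel_small causal_p causal_s mp ms a0 Ls weighted_L2_hl mf fi e4.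
near=> t; have t0 : 0 < t by near: t; exact: nbhs_right_gt.
have td1 : t < d1 by near: t; exact: nbhs_right_lt.
have td2 : t < d2 by near: t; exact: nbhs_right_lt.
have msh : cmeas (fun x : R => hl f (x - t) - hl f x).
  by apply: (cmeasB _ mf); apply: (cmeas_comp _ mf); exact: measurable_funB.
have mK := cmeas_kop (mk t) mf.
rewrite (@eq_ae_sqint _ _ (fun x => (hl f (x - t) - hl f x) + kop (op_kernel p s t) (hl f) x)).
- apply: le_trans (sqintD msh mK) _.
  apply: (@le_trans _ _ (2%:E * (e / 4)%:E + 2%:E * (e / 4)%:E)%E).
    by rewrite leeD// lee_pmul2l// ?h1 ?h2// ltW.
  by rewrite -!EFinM -EFinD lee_fin; lra.
- by rewrite hlD hlN; apply: cmeasD; [exact: cmeas_op_T (ltW t0) Lf|exact: cmeasN].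
- exact: cmeasD.
apply: ae_imply (op_TE f (ltW t0)) => x E.
by rewrite hlD hlN E /T_op; ring.
Unshelve. all: by end_near.
Qed.

Lemma C0_semigroup_op_T : C0_semigroup (op_T phi psi).
Proof.
split; [exact: bounded_op_T|exact: op_T0|exact: op_T_semigroup|exact: op_T_continuous].
Qed.

Lemma op_T_shift t : (fun f x => op_T phi psi t f x - shift_op t f x) = op_K phi psi t.
Proof. by apply/funext => f; apply/funext => x; rewrite /op_T addrAC subrr add0r. Qed.

Lemma HS_perturbation_op_T : HS_perturbation_of_shift (op_T phi psi).
Proof.
move=> t t0; rewrite op_T_shift; split; first exact: bounded_op_K.
move=> e [Le oe _].
have me n : cmeas (hl (e n)) by case: ((inL2P _).1 (Le n)).
have ie n : (sqint (hl (e n)) < +oo)%E by case: ((inL2P _).1 (Le n)).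
have := kop_hilbert_schmidt (mk t) (hsk t) me ie (fun m n => etrans (esym (innerE _ _)) (oe m n)).
move=> h; apply: le_lt_trans (hsk t); apply: le_trans h.
apply: lee_nneseries => n _; first by rewrite L2norm_sqr sqint_ge0.
rewrite L2norm_sqr -(_ : sqint (hl (kop (op_kernel p s t) (hl (e n)))) = sqint (hl (op_K phi psi
  t (e n)))).
  by apply: le_sqint_hl; exact: cmeas_kop.
by congr sqint; apply/funext => x; rewrite !(hlE _ x); case: ifP => // x0; rewrite op_KE.
Qed.

Lemma left_inverse_op_T : left_inverse_of_shift (op_T phi psi).
Proof.
move=> t t0; pose k' := adjoint_kernel (op_kernel p s t).
have mk' : cmeas k' by exact: cmeas_adjoint_kernel.
have hk' : (hs_norm2 k' < +oo)%E by rewrite hs_norm2_adjoint.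
(* The adjoint is the backward translation plus the adjoint kernel. On [shift_op t f] the
   translation gives back [f]; the kernel contributes nothing, because it lives on [x < t], where
   the shifted function vanishes. *)
exists (fun g x => hl g (x + t) + kop k' (hl g) x).
  split.
    apply: (@bounded_shift_kernel _ _ 1 (- t) _ mk' hk') => g Lg; have [mg gi] := (inL2P g).1 Lg.
      apply: cmeas_hl; apply: cmeasD; last exact: cmeas_kop.
      by apply: (cmeas_comp _ mg); exact: measurable_funD.
    by apply: aeW => x _; rewrite mul1r opprK.
  move=> f g Lf Lg; have [mf fi] := (inL2P f).1 Lf; have [mg gi] := (inL2P g).1 Lg.
  have mK := cmeas_kop (mk t) mf; have mK' := cmeas_kop mk' mg.
  have mfs : cmeas (fun x : R => hl f (x - t)) by apply: (cmeas_comp _ mf); exact: measurable_funB.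
  have mgs : cmeas (fun x : R => hl g (x + t)) by apply: (cmeas_comp _ mg); exact: measurable_funD.
  have mgc := cmeas_conj mg.
  have gci : (sqint (fun x => conjc (hl g x)) < +oo)%E by rewrite sqint_conj.
  have fsi : (sqint (fun x : R => hl f (x - t)) < +oo)%E by rewrite sqint_shift.
  have L1 : cL1 (fun x : R => hl f (x - t) * conjc (hl g x)) by exact: (cL1_mul mfs mgc fsi gci).
  have L2 : cL1 (fun x : R => kop (op_kernel p s t) (hl f) x * conjc (hl g x)).
    exact: (cL1_mul mK mgc (sqint_kop_lty (mk t) (hsk t) mf fi) gci).
  have L3 : cL1 (fun x : R => hl f x * conjc (kop k' (hl g) x)).
    apply: (cL1_mul mf (cmeas_conj mK') fi); rewrite sqint_conj.
    exact: (sqint_kop_lty mk' hk' mg gi).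
  have L4 : cL1 (fun x : R => hl f x * conjc (hl g (x + t))).
    apply: (cL1_mul mf (cmeas_conj mgs) fi); rewrite sqint_conj.
    have := sqint_shift mg (- t); rewrite opprK => ->; exact: gi.
  have [mL1 _] := L1.
  have E1 := cint_shift t mL1.
  have E2 := kop_adjoint (mk t) (hsk t) mf mg fi gi.
  rewrite !innerE.
  transitivity (cint setT (fun x : R => hl f (x - t) * conjc (hl g x)) +
      cint setT (fun x : R => kop (op_kernel p s t) (hl f) x * conjc (hl g x))).
    apply: etrans (cintD L1 L2); apply: eq_ae_cint.
    - exact: (cmeasM (cmeas_op_T t0 Lf) mgc).
    - by have [] := cL1D L1 L2.
    by apply: ae_imply (op_TE f t0) => x ->; rewrite /T_op mulrDl.
  rewrite -E1 E2.
  have -> : (fun x : R => hl f (x + t - t) * conjc (hl g (x + t))) =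
      (fun x : R => hl f x * conjc (hl g (x + t))).
    by apply/funext => x; rewrite addrK.
  apply: etrans (esym (cintD L4 L3)) _; congr cint; apply/funext => x.
  have [x0|x0] := leP x 0; first by rewrite hl_le0// !mul0r addr0.
  by rewrite (hlE (fun _ => _ + _) x) x0 rmorphD mulrDr.
move=> f Lf; have [mf fi] := (inL2P f).1 Lf; apply/eqaeP.
have mS := cmeas_shift_op t0 mf.
apply: ae_hl; apply: ae_imply (ae_shift t (hl_shift_op f t0)) => y E y0.
rewrite E addrK hlE y0 /kop [X in _ + X](_ : _ = 0) ?addr0//.
rewrite -[RHS](@cint0 _ setT); congr cint; apply/funext => x.
rewrite /k' /adjoint_kernel /op_kernel /= hlE /shift_op; case: ifP => x0; last by rewrite mulr0.
case: (ltP x t) => xt; first by rewrite mulr0.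
by rewrite renewal_kernel_le0 ?subr_le0// rmorph0 mul0r.
Qed.

End perturbed_shift.

(** * The fundamental theorem of calculus for absolutely continuous functions *)

Section absolutely_continuous_functions.
Context {R : realType}.
Local Notation mu := (@lebesgue_measure R).
Implicit Types (a b : R) (u : R -> R) (s : seq (R * R)).

(* An interval is a pair (right endpoint, left endpoint), in the order produced by
   the library on partitions, [zip s (a :: s)]. *)
Definition disjoint_itv (I J : R * R) := (I.1 <= J.2) || (J.1 <= I.2).

Definition in_itv_range a b (I : R * R) := [&& a <= I.2, I.2 <= I.1 & I.1 <= b].

Definition itv_family a b s := all (in_itv_range a b) s && pairwise disjoint_itv s.

Definition total_length s := \sum_(I <- s) (I.1 - I.2).

Definition increments u s := \sum_(I <- s) `|u I.1 - u I.2|.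

(** The bound on the increments is not strict, so that it survives the passage to suprema over
    partitions. *)
Definition AC a b u := forall e, 0 < e -> exists2 d, 0 < d &
  forall s, itv_family a b s -> total_length s < d -> increments u s <= e.

Lemma abs_continuous_AC a b (f : R -> R[i]) : abs_continuous a b f ->
  AC a b (Ref f) /\ AC a b (Imf f).
Proof.
move=> acf; suff H e : 0 < e -> exists2 d, 0 < d & forall s, itv_family a b s ->
    total_length s < d -> \sum_(I <- s) cmodulus (f I.1 - f I.2) <= e.
  split=> e e0; have [d d0 hd] := H e e0; exists d => // s fs ls;
    apply: le_trans (hd s fs ls); apply: ler_sum => I _.
    by apply: le_trans (Re_le_cmodulus _); rewrite ReD ReN.
  by apply: le_trans (Im_le_cmodulus _); rewrite ImD ImN.
move=> e0; have [d d0 hd] := acf e e0; exists d => // s /andP[/allP rs ps] ls.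
pose nt i := nth (0, 0) s i.
have := hd (size s) (fun i => (nt i).2) (fun i => (nt i).1).
move: ls; rewrite /total_length !(big_nth (0, 0)) !big_mkord => ls h; apply: ltW; apply: h => //.
  by move=> i; have /and3P[] := rs (nt i) (mem_nth _ (ltn_ord i)).
move=> i j ij; have [h|h|h] := ltngtP i j; last by rewrite (ord_inj h) eqxx in ij.
- have /(pairwiseP (0, 0))/(_ i j) := ps.
  by rewrite !inE !ltn_ord => /(_ isT isT h)/orP[]; [left|right].
- have /(pairwiseP (0, 0))/(_ j i) := ps.
  by rewrite !inE !ltn_ord => /(_ isT isT h)/orP[]; [right|left].
Qed.

Lemma itv_family_cat a b s1 s2 I l : itv_family a b (s1 ++ I :: s2) ->
  itv_family I.2 I.1 l -> itv_family a b (s1 ++ l ++ s2).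
Proof.
rewrite /itv_family !all_cat !pairwise_cat /= !allrel_catr allrel_consr.
move=> /and4P[/and3P[r1 rI r2] /andP[rel1I rel12] p1 /andP[pI p2]] /andP[rl pl].
have /and3P[aI II Ib] := rI.
have sub J : J \in l -> [/\ I.2 <= J.2, J.2 <= J.1 & J.1 <= I.1].
  by move=> /(allP rl)/and3P[].
rewrite r1 r2 rel12 p1 pl p2 !andbT /=; apply/and3P; split.
- by apply/allP => J /sub[h1 h2 h3]; apply/and3P; split => //; [exact: le_trans h1|exact:
  le_trans Ib].
- apply/allrelP => J K Js Kl; have /sub[h1 h2 h3] := Kl.
  by have /orP[h|h] := allP rel1I J Js; apply/orP; [left|right]; [exact: le_trans h1|exact:
    le_trans h].
- apply/allrelP => J K Jl Ks; have /sub[h1 h2 h3] := Jl.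
  by have /orP[h|h] := allP pI K Ks; apply/orP; [left|right]; [exact: le_trans h|exact: le_trans
    h1].
Qed.

Lemma itv_partition_family c d l : itv_partition c d l ->
  itv_family c d (zip l (c :: l)) /\ total_length (zip l (c :: l)) = d - c.
Proof.
elim: l c => [c /itv_partition_nil ->|x l ih c xl].
  by rewrite /total_length big_nil subrr.
have cx : c < x by case: xl => /= /andP[].
have xd : x <= d.
  have := itv_partition_cons xl; case: l {ih xl} => [/itv_partition_nil ->//|y l h].
  by apply: ltW; apply: (itv_partition_size_neq0 _ h).
have [fl ll] := ih x (itv_partition_cons xl).
have /andP[rl pl] := fl.
rewrite /total_length /= big_cons /= -/(total_length _) ll; split; last by ring.
apply/andP; split=> /=; apply/andP; split => //.
- by rewrite /in_itv_range /= lexx (ltW cx).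
- apply/allP => J /(allP rl)/and3P[h1 h2 h3]; apply/and3P; split => //.
  exact: le_trans (ltW cx) h1.
- by apply/allP => J /(allP rl)/and3P[h1 h2 h3]; apply/orP; left.
Qed.

Lemma total_length_cat s1 s2 : total_length (s1 ++ s2) = total_length s1 + total_length s2.
Proof. by rewrite /total_length big_cat. Qed.

Lemma increments_cat u s1 s2 : increments u (s1 ++ s2) = increments u s1 + increments u s2.
Proof. by rewrite /increments big_cat. Qed.

Lemma itv_partition_exists (c d : R) : c <= d -> exists l, itv_partition c d l.
Proof.
rewrite le_eqVlt => /predU1P[->|cd]; first by exists [::].
by exists [:: d]; exact: itv_partition1.
Qed.

(* Induction on [s2]: the variation of one more interval is a supremum over its
   partitions, whose intervals can be moved to [s1]. *)
Lemma total_variation_family a b u d e :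
  (forall s, itv_family a b s -> total_length s < d -> increments u s <= e) ->
  forall s2 s1, itv_family a b (s1 ++ s2) -> total_length (s1 ++ s2) < d ->
  ((increments u s1)%:E + \sum_(I <- s2) total_variation I.2 I.1 u <= e%:E)%E.
Proof.
move=> H; elim=> [|I s2 ih] s1.
  by rewrite cats0 big_nil adde0 lee_fin; exact: H.
move=> fs ls; rewrite big_cons.
have II : I.2 <= I.1.
  by move: fs; rewrite /itv_family all_cat /= => /andP[/and3P[_ /and3P[]]].
have step l : itv_partition I.2 I.1 l -> ((increments u s1 + variation I.2 I.1 u l)%:E +
    \sum_(J <- s2) total_variation J.2 J.1 u <= e%:E)%E.
  move=> pl; have [fl ll] := itv_partition_family pl.
  rewrite variation_zip// -/(increments u _) -increments_cat; apply: ih.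
    by rewrite -catA; exact: itv_family_cat fl.
  by move: ls; rewrite !total_length_cat ll /total_length big_cons addrA.
set Y := (\sum_(J <- s2) _)%E in step *.
have Y0 : (0 <= Y)%E.
  rewrite /Y big_seq; apply: sume_ge0 => J Js; apply: total_variation_ge0.
  move: fs; rewrite /itv_family all_cat /= => /andP[/and3P[_ _ /allP/(_ J Js)]].
  by move=> /and3P[].
(* One partition of [I] already bounds [Y] through [step]; being finite, [Y] can be subtracted in
   the supremum over all partitions. *)
have Yfin : Y \is a fin_num.
  have [l /step + ] := itv_partition_exists II; move: Y0; clearbody Y.
  by clear; case: Y => // [|].
rewrite -(fineK Yfin) in step *; move: (fine Y) step => y step.
have TVle : (total_variation I.2 I.1 u <= (e - increments u s1 - y)%:E)%E.
  apply: ge_ereal_sup => _ [v [l pl <-] <-]; have := step l pl.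
  by rewrite -EFinD !lee_fin; lra.
apply: le_trans (leeD2l _ (leeD2r _ TVle)) _.
by rewrite -!EFinD lee_fin; lra.
Qed.

(** On pieces of length at most [h = d / 2] the variation is at most 1, and finitely many such
    pieces cover [[a, b]]. *)
Lemma total_variation_lty a b u : a <= b -> AC a b u -> (total_variation a b u < +oo)%E.
Proof.
move=> ab acu; have [d d0 hd] := acu 1 ltr01; pose h := d / 2.
have h0 : 0 < h by rewrite divr_gt0.
have small c c' : a <= c -> c <= c' -> c' <= b -> c' - c <= h -> (total_variation c c' u <= 1%:E)%E.
  move=> ac cc' c'b hc.
  have := @total_variation_family a b u d 1 hd [:: (c', c)] [::].
  rewrite /itv_family /= /in_itv_range /= ac cc' c'b /total_length /increments big_nil !big_seq1
    add0e /= => /(_ isT).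
  by apply; rewrite (le_lt_trans hc)// /h; lra.
have ind n c : a <= c -> c <= b -> c - a <= n%:R * h -> (total_variation a c u < +oo)%E.
  elim: n c => [|n ih] c ac cb hc.
    have -> : c = a by move: hc; rewrite mul0r; lra.
    by rewrite total_variationxx.
  have [ca|ca] := leP (c - h) a.
    by apply: le_lt_trans (small a c _ _ _ _) _; rewrite ?ltry//; lra.
  have h1 : c - h <= c by lra.
  rewrite (total_variationD u (ltW ca) h1) lte_add_pinfty//.
    apply: ih; [exact: ltW|lra|]; move: hc; rewrite -natr1 mulrDl mul1r; lra.
  by apply: le_lt_trans (small _ _ (ltW ca) h1 cb _) _; rewrite ?ltry//; lra.
apply: (ind (Num.bound ((b - a) / h))) => //.
rewrite -ler_pdivrMr//; apply: ltW; apply: archi_boundP.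
by rewrite divr_ge0// ?subr_ge0// ltW.
Qed.

Lemma AC_add a b u v : AC a b u -> AC a b v -> AC a b (fun x => u x + v x).
Proof.
move=> acu acv e e0; have e2 : 0 < e / 2 by rewrite divr_gt0.
have [d1 d10 h1] := acu _ e2; have [d2 d20 h2] := acv _ e2.
exists (Num.min d1 d2); first by rewrite lt_min d10.
move=> s fs; rewrite lt_min => /andP[l1 l2].
rewrite [leRHS]splitr; apply: le_trans (lerD (h1 s fs l1) (h2 s fs l2)).
rewrite /increments -big_split /=; apply: ler_sum => I _.
by rewrite opprD addrACA ler_normD.
Qed.

Section variation_function.
Variables (a b : R) (u : R -> R).
Hypotheses (ab : a <= b) (acu : AC a b u).

Definition varfun x := fine (total_variation a x u).

Lemma varfun_increment x y : a <= x -> x <= y -> y <= b ->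
  total_variation x y u = (varfun y - varfun x)%:E.
Proof.
move=> ax xy yb.
have fin c : a <= c -> c <= b -> total_variation a c u \is a fin_num.
  move=> ac cb; rewrite ge0_fin_numE ?total_variation_ge0//.
  apply: le_lt_trans (total_variation_lty ab acu).
  by rewrite (total_variationD u ac cb) leeDl// total_variation_ge0.
have fx := fin x ax (le_trans xy yb); have fy := fin y (le_trans ax xy) yb.
have := total_variationD u ax xy; rewrite /varfun.
rewrite -(fineK fx) -(fineK fy); case: (total_variation x y u) => //= r.
by rewrite -EFinD => -[->]; congr EFin; ring.
Qed.

Lemma varfun_ge x y : a <= x -> x <= y -> y <= b -> `|u y - u x| <= varfun y - varfun x.
Proof.
by move=> ax xy yb; rewrite -lee_fin -varfun_increment// total_variation_ge.
Qed.

Lemma AC_varfun : AC a b varfun.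
Proof.
move=> e e0; have [d d0 hd] := acu e0; exists d => // s fs ls.
have := total_variation_family hd (s1 := [::]) fs ls.
rewrite /increments big_nil add0e -lee_fin; apply: le_trans.
rewrite -sumEFin !big_seq le_eqVlt; apply/orP; left; apply/eqP; apply: eq_bigr => I Is.
have /andP[/allP/(_ I Is)/and3P[h1 h2 h3] _] := fs.
rewrite varfun_increment// ger0_norm//.
by apply: le_trans (varfun_ge h1 h2 h3).
Qed.

Lemma varfun_nondecreasing x y : a <= x -> x <= y -> y <= b -> varfun x <= varfun y.
Proof.
by move=> ax xy yb; rewrite -subr_ge0; apply: le_trans (varfun_ge ax xy yb).
Qed.

Lemma varfunD_nondecreasing x y : a <= x -> x <= y -> y <= b ->
  varfun x + u x <= varfun y + u y.
Proof.
move=> ax xy yb; have := varfun_ge ax xy yb; rewrite ler_norml; lra.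
Qed.

End variation_function.

Section monotone_AC.
Variables (a b : R) (F : R -> R).
Hypothesis ab : a < b.
Hypothesis ndF : forall x y, a <= x -> x <= y -> y <= b -> F x <= F y.
Hypothesis acF : AC a b F.

Let cl (x : R) := Num.max a (Num.min b x).

Let cl_range x : a <= cl x <= b.
Proof. by rewrite /cl le_max lexx ge_max ge_min lexx (ltW ab). Qed.

Let cl_mono x y : x <= y -> cl x <= cl y.
Proof.
move=> xy; rewrite /cl ge_max !le_max lexx /= ge_min le_min.
by case: (leP b x) => bx; rewrite ?lexx ?orbT //= ?(le_trans bx xy)?orbT// ?xy ?orbT//;
  case: (leP b y); rewrite ?lexx ?(ltW bx) ?xy ?orbT.
Qed.

Let cl_lip x y : x <= y -> cl y - cl x <= y - x.
Proof.
move=> xy; rewrite /cl; case: (leP b x) => bx; case: (leP b y) => by_;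
  case: (leP a b) => abb; do ?[case: (leP a x) => ax]; do ?[case: (leP a y) => ay]; lra.
Qed.

Let cl_id x : a <= x -> x <= b -> cl x = x.
Proof. by move=> ax xb; rewrite /cl (min_idPr xb) (max_idPr ax). Qed.

(* [clamped] is constant outside [a, b]: it has a Stieltjes measure, which absolute
   continuity makes dominated by the Lebesgue measure. *)
Definition clamped x := F (cl x).

Lemma clamped_nondecreasing : nondecreasing clamped.
Proof.
move=> x y xy; have /andP[ax xb] := cl_range x; have /andP[ay yb] := cl_range y.
by apply: ndF => //; exact: cl_mono.
Qed.

Lemma clamped_right_continuous : right_continuous clamped.
Proof.
apply: right_continuousW => x; apply/cvgrPdist_le => e e0.
have [d d0 hd] := acF e0.
have key w v : w <= v -> v - w < d -> `|clamped v - clamped w| <= e.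
  move=> uv dv; have := hd [:: (cl v, cl w)].
  rewrite /increments /total_length !big_seq1 /itv_family /= /in_itv_range /=.
  have /andP[-> _] := cl_range w; have /andP[_ ->] := cl_range v.
  by rewrite cl_mono//= => /(_ isT); apply; exact: le_lt_trans (cl_lip uv) dv.
near=> y; have xy : `|x - y| < d by near: y; exact: cvgr_dist_lt.
have [h|/ltW h] := leP x y.
- by rewrite distrC key//; move: xy; rewrite distrC ger0_norm ?subr_ge0.
- by rewrite key//; move: xy; rewrite ger0_norm ?subr_ge0.
Unshelve. all: by end_near.
Qed.

Definition clamped_cumulative : cumulative R R :=
  Cumulative.Pack (Cumulative.Class (isCumulative.Build R _ R clamped
    clamped_nondecreasing clamped_right_continuous)).

Let lsf : {measure set (measurableTypeR R) -> \bar R} :=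
  lebesgue_stieltjes_measure clamped_cumulative.

Let lsf_itv x y : x <= y -> lsf `]x, y]%classic = (clamped y - clamped x)%:E.
Proof.
move=> xy; change (lebesgue_stieltjes_measure clamped_cumulative `]x, y]%classic = (clamped y -
  clamped x)%:E).
rewrite /lebesgue_stieltjes_measure /measure_extension.
by rewrite measurable_mu_extE; [rewrite /= wlength_itv_bnd|exact: is_ocitv].
Qed.

(** The components of [U], with endpoints clamped to [[a, b]], form families of total length below
    [d], and their increments dominate the Stieltjes measures of the components. Boundedness of [U]
    makes each component the interval between its infimum and supremum. *)
Let open_small e : 0 < e -> exists2 d : R, 0 < d & forall U : set R, open U ->
  U `<=` `]a - 1, b + 1[%classic -> (mu U < d%:E)%E -> (lsf U <= e%:E)%E.
Proof.
move=> e0; have [d d0 hd] := acF e0; exists d => // U oU Uab Ud.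
pose I := open_disjoint_itv oU; pose al i := inf (I i); pose be i := sup (I i).
have mI i : measurable (I i) by apply: open_measurable; exact: open_disjoint_itv_open.
have trI : trivIset setT I by exact: open_disjoint_itv_trivIset.
have UI : U = \bigcup_q I q by exact: open_disjoint_itv_bigcup.
have Isub i : I i `<=` `]a - 1, b + 1[%classic.
  by apply: subset_trans Uab; rewrite UI; exact: bigcup_sup.
have IE i : I i = `]al i, be i[%classic.
  have : open (I i) by exact: open_disjoint_itv_open.
  rewrite openE => IIo.
  have lb : has_lbound (I i).
    by exists (a - 1) => x /Isub /=; rewrite in_itv/= => /andP[/ltW].
  have ub : has_ubound (I i).
    by exists (b + 1) => x /Isub /=; rewrite in_itv/= => /andP[_ /ltW].
  have itvI : is_interval (I i) by exact: open_disjoint_itv_is_interval.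
  have E := interval_bounded_interior itvI lb ub.
  apply/seteqP; split => x.
    by move=> /IIo; rewrite -/(I i) E /= in_itv/=.
  by rewrite /= in_itv/= => h; apply: (@interior_subset _ (I i)); rewrite E.
have disj i j : i != j -> al i < be i -> al j < be j -> be i <= al j \/ be j <= al i.
  move=> ij hi hj; apply/orP; rewrite -[_ || _]negbK negb_or -!ltNge; apply/negP => /andP[h1 h2].
  pose z := (Num.max (al i) (al j) + Num.min (be i) (be j)) / 2.
  have zz : Num.max (al i) (al j) < Num.min (be i) (be j).
    by rewrite gt_max !lt_min hi hj h1 h2.
  have [z1 z2] : Num.max (al i) (al j) < z /\ z < Num.min (be i) (be j) by rewrite /z; split; lra.
  move: z1 z2; rewrite gt_max lt_min => /andP[z1 z2] /andP[z3 z4].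
  have : (I i `&` I j) z by rewrite !IE /= !in_itv/= z1 z2 z3 z4.
  have := trI i j Logic.I Logic.I; move/eqP: ij => ij.
  by move=> h hz; apply: ij; apply: h; exists z.
(* The enumeration may contain empty components, to which the degenerate interval at [a] is
   assigned; it is disjoint from any other in the sense of [disjoint_itv]. *)
pose J i := if al i < be i then (cl (be i), cl (al i)) else (a, a).
have J_in i : in_itv_range a b (J i).
  rewrite /J /in_itv_range; case: ifP => [h|_] /=; last by rewrite lexx (ltW ab).
  have /andP[-> _] := cl_range (al i); have /andP[_ ->] := cl_range (be i).
  by rewrite cl_mono// ltW.
have fam n : itv_family a b (mkseq J n).
  apply/andP; split; first by apply/allP => K /mapP[i _ ->].
  apply/(pairwiseP (a, a)) => i j; rewrite !inE size_mkseq => ni nj ij.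
  rewrite !nth_mkseq// /disjoint_itv; have /and3P[Ja1 Ja2 Ja3] := J_in i.
  have /and3P[Jb1 Jb2 Jb3] := J_in j.
  move: Ja1 Ja2 Ja3 Jb1 Jb2 Jb3; rewrite /J.
  case: ifP => hi; case: ifP => hj //= *; try by apply/orP; ((by left)||(by right)).
  have /disj/(_ hi hj)[h|h] : i != j by rewrite ltn_eqF.
  - by apply/orP; left; exact: cl_mono.
  - by apply/orP; right; exact: cl_mono.
have len n : (total_length (mkseq J n) < d)%R.
  rewrite -lte_fin; apply: le_lt_trans Ud.
  rewrite UI measure_semi_bigcup//; last by rewrite -UI; exact: open_measurable.
  apply: le_trans (nneseries_lim_ge n _); last by move=> *; exact: measure_ge0.
  rewrite /total_length big_map -sumEFin /index_iota subn0; apply: lee_sum => i _.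
  rewrite /J; case: ifP => h /=; last by rewrite subrr measure_ge0.
  have := lebesgue_measure_itv `]al i, be i[; rewrite -IE /= lte_fin h => ->.
  by rewrite -EFinD lee_fin cl_lip// ltW.
have incr n : (\sum_(0 <= i < n) lsf (I i) <= e%:E)%E.
  apply: (@le_trans _ _ (increments F (mkseq J n))%:E); last by rewrite lee_fin hd.
  rewrite /increments big_map -sumEFin /index_iota subn0; apply: lee_sum => i _.
  rewrite IE /J; case: ltP => h /=; last first.
    rewrite set_itv_ge; first by rewrite measure0 lee_fin.
    by rewrite bnd_simp -leNgt.
  apply: (@le_trans _ _ (lsf `]al i, be i]%classic)).
    by apply: le_measure; rewrite ?inE; [exact: measurable_itv|exact: measurable_itv|exact:
      subset_itvW].
  by rewrite lsf_itv ?(ltW h)// lee_fin ler_norm.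
rewrite UI measure_semi_bigcup//; last by rewrite -UI; exact: open_measurable.
apply: lime_le; first by apply: is_cvg_nneseries => *; exact: measure_ge0.
by near=> n; exact: incr.
Unshelve. all: by end_near.
Qed.

Let lsf_fin : (lsf `]a, b]%classic < +oo)%E.
Proof. by rewrite lsf_itv ?ltry// ltW. Qed.

Let nu : {finite_measure set (measurableTypeR R) -> \bar R} 
  := mfrestr (f := lsf) (measurable_itv `]a, b]) lsf_fin.

(** By outer regularity a Lebesgue null set lies in open sets of arbitrarily small measure, to which
    [open_small] applies. *)
Let nu_dom : nu `<< mu.
Proof.
move=> A nA B mB BA.
have B0 : mu B = 0%E by exact: nA mB BA.
apply/eqP; rewrite eq_le; apply/andP; split; last exact: measure_ge0.
apply/lee_addgt0Pr => e e0; rewrite add0e; have [d d0 hd] := open_small e0.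
pose B' := B `&` `]a, b]%classic.
have mB' : measurable B' by apply: measurableI => //; exact: measurable_itv.
have B'0 : mu B' = 0%E.
  apply/eqP; rewrite eq_le measure_ge0 andbT -B0; apply: le_measure; rewrite ?inE//.
  exact: subIsetl.
have B'fin : (mu B' < +oo)%E by rewrite B'0 ltry.
have [U [oU B'U Ud]] := lebesgue_regularity_outer mB' B'fin d0.
pose U' := U `&` `]a - 1, b + 1[%classic.
have oU' : open U' by apply: openI => //; exact: interval_open.
have B'U' : B' `<=` U'.
  move=> x B'x; split; first exact: B'U.
  by have [_ ] := B'x; rewrite /= !in_itv/= => /andP[h1 h2]; apply/andP; split; lra.
apply: (@le_trans _ _ (lsf U')).
  by apply: le_measure; rewrite ?inE//; exact: open_measurable.
apply: hd => //; first by move=> x [].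
apply: le_lt_trans Ud.
apply: (@le_trans _ _ (mu (U `\` B') + mu B')%E); last by rewrite B'0 adde0.
have mU : measurable U by exact: open_measurable.
have mUB : measurable (U `\` B') by exact: measurableD.
have le2 : (mu ((U `\` B') `|` B') <= mu (U `\` B') + mu B')%E by exact: measureU2.
apply: le_trans le2.
apply: le_measure; rewrite ?inE//; [exact: open_measurable|exact: measurableU|].
move=> x [Ux _]; case: (pselect (B' x)) => h; [by right|by left].
Qed.

Lemma monotone_AC_integral : exists g : R -> R,
  mu.-integrable setT (EFin \o g) /\
  forall x, a <= x -> x <= b -> F x - F a = (\int[mu]_(t in `]a, x]) g t)%R.
Proof.
pose h := Radon_Nikodym_SigmaFinite.f nu mu.
have hfin x : h x \is a fin_num by exact: (Radon_Nikodym_SigmaFinite.f_fin_num nu_dom).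
have Eh : EFin \o (fine \o h) = h by apply/funext => x /=; rewrite fineK.
exists (fine \o h); rewrite Eh; split; first exact: (Radon_Nikodym_SigmaFinite.f_integrable nu_dom).
move=> x ax xb; rewrite /Rintegral.
rewrite (eq_integral h) => [|t _]; last by rewrite /= fineK.
rewrite -(Radon_Nikodym_SigmaFinite.f_integral nu_dom (measurable_itv _)).
transitivity (fine (lsf (`]a, x]%classic `&` `]a, b]%classic))); last by [].
have -> : `]a, x]%classic `&` `]a, b]%classic = `]a, x]%classic.
  by apply: setIidl; apply: subset_itvl; rewrite bnd_simp.
by rewrite lsf_itv// /clamped !cl_id// ltW.
Qed.

End monotone_AC.

(** Jordan decomposition: [u] is the difference of [varfun + u] and [varfun], both nondecreasing and
    absolutely continuous, so [g] is a difference of two densities. Lebesgue differentiation then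
    identifies it with the derivative. *)
Theorem AC_FTC a b u : a < b -> AC a b u -> exists g : R -> R,
  [/\ mu.-integrable setT (EFin \o g),
      forall x, a <= x -> x <= b -> u x = u a + (\int[mu]_(t in `]a, x]) g t)%R &
      {ae mu, forall x, a < x < b -> derivable u x 1 /\ derive1 u x = g x}].
Proof.
move=> ab acu; have leab := ltW ab; have acv := AC_varfun leab acu.
have [g1 [ig1 E1]] := monotone_AC_integral ab (varfun_nondecreasing leab acu) acv.
have [g2 [ig2 E2]] := monotone_AC_integral ab (varfunD_nondecreasing leab acu) (AC_add acv acu).
have ig : mu.-integrable setT (EFin \o (fun x => g2 x - g1 x)).
  have -> : EFin \o (fun x => g2 x - g1 x) = (fun x => (g2 x)%:E - (g1 x)%:E)%E.
    by apply/funext => x.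
  exact: integrableB.
have E x : a <= x -> x <= b -> u x = u a + (\int[mu]_(t in `]a, x]) (g2 t - g1 t))%R.
  move=> ax xb; have e1 := E1 x ax xb; have e2 := E2 x ax xb.
  rewrite RintegralB -?e1 -?e2//; first ring.
  - by apply: integrableS ig2.
  - by apply: integrableS ig1.
exists (fun x => g2 x - g1 x); split => //.
have loc : locally_integrable [set: R] (fun x => g2 x - g1 x).
  exact: (open_integrable_locally openT ig).
have intf y : mu.-integrable [set` Interval (BRight a) (BRight y)] (EFin \o (fun x => g2 x - g1 x)).
  by apply: integrableS ig.
apply: ae_imply (FTC1 intf loc) => x h /andP[ax xb].
have [|d1 d2] := h; first exact: ax.
pose G y := u a + (\int[mu]_(t in `]a, y]) (g2 t - g1 t))%R.
have nE : \near x, G x = u x.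
  near=> y; apply/esym/E; apply: ltW; near: y; [exact: lt_nbhsr|exact: lt_nbhsl].
have dF : is_derive x (1 : R) (fun y => \int[mu]_(t in `]a, y]) (g2 t - g1 t))%R (g2 x - g1 x).
  by apply: DeriveDef; rewrite -?derive1E.
have [du duE] := near_eq_is_derive nE (is_deriveD (is_derive_cst (u a) x (1 : R)) dF).
by split => //; rewrite derive1E duE add0r.
Unshelve. all: by end_near.
Qed.

End absolutely_continuous_functions.

(** * Laplace transforms of derivatives and exponentials *)

Section Laplace_of_derivative.
Context {R : realType}.
Local Notation mu := (@lebesgue_measure R).

Lemma cmeas_step : cmeas (fun x : R => if 0 < x then 1 else 0 : R[i]).
Proof. exact: (cmeas_if measurable_gt0 (cmeas_cst 1) (cmeas_cst 0)). Qed.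

Lemma step_expz (l : R) : 0 < l ->
  cL1 (fun x : R => (if 0 < x then 1 else 0) * expz l%:C x) /\
  cint setT (fun x : R => (if 0 < x then 1 else 0) * expz l%:C x) = (l^-1)%:C.
Proof.
move=> l0; pose h (x : R) : R := if 0 < x then expR (- (l * x)) else 0.
have E : (fun x : R => (if 0 < x then 1 else 0) * expz l%:C x) = (fun x => (h x)%:C).
  by apply/funext => x; rewrite expz_real /h; case: ifP => _; rewrite ?mul1r ?mul0r.
have mh : measurable_fun setT h.
  apply: measurable_fun_ifT => //; first exact: measurable_gt0.
  apply: measurableT_comp => //; apply: measurableT_comp => //; exact: measurable_mull.
have h0 x : 0 <= h x by rewrite /h; case: ifP => // _; exact: expR_ge0.
have ih := integral_exp_halfline l0.
rewrite E; split.
  split; first exact: cmeas_real.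
  under eq_integral do rewrite cmodulusC ger0_norm//.
  by rewrite ih ltry.
rewrite /cint; apply: complex_ext => /=.
  by rewrite /Rintegral [X in fine X](_ : _ = (l^-1)%:E)// -ih; apply: eq_integral.
rewrite /Rintegral (eq_integral (fun=> 0%E)) ?integral0// => x _.
Qed.

Lemma sqint_hl_expz (z : R[i]) : 0 < complex.Re z -> (sqint (hl (expz z)) < +oo)%E.
Proof.
move=> z0; have z2 : 0 < 2 * complex.Re z by rewrite mulr_gt0.
have -> : sqint (hl (expz z)) =
    (\int[mu]_x (if (0 < x)%R then expR (- (2 * complex.Re z * x)) else 0%R)%:E)%E.
  apply: eq_integral => x _; rewrite hlE; case: ifP => _; last by rewrite cmodulus0 expr0n.
  by rewrite cmodulus_expz -expRM_natl; congr (expR _)%:E; ring.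
by rewrite integral_exp_halfline// ltry.
Qed.

Lemma cmeas_hl_expz z : cmeas (hl (expz z : R -> R[i])).
Proof. by apply: cmeas_hl; exact: cmeas_expz. Qed.

Lemma inL2_expz z : 0 < complex.Re z -> inL2 (expz z : R -> R[i]).
Proof. by move=> z0; apply/inL2P; split; [exact: cmeas_hl_expz|exact: sqint_hl_expz]. Qed.

Lemma cL1_inL2_expz f z : 0 < complex.Re z -> inL2 f -> cL1 (fun x : R => hl f x * expz z x).
Proof.
move=> z0 /inL2P[mf fi].
have -> : (fun x : R => hl f x * expz z x) = (fun x => hl f x * hl (expz z) x).
  by apply/funext => x; rewrite !hlE; case: ifP => //; rewrite !mul0r.
exact: (cL1_mul mf (cmeas_hl_expz z) fi (sqint_hl_expz z0)).
Qed.

Lemma AC_primitive (p : R -> R[i]) x : locally_AC p -> cmeas (hl (cderiv p)) -> 0 < x ->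
  p x = p 0 + cint setT (fun r => if 0 < r < x then cderiv p r else 0).
Proof.
move=> acp mq x0; have [acR acI] := abs_continuous_AC (acp x x0).
have [g1 [ig1 E1 d1]] := AC_FTC x0 acR; have [g2 [ig2 E2 d2]] := AC_FTC x0 acI.
pose G r : R[i] := if 0 < r <= x then g1 r +i* g2 r else 0.
have mg (g : R -> R) : mu.-integrable setT (EFin \o g) -> measurable_fun setT g.
  by move=> /integrableP[/measurable_EFinP].
have mb : measurable_fun setT (fun r : R => 0 < r <= x).
  by apply: measurable_and; [exact: measurable_fun_ltr|exact: measurable_fun_ler].
have mb' : measurable_fun setT (fun r : R => 0 < r < x).
  by apply: measurable_and; exact: measurable_fun_ltr.
have mG : cmeas G.
  by apply: (cmeas_if mb _ (cmeas_cst 0)); split => /=; exact: mg.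
have EG : cint setT G = p x - p 0.
  apply: complex_ext; rewrite /= ?ReD ?ReN ?ImD ?ImN.
    have -> : complex.Re (p x) - complex.Re (p 0) = (\int[mu]_(t in `]0, x]) g1 t)%R.
      by have := E1 x (ltW x0) (lexx x); rewrite /Ref => ->; ring.
    rewrite [RHS]Rintegral_mkcond; congr Rintegral; apply/funext => r.
    by rewrite patchE mem_setE in_itv/= /Ref /G; case: ifP.
  have -> : complex.Im (p x) - complex.Im (p 0) = (\int[mu]_(t in `]0, x]) g2 t)%R.
    by have := E2 x (ltW x0) (lexx x); rewrite /Imf => ->; ring.
  rewrite [RHS]Rintegral_mkcond; congr Rintegral; apply/funext => r.
  by rewrite patchE mem_setE in_itv/= /Imf /G; case: ifP.
have <- : cint setT G = cint setT (fun r => if 0 < r < x then cderiv p r else 0).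
  apply: eq_ae_cint => //.
    have -> : (fun r => if 0 < r < x then cderiv p r else 0) = (fun r => if 0 < r < x then hl
      (cderiv p) r else 0).
      by apply/funext => r; rewrite hlE; case: ifP => // /andP[->].
    exact: (cmeas_if mb' mq (cmeas_cst 0)).
  apply: ae_imply2 (ae_imply2 (fun=> @conj _ _) d1 d2) (ae_neq x) => r [D1 D2] rx.
  rewrite /G; case: (ltgtP r x) rx => // rx _; last by rewrite !andbF.
  rewrite !andbT; case: ifP => // r0; rewrite /cderiv.
  have r0x : 0 < r < x by rewrite r0.
  by have [_ ->] := D1 r0x; have [_ ->] := D2 r0x.
by rewrite EG; ring.
Qed.

(** With the Heaviside function [H], [p = p 0 * H + conv H p'] on the half-line. The convolution
    theorem and the transform [1 / l] of [H] take the place of an integration by parts, so no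
    boundary term at infinity arises. *)
Lemma Laplace_cderiv (p : R -> R[i]) (l : R) : locally_AC p -> inL2 p -> inL2 (cderiv p) ->
  0 < l -> laplace (cderiv p) l%:C = l%:C * laplace p l%:C - p 0.
Proof.
move=> acp Lp Lq l0; have [mq qi] := (inL2P _).1 Lq.
pose H (x : R) : R[i] := if 0 < x then 1 else 0.
have l0C : 0 < complex.Re (l%:C : R[i]) by [].
have [LH EH] := step_expz l0.
have LQ := cL1_inL2_expz l0C Lq.
have Ep : hl p = (fun x => p 0 * H x + conv H (hl (cderiv p)) x).
  apply/funext => x; rewrite hlE; case: ifP => x0; last first.
    have H0 y : y <= 0 -> H y = 0 by rewrite /H ltNge => ->.
    have x0' : x <= 0 by rewrite leNgt x0.
    by rewrite (conv_le0 H0 (@hl_le0 _ (cderiv p)) x0') H0// mulr0 addr0.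
  rewrite (AC_primitive acp mq x0) /H x0 mulr1; congr (_ + _).
  rewrite /conv; congr cint; apply/funext => r; rewrite hlE subr_gt0.
  by case: (0 < r); case: (r < x); rewrite /= ?mul1r ?mul0r ?mulr0.
have mH : cmeas H by exact: cmeas_step.
have LC := cL1_conv mH mq LH LQ.
have E : laplace p l%:C = p 0 * (l^-1)%:C + (l^-1)%:C * laplace (cderiv p) l%:C.
  rewrite [LHS]laplaceE Ep.
  rewrite (_ : (fun x => _ * expz _ _) = (fun x : R => p 0 * (H x * expz l%:C x) + conv H (hl
    (cderiv p)) x * expz l%:C x)); last first.
    by apply/funext => x; rewrite mulrDl mulrA.
  rewrite (cintD (cL1Z (p 0) LH) LC) (cintZ (p 0) LH) EH (Laplace_conv mH mq LH LQ) EH.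
  by rewrite laplaceE.
rewrite E mulrDr mulrCA -rmorphM mulfV ?gt_eqF// mulr1 mulrA -rmorphM mulfV ?gt_eqF// mul1r.
by rewrite addrAC subrr add0r.
Qed.

End Laplace_of_derivative.

Section smooth_functions.
Context {R : realType}.
Implicit Types (f g : R -> R[i]).

Definition has_cderiv_at f (x : R) (v : R[i]) :=
  is_derive x (1 : R) (Ref f) (complex.Re v) /\
  is_derive x (1 : R) (Imf f) (complex.Im v).

Definition has_cderiv f g := forall x, has_cderiv_at f x (g x).

Lemma has_cderiv_atE f x v : has_cderiv_at f x v -> cderivable f x /\ cderiv f x = v.
Proof.
move=> [[fR dR] [fI dI]]; split => //.
by apply: complex_ext; rewrite /cderiv /= derive1E.
Qed.

Lemma has_cderivE f g : has_cderiv f g -> cderiv f = g.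
Proof. by move=> fg; apply/funext => x; have [_] := has_cderiv_atE (fg x). Qed.

Lemma has_cderiv_atD f g x v w : has_cderiv_at f x v -> has_cderiv_at g x w ->
  has_cderiv_at (fun x => f x + g x) x (v + w).
Proof.
move=> [fR fI] [gR gI]; split.
  have -> : Ref (fun x => f x + g x) = Ref f + Ref g by apply/funext => y; rewrite /Ref /= ReD.
  by rewrite ReD; exact: is_deriveD.
have -> : Imf (fun x => f x + g x) = Imf f + Imf g by apply/funext => y; rewrite /Imf /= ImD.
by rewrite ImD; exact: is_deriveD.
Qed.

Lemma has_cderiv_atZ (c : R[i]) f x v : has_cderiv_at f x v ->
  has_cderiv_at (fun x => c * f x) x (c * v).
Proof.
move=> [fR fI]; split.
  have -> : Ref (fun x => c * f x) = complex.Re c \*: Ref f - complex.Im c \*: Imf f.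
    by apply/funext => y; rewrite /Ref /= ReM.
  by rewrite ReM; apply: is_deriveB; exact: is_deriveZ.
have -> : Imf (fun x => c * f x) = complex.Re c \*: Imf f + complex.Im c \*: Ref f.
  by apply/funext => y; rewrite /Imf /= ImM.
by rewrite ImM; apply: is_deriveD; exact: is_deriveZ.
Qed.

Lemma expzE (z : R[i]) (x : R) : expz z x =
  (expR (- (complex.Re z * x)) * cos (complex.Im z * x)) +i*
  (- (expR (- (complex.Re z * x)) * sin (complex.Im z * x))).
Proof.
rewrite /expz /cexp; apply: complex_ext; rewrite ?ReM ?ImM ReN ImN ReM ImM /= !mulr0 !mul0r
  ?subr0 ?add0r ?addr0 ?sinN ?cosN //.
by rewrite mulrN.
Qed.

Lemma has_cderiv_expz (z : R[i]) : has_cderiv (expz z) (fun x => - z * expz z x).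
Proof.
move=> x; set a := complex.Re z; set b := complex.Im z.
have lin (k : R) : is_derive x (1 : R) (fun y => k * y) k.
  have := @is_deriveZ R R R id k x 1 1 (is_derive_id x 1).
  by rewrite /GRing.scale /= mulr1.
have de : is_derive x (1 : R) (fun x => expR (- (a * x))) (- a * expR (- (a * x))).
  have -> : (fun x => expR (- (a * x))) = expR \o (fun x => - a * x).
    by apply/funext => y /=; rewrite mulNr.
  rewrite mulrC -mulNr; exact: is_derive1_comp (is_derive_expR _) (lin _).
have dc : is_derive x (1 : R) (fun x => cos (b * x)) (- sin (b * x) * b).
  exact: is_derive1_comp (is_derive_cos _) (lin _).
have ds : is_derive x (1 : R) (fun x => sin (b * x)) (cos (b * x) * b).
  exact: is_derive1_comp (is_derive_sin _) (lin _).
split.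
  have -> : Ref (expz z) = (fun x => expR (- (a * x))) * (fun x => cos (b * x)).
    by apply/funext => y; rewrite /Ref expzE.
  apply: (is_derive_eq (is_deriveM de dc)).
  rewrite expzE ReM ReN ImN /= -/a -/b /GRing.scale /=; ring.
have -> : Imf (expz z) = - ((fun x => expR (- (a * x))) * (fun x => sin (b * x))).
  by apply/funext => y; rewrite /Imf expzE.
apply: (is_derive_eq (is_deriveN (is_deriveM de ds))).
rewrite expzE ImM ReN ImN /= -/a -/b /GRing.scale /=; ring.
Qed.

(** The mean value theorem holds for each component but not for complex values; this is the factor
    2. *)
Lemma has_cderiv_lipschitz f g (K : R) : has_cderiv f g ->
  (forall x, 0 <= x -> cmodulus (g x) <= K) ->
  forall u v, 0 <= u -> u <= v -> cmodulus (f v - f u) <= 2 * K * (v - u).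
Proof.
move=> fg gK u v u0 uv.
have lip (h h' : R -> R) : (forall x, is_derive x (1 : R) h (h' x)) ->
    (forall x, 0 <= x -> `|h' x| <= K) -> `|h v - h u| <= K * (v - u).
  move=> hh hK; have [|c cuv ->] := @MVT_segment R h h' u v uv (fun x _ => hh x).
    by apply: derivable_within_continuous => x _; case: (hh x).
  rewrite normrM (ger0_norm (_ : 0 <= v - u)) ?subr_ge0//.
  rewrite ler_wpM2r ?subr_ge0// hK//; move: cuv; rewrite in_itv/= => /andP[uc _].
  exact: le_trans uc.
apply: le_trans (cmodulus_le_ReIm _) _; rewrite ReD ReN ImD ImN.
have := lip (Ref f) (fun x => complex.Re (g x)) (fun x => (fg x).1)
  (fun x x0 => le_trans (Re_le_cmodulus _) (gK x x0)).
have := lip (Imf f) (fun x => complex.Im (g x)) (fun x => (fg x).2)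
  (fun x x0 => le_trans (Im_le_cmodulus _) (gK x x0)).
rewrite /Ref /Imf; lra.
Qed.

Lemma has_cderiv_locally_AC f g (K : R) : has_cderiv f g ->
  (forall x, 0 <= x -> cmodulus (g x) <= K) -> locally_AC f.
Proof.
move=> fg gK b b0 e e0; have lip := has_cderiv_lipschitz fg gK.
have K0 : 0 <= K by apply: le_trans (gK 0 (lexx 0)); exact: cmodulus_ge0.
have K1 : 0 < 2 * K + 1 by lra.
exists (e / (2 * K + 1)); first by rewrite divr_gt0.
move=> n u v uv _; rewrite ltr_pdivlMr// => h; apply: le_lt_trans h.
rewrite mulr_suml; apply: ler_sum => i _; have [u0 uvi _] := uv i.
apply: le_trans (lip _ _ u0 uvi) _; rewrite mulrC ler_wpM2l ?subr_ge0//; lra.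
Qed.

End smooth_functions.

Section exponentials.
Context {R : realType}.
Variables (c d z w : R[i]).
Hypotheses (z0 : 0 < complex.Re z) (w0 : 0 < complex.Re w).

Let f x : R[i] := c * expz z x + d * expz w x.
Let g x : R[i] := c * (- z * expz z x) + d * (- w * expz w x).

Lemma le_cmodulus_expz (v : R[i]) (x : R) : 0 < complex.Re v -> 0 <= x -> cmodulus (expz v x) <= 1.
Proof.
by move=> v0 x0; rewrite cmodulus_expz -expR0 ler_expR oppr_le0 mulr_ge0// ltW.
Qed.

Lemma has_cderiv_expz_comb : has_cderiv f g.
Proof. by move=> x; apply: has_cderiv_atD; apply: has_cderiv_atZ; exact: has_cderiv_expz. Qed.

Lemma cderiv_expz_comb : cderiv f = g.
Proof. exact: has_cderivE has_cderiv_expz_comb. Qed.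

Lemma expz_comb_bounds : exists2 K : R, 0 <= K & forall x, 0 <= x ->
  cmodulus (g x) <= K.
Proof.
exists (cmodulus (c * z) + cmodulus (d * w)); first by rewrite addr_ge0 ?cmodulus_ge0.
move=> x x0; apply: le_trans (cmodulusD _ _) _.
have aux (k v : R[i]) : 0 < complex.Re v -> cmodulus (k * (- v * expz v x)) <= cmodulus (k * v).
  move=> v0; rewrite mulNr mulrN cmodulusN mulrA (cmodulusM (k * v)).
  by rewrite ler_piMr ?cmodulus_ge0// le_cmodulus_expz.
by rewrite lerD// aux.
Qed.

Lemma inL2_expz_comb : inL2 f.
Proof. by apply: inL2_comb; exact: inL2_expz. Qed.

Lemma inL2_cderiv_expz_comb : inL2 g.
Proof.
have -> : g = (fun x => (c * - z) * expz z x + (d * - w) * expz w x).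
  by apply/funext => x; rewrite /g !mulrA.
by apply: inL2_comb; exact: inL2_expz.
Qed.

Lemma dom_Astar_expz_comb : dom_Astar f.
Proof.
have [K _ hK] := expz_comb_bounds; split; first exact: has_cderiv_locally_AC
  has_cderiv_expz_comb hK.
  exact: inL2_expz_comb.
by rewrite cderiv_expz_comb; exact: inL2_cderiv_expz_comb.
Qed.

End exponentials.

Section Laplace_exponential.
Context {R : realType}.

Lemma expz0 (z : R[i]) : expz z 0 = 1.
Proof. by rewrite expzE !mulr0 oppr0 expR0 cos0 sin0 mulr1 mulr0 oppr0. Qed.

(** The rule for derivatives, applied to [expz z] at the real point 1, reads [- z L = L - 1]. *)
Lemma Laplace_expz (z : R[i]) : 0 < complex.Re z -> laplace (expz 1) z = (1 + z)^-1.
Proof.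
move=> z0; have l0 : 0 < complex.Re (1 : R[i]) by rewrite /= ltr01.
have E : (fun x => 1 * expz z x + 0 * expz 1 x) = expz z.
  by apply/funext => x; rewrite mul0r addr0 mul1r.
have [ac L2 L2'] := dom_Astar_expz_comb 1 0 z0 l0; rewrite E in ac L2 L2'.
have LX := cL1_inL2_expz l0 L2.
have := Laplace_cderiv ac L2 L2' ltr01; rewrite (has_cderivE (has_cderiv_expz z)).
rewrite (_ : 1%:C = 1)// mul1r expz0 laplaceE hlZ.
have -> : (fun x => - z * hl (expz z) x * expz 1 x) = (fun x : R => - z * (hl (expz z) x * expz
  1 x)).
  by apply/funext => x; exact/esym/mulrA.
rewrite (cintZ (- z) LX) -laplaceE => Ez.
have nz : 1 + z != 0.
  by apply/eqP => /(congr1 (@complex.Re R)); rewrite ReD /=; lra.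
(* Both are the integral of [e^{-(1 + z) x}]; the right-hand side only needs a real
   argument of the transform. *)
have -> : laplace (expz 1) z = laplace (expz z) 1.
  rewrite !laplaceE; congr cint; apply/funext => x; rewrite !hlE; case: ifP => _; last by
    rewrite !mul0r.
  by rewrite mulrC.
apply: (mulfI nz); rewrite mulfV// mulrDl mul1r.
by move: Ez; rewrite mulNr => Ez; apply/eqP; rewrite -subr_eq0 -[z * _]opprK Ez; apply/eqP; ring.
Qed.

End Laplace_exponential.

(** * The generator *)

Section generator_at_zero.
Context {R : realType}.
Local Notation mu := (@lebesgue_measure R).
Variables phi psi : R -> R[i].
Hypotheses (phi_loc : L1loc phi) (phi_L2 : finite_weighted_L2 phi).
Hypothesis psiP : is_psi phi psi.
Local Notation p := (hl phi).
Local Notation s := (hl psi).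

Let mp : cmeas p. Proof. exact: L1loc_cmeas_hl. Qed.
Let ms : cmeas s. Proof. by case: psiP => /L1loc_cmeas_hl. Qed.

Lemma sqr_lee (x : \bar R) (r : R) : 0 <= r -> (x ^+ 2 <= (r ^+ 2)%:E)%E -> (x <= r%:E)%E.
Proof.
move=> r0; case: x => [x| |] //=; rewrite -?EFin_expe ?lee_fin => h.
  have [x0|x0] := leP x 0; first exact: le_trans r0.
  by rewrite -(@ler_pXn2r _ 2)// nnegrE ltW.
Qed.

Lemma response_at0 (f g : R -> R[i]) (K : R) : 0 <= K -> cmeas f -> cmeas g -> inL2 f ->
  (forall x, 0 <= x -> cmodulus (f x - f 0) <= K * x) ->
  (forall x, 0 <= x -> cmodulus (g x) <= K) ->
  generator_graph (op_T phi psi) f (fun x => - g x) ->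
  forall e : R, 0 < e -> exists2 d : R, 0 < d & forall t, 0 < t -> t <= d ->
    (head_integral t (fun u => response p s (hl f) u - f 0)%R <= (e * t)%:E)%E.
Proof.
move=> K0 mf mg Lf fK gK /L2norm_cvg0/cvge0P => /(_ (fun t => sqint_ge0 _) 1 ltr01).
move=> [d0 /= d00 hd0] e e0.
have [mhf fi] := (inL2P f).1 Lf; set w := response p s (hl f).
have mw : cmeas w by exact: cmeas_response.
have K1 : 0 < 4 * (K + 1) by lra.
(* The first bound makes the difference quotient in [D] accurate to within 1 in square norm. The
   second gives [t^{3/2} <= (e / 2) t], and the third [2 K t <= e / 2]. *)
pose d := Num.min (d0 / 2) (Num.min ((e / 2) ^+ 2) (e / (4 * (K + 1)))).
have d_gt0 : 0 < d by rewrite !lt_min divr_gt0//= exprn_gt0 ?divr_gt0//.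
exists d => // t t0; rewrite !le_min => /and3P[td0 te1 te2].
have tball : ball (0 : R) d0 t.
  by rewrite /ball/= sub0r normrN gtr0_norm//; lra.
have := hd0 t tball t0; set D := (fun x => _) => hD.
(* [A u] is [t * D x] at [x = t - u]: on [x < t] the translated part of [op_T] vanishes and only the
   response remains. *)
pose A u := w u - f (t - u) + t%:C * g (t - u).
have mrefl : measurable_fun setT (fun u : R => t - u) by exact: measurable_funB.
have mA : cmeas A.
  apply: cmeasD; first by apply: cmeasB => //; exact: (cmeas_comp mrefl mf).
  by apply: (cmeasM (cmeas_cst _)); exact: (cmeas_comp mrefl mg).
have mb : measurable_fun setT (fun r : R => 0 < r < t).
  by apply: measurable_and; exact: measurable_fun_ltr.
pose B u := if 0 < u < t then A u else 0.
have mB : cmeas B by exact: (cmeas_if mb mA (cmeas_cst 0)).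
have mhD : cmeas (hl D).
  have -> : hl D = (fun x => (t^-1)%:C * (hl (op_T phi psi t f) x - hl f x) + hl g x).
    by apply/funext => x; rewrite /D !hlE; case: ifP => _; rewrite ?opprK// subrr mulr0 addr0.
  apply: cmeasD; last exact: cmeas_hl.
  apply: (cmeasM (cmeas_cst _)); apply: (cmeasB _ mhf).
  exact: (cmeas_op_T phi_loc psiP (ltW t0) Lf).
have sB : (sqint B <= (t ^+ 2)%:E)%E.
  have -> : sqint B = sqint (fun x => B (t - x)).
    by rewrite /sqint (ge0_integral_reflect t (measurable_sqmod mB))// => x; rewrite lee_fin
      sqr_ge0.
  apply: (@le_trans _ _ (sqint (fun x => t%:C * hl D x))).
    apply: le_sqint; [exact: (cmeas_comp mrefl mB)|exact: (cmeasM (cmeas_cst _) mhD)|].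
    move=> x; rewrite /B; case: ifP => [|_]; last by rewrite cmodulus0 cmodulus_ge0.
    rewrite subr_gt0 gtrBl => /andP[xt x0].
    rewrite hlE x0 /D /op_T /shift_op xt add0r (op_KE phi_loc psiP)// kop_op_kernel x0.
    rewrite -/w opprK mulrDr mulrA -rmorphM mulfV ?gt_eqF// mul1r /A.
    by have -> : t - (t - x) = x by ring.
  rewrite sqintZ// cmodulusC real_normK ?num_real//.
  by rewrite -[leRHS]mule1 lee_pmul2l// lte_fin exprn_gt0.
have hA : (head_integral t A <= (e / 2 * t)%:E)%E.
  apply: sqr_lee; first by rewrite mulr_ge0 ?divr_ge0 ?ltW.
  pose chi (u : R) : R[i] := if 0 < u < t then 1 else 0.
  have mchi : cmeas chi by exact: (cmeas_if mb (cmeas_cst 1) (cmeas_cst 0)).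
  have schi : sqint chi = t%:E.
    transitivity (head_integral t (fun=> 1)).
      apply: eq_integral => u _; rewrite /chi; case: ifP => _; last by rewrite cmodulus0 expr0n.
      by rewrite -(_ : 1%:C = 1 :> R[i])// cmodulusC normr1 expr1n.
    by rewrite head_integral_cst// -(_ : 1%:C = 1 :> R[i])// cmodulusC normr1 mul1r.
  have [_ CS] := Cauchy_Schwarz mchi mB (eq_ind_r (fun x => (x < +oo)%E) (ltry t) schi)
    (le_lt_trans sB (ltry _)).
  have -> : head_integral t A = (\int[mu]_x (cmodulus (chi x * B x)%R)%:E)%E.
    apply: eq_integral => u _; rewrite /chi /B; case: ifP => _; first by rewrite mul1r.
    by rewrite mul0r cmodulus0.
  apply: le_trans CS _; rewrite schi.
  apply: (@le_trans _ _ (t%:E * (t ^+ 2)%:E)%E); first by rewrite lee_pmul2l// lte_fin.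
  by rewrite -EFinM lee_fin exprMn ler_wpM2r ?sqr_ge0.
have Kt0 : 0 <= K * t by rewrite mulr_ge0// ltW.
have mwf : cmeas (fun u : R => w u - f 0) by exact: (cmeasB mw (cmeas_cst _)).
apply: (le_trans (le_head_integral3 mwf mA (cmeas_cst (K * t)%:C) (cmeas_cst (K * t)%:C) _)).
  apply: aeW => u /andP[u0 ut]; rewrite cmodulusC ger0_norm//.
  have -> : w u - f 0 = A u + (f (t - u) - f 0) - t%:C * g (t - u) by rewrite /A; ring.
  have tu0 : 0 <= t - u by rewrite subr_ge0 ltW.
  apply: le_trans (cmodulusD _ _) _; apply: lerD; last first.
    by rewrite cmodulusN cmodulusM cmodulusC gtr0_norm// mulrC ler_wpM2r ?gK// ltW.
  apply: le_trans (cmodulusD _ _) _; rewrite lerD2l; apply: le_trans (fK _ tu0) _.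
  by rewrite ler_wpM2l//; lra.
rewrite !head_integral_cst// cmodulusC ger0_norm//.
apply: (@le_trans _ _ ((e / 2 * t)%:E + (K * t * t)%:E + (K * t * t)%:E)%E); first by rewrite
  !leeD2r.
rewrite -!EFinD lee_fin.
have Kt : (K + 1) * t <= e / 4 by move: te2; rewrite ler_pdivlMr//; lra.
have -> : e * t = e / 2 * t + 2 * (e / 4) * t by field.
rewrite -addrA lerD2l -!mulrDl ler_wpM2r ?(ltW t0)//.
nra.
Qed.

(** For an exponential the forcing term is explicit: the substitution [x = u + y] makes it
    [e^{l u} \int_u^oo phi x e^{- l x} dx], which tends to the Laplace transform. *)
Lemma forcing_expz_at0 (l : R) : 0 < l -> forall e : R, 0 < e ->
  exists2 d : R, 0 < d & forall u, 0 < u -> u <= d ->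
  [/\ cL1 (fun y => hankel p (u, y) * hl (expz l%:C) y) &
     cmodulus (forcing p (hl (expz l%:C)) u - laplace phi l%:C) <= e].
Proof.
move=> l0 e e0; have Lp := cL1_phi_expz phi_loc phi_L2 l0.
set I := laplace phi l%:C.
(* With [x = e^{l u} <= 1 + e1 <= 2], the error [(x - 1) |I| + x |\int_0^u phi e^{- l y}|] is at
   most [e1 (|I| + 2)]. *)
pose e1 := Num.min 1 (e / (cmodulus I + 2)).
have k0 : 0 < cmodulus I + 2 by rewrite ltr_wpDl// cmodulus_ge0.
have e10 : 0 < e1 by rewrite lt_min ltr01 divr_gt0.
have e1k : e1 * (cmodulus I + 2) <= e by rewrite -ler_pdivlMr// ge_min lexx orbT.
have e11 : e1 <= 1 by rewrite ge_min lexx.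
have [d1 d10 h1] := head_integral_small Lp e10.
have [d2 d20 h2] : exists2 d : R, 0 < d & forall u, 0 < u -> u <= d -> expR (l * u) - 1 <= e1.
  have cexp : {for 0, continuous (fun u : R => expR (l * u))}.
    apply: continuous_comp; last exact: continuous_expR.
    exact: mulrl_continuous.
  move/cvgrPdist_le : cexp => /(_ e1 e10)[d /= d0 hd].
  exists (d / 2); first by rewrite divr_gt0.
  move=> u u0 ud; have := hd u; rewrite /ball/= sub0r normrN gtr0_norm// mulr0 expR0.
  by move=> /(_ _); rewrite distrC => h; apply: le_trans (ler_norm _) (h _); lra.
exists (Num.min d1 d2); first by rewrite lt_min d10.
move=> u u0; rewrite le_min => /andP[ud1 ud2].
pose T (y : R) : R[i] := if u < y then p y * expz l%:C y else 0.
pose Hd (y : R) : R[i] := if 0 < y < u then p y * expz l%:C y else 0.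
have mbT : measurable_fun setT (fun y : R => u < y) by exact: measurable_fun_ltr.
have mbH : measurable_fun setT (fun y : R => 0 < y < u).
  by apply: measurable_and; exact: measurable_fun_ltr.
have [mLp _] := Lp.
have LT : cL1 T.
  apply: (cL1_le (cmeas_if mbT mLp (cmeas_cst 0)) Lp) => y; rewrite /T.
  by case: ifP => // _; rewrite cmodulus0 cmodulus_ge0.
have LH : cL1 Hd.
  apply: (cL1_le (cmeas_if mbH mLp (cmeas_cst 0)) Lp) => y; rewrite /Hd.
  by case: ifP => // _; rewrite cmodulus0 cmodulus_ge0.
have IE : I = cint setT T + cint setT Hd.
  rewrite /I laplaceE; apply: etrans (cintD LT LH); apply: eq_ae_cint => //.
    by have [] := cL1D LT LH.
  apply: ae_imply (ae_neq u) => y yu; rewrite /T /Hd.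
  have [y0|y0] := leP y 0.
    by rewrite hl_le0// mul0r ltNge (le_trans y0 (ltW u0)) addr0.
  by case: (ltgtP y u) yu => // _ _; rewrite ?addr0 ?add0r.
have E : (fun y => hankel p (u, y) * hl (expz l%:C) y) = (fun y => (expR (l * u))%:C * T (y + u)).
  apply/funext => y; rewrite /hankel /= u0 (hlE (expz _)) /T -[u < y + u]subr_gt0 addrK.
  case: ifP => y0; last by rewrite mul0r mulr0.
  rewrite (addrC u y) expzD !expz_real mulrCA; congr (_ * _).
  by rewrite mulrCA -rmorphM -expRD subrr expR0 mulr1.
have LTs := cL1_shift u LT.
split; first by rewrite E; exact: cL1Z.
have -> : forcing p (hl (expz l%:C)) u = (expR (l * u))%:C * cint setT T.
  rewrite /forcing /kop E (cintZ _ LTs); congr (_ * _); apply: cint_shift.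
  by case: LT.
have -> : cint setT T = I - cint setT Hd by rewrite IE addrK.
have hH : cmodulus (cint setT Hd) <= e1.
  rewrite -lee_fin; apply: le_trans (le_cmodulus_cint LH) _; apply: le_trans (h1 u ud1).
  rewrite le_eqVlt; apply/orP; left; apply/eqP; apply: eq_integral => y _.
  by rewrite /Hd; case: ifP => // _; rewrite cmodulus0.
have hx := h2 u u0 ud2; have x1 : 1 <= expR (l * u) by rewrite -expR0 ler_expR mulr_ge0// ltW.
move: (expR (l * u)) hx x1 => x hx x1.
have -> : x%:C * (I - cint setT Hd) - I = (x - 1)%:C * I - x%:C * cint setT Hd.
  rewrite rmorphB; ring.
apply: le_trans (cmodulusD _ _) _; rewrite cmodulusN !cmodulusM !cmodulusC.
rewrite (ger0_norm (_ : 0 <= x - 1)) ?subr_ge0// (ger0_norm (le_trans ler01 x1)).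
apply: le_trans e1k; move: (cmodulus I) (cmodulus_ge0 I) => i i0.
move: (cmodulus _) hH (cmodulus_ge0 (cint setT Hd)) => y hy y0; nra.
Qed.

Lemma inL2_0 : inL2 (fun=> 0 : R[i]).
Proof.
apply/inL2P; have -> : hl (fun=> 0 : R[i]) = (fun=> 0).
  by apply/funext => x; rewrite hlE if_same.
split; first exact: cmeas_cst.
rewrite /sqint; under eq_integral do rewrite cmodulus0 expr0n.
by rewrite integral0 ltry.
Qed.

Lemma op_T_0 t : op_T phi psi t (fun=> 0) = (fun=> 0).
Proof.
apply/funext => x; rewrite /op_T /shift_op if_same add0r /op_K; case: ifP => // _.
rewrite -[RHS](@cint0 _ halfline); congr cint; apply/funext => y; exact: mulr0.
Qed.

Lemma L2norm_0 : L2norm (fun=> 0 : R[i]) = 0%E.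
Proof.
rewrite L2normE /sqint (eq_integral (fun=> 0%E)) ?integral0 ?sqrte0// => x _.
by rewrite hlE if_same cmodulus0 expr0n.
Qed.

(** The pair [(0, 0)] belongs to the graph of every generator, and membership in [graph_AM M]
    carries a function [r] with [M = transM r]. *)
Lemma graph_AM_function (M : R[i] -> R[i]) : is_generator (graph_AM M) (op_T phi psi) ->
  exists2 r, calO r & forall z : R[i], 0 < complex.Re z -> M z = transM r z.
Proof.
move=> /(_ _ _ inL2_0 inL2_0)[gen _].
have [|r [rO rM _]] := gen; last by exists r.
rewrite /generator_graph.
have -> : (fun t => L2norm (fun x : R => (t^-1)%:C * (op_T phi psi t (fun=> 0) x - 0) - 0)) =
  (fun=> 0%E).
  apply/funext => t; rewrite -L2norm_0; congr L2norm; apply/funext => x.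
  by rewrite op_T_0 subrr mulr0 subrr.
exact: cvg_cst.
Qed.

Lemma pairingE (f g : R -> R[i]) : pairing f g = cint setT (fun x => hl f x * hl g x).
Proof. by rewrite /pairing cint_cres -/(hl _) hlM. Qed.

Lemma pairing_expz_comb (c d z w : R[i]) (r : R -> R[i]) :
  0 < complex.Re z -> 0 < complex.Re w -> inL2 r ->
  pairing (fun x => c * expz z x + d * expz w x) r = c * laplace r z + d * laplace r w.
Proof.
move=> z0 w0 Lr; rewrite pairingE !laplaceE.
have Lz := cL1_inL2_expz z0 Lr; have Lw := cL1_inL2_expz w0 Lr.
rewrite -(cintZ c Lz) -(cintZ d Lw); apply: etrans (cintD (cL1Z c Lz) (cL1Z d Lw)).
congr cint; apply/funext => x; rewrite !hlE; case: ifP => _; last by rewrite !mul0r !mulr0 addr0.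
move: (expz z x) (expz w x) (r x) => ez ew rx; ring.
Qed.

(* The combination [f] of two exponentials is chosen in the domain of [A_M]; its
   membership in the domain of the generator then reads [f 0 = \int phi f]. *)
Lemma generator_relation (M : R[i] -> R[i]) (l l' : R) :
  is_generator (graph_AM M) (op_T phi psi) -> 0 < l -> 0 < l' ->
  M l'%:C * (1 - laplace phi l%:C) = M l%:C * (1 - laplace phi l'%:C).
Proof.
move=> gen l0 l'0; have [r rO rM] := graph_AM_function gen.
have [[acr Lr Lr'] _] := rO.
have z0 : 0 < complex.Re (l%:C : R[i]) by [].
have w0 : 0 < complex.Re (l'%:C : R[i]) by [].
set c := M l'%:C; set d := - M l%:C.
pose f (x : R) := c * expz l%:C x + d * expz l'%:C x.
pose g (x : R) := c * (- l%:C * expz l%:C x) + d * (- l'%:C * expz l'%:C x).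
have Ef : cderiv f = g by exact: cderiv_expz_comb.
have dom : dom_Astar f by exact: dom_Astar_expz_comb.
have Lf : inL2 f by exact: inL2_expz_comb.
have Lg : inL2 g by exact: inL2_cderiv_expz_comb.
have Lng : inL2 (fun x => - g x).
  have -> : (fun x => - g x) = (fun x => -1 * g x + 0 * g x).
    by apply/funext => x; rewrite mul0r addr0 mulN1r.
  exact: inL2_comb.
have gA : graph_AM M f (fun x => - g x).
  exists r; split => //; exists f; split; last 2 first.
  - by apply/eqaeP; exact: aeW.
  - by rewrite Ef; apply/eqaeP; exact: aeW.
  split => //; rewrite Ef.
  have -> : g = (fun x => (c * - l%:C) * expz l%:C x + (d * - l'%:C) * expz l'%:C x).
    by apply/funext => x; rewrite /g !mulrA.
  rewrite !pairing_expz_comb// !Laplace_cderiv//.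
  have := rM _ z0; have := rM _ w0; rewrite /transM -/c => Ec Ed.
  have {}Ed : d = - ((1 - l%:C ^+ 2) * laplace r l%:C + r 0 * l%:C) by rewrite /d Ed.
  rewrite Ed Ec; ring.
have /(gen _ _ Lf Lng) gg := gA.
have [K K0 hK] := expz_comb_bounds c d z0 w0.
have lip := has_cderiv_lipschitz (has_cderiv_expz_comb c d l%:C l'%:C) hK.
have mf : cmeas f.
  by apply: cmeasD; apply: (cmeasM (cmeas_cst _)); exact: cmeas_expz.
have mg : cmeas g.
  by apply: cmeasD; apply: (cmeasM (cmeas_cst _)); apply: (cmeasM (cmeas_cst _)); exact: cmeas_expz.
have K20 : 0 <= 2 * K by lra.
have fK x : 0 <= x -> cmodulus (f x - f 0) <= 2 * K * x.
  by move=> x0; have := lip 0 x (lexx 0) x0; rewrite subr0.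
have gK x : 0 <= x -> cmodulus (g x) <= 2 * K by move=> x0; apply: le_trans (hK x x0) _; lra.
have hw := response_at0 K20 mf mg Lf fK gK gg.
have [mhf fi] := (inL2P f).1 Lf.
have [a a0 [Ls ps]] := psi_laplace psiP.
have hl0 (k : R -> R[i]) x : x <= 0 -> hl k x = 0 by exact: hl_le0.
have E0 : f 0 = c * laplace phi l%:C + d * laplace phi l'%:C.
  apply: (response_forcing_at0 (hl0 phi) (hl0 psi) mp ms a0 (cL1_phi_expz phi_loc phi_L2 a0) Ls
    (weighted_L2_hl phi_L2) ps mhf fi hw) => e e0.
  pose k := cmodulus c + cmodulus d + 1.
  have k0 : 0 < k by rewrite /k ltr_wpDl// addr_ge0 ?cmodulus_ge0.
  have e'0 : 0 < e / k by rewrite divr_gt0.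
  have [d1 d10 h1] := forcing_expz_at0 l0 e'0; have [d2 d20 h2] := forcing_expz_at0 l'0 e'0.
  exists (Num.min d1 d2); first by rewrite lt_min d10.
  move=> u u0; rewrite le_min => /andP[ud1 ud2].
  have [L1 H1] := h1 u u0 ud1; have [L2 H2] := h2 u u0 ud2.
  have -> : forcing p (hl f) u = c * forcing p (hl (expz l%:C)) u + d * forcing p (hl (expz
    l'%:C)) u.
    rewrite /forcing /kop -(cintZ c L1) -(cintZ d L2).
    apply: etrans (cintD (cL1Z c L1) (cL1Z d L2)); congr cint; apply/funext => y.
    rewrite /f hlD !hlZ; ring.
  have -> : c * forcing p (hl (expz l%:C)) u + d * forcing p (hl (expz l'%:C)) u -
     (c * laplace phi l%:C + d * laplace phi l'%:C) =
     c * (forcing p (hl (expz l%:C)) u - laplace phi l%:C) +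
     d * (forcing p (hl (expz l'%:C)) u - laplace phi l'%:C) by ring.
  apply: le_trans (cmodulusD _ _) _; rewrite !cmodulusM.
  have -> : e = (cmodulus c + cmodulus d + 1) * (e / k) by rewrite -/k; field; rewrite gt_eqF.
  rewrite !mulrDl mul1r; apply: ler_wpDr; first exact: ltW.
  by apply: lerD; rewrite ler_wpM2l ?cmodulus_ge0.
move: E0; rewrite /f !expz0 !mulr1 => E0.
apply/eqP; rewrite -subr_eq0; apply/eqP.
have -> : M l%:C = - d by rewrite /d opprK.
rewrite mulNr opprK !mulrBr !mulr1 addrACA E0; ring.
Qed.

(** * The explicit formula for [q], with a constant [c] in place of [q(0)] *)

Definition profile (c : R[i]) (x : R) : R[i] :=
  c * ((expR (- x))%:C - cint `[0, x] (fun r => phi r * (expR (r - x))%:C)).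

Lemma cL1_phi (y : R) : cL1 (cres `[0, y]%classic phi).
Proof.
have [_ /(_ `[0, y]%classic (@segment_compact _ 0 y))] := phi_loc.
have sub : `[0, y]%classic `<=` (`[0, +oo[%classic : set R).
  by move=> x /=; rewrite !in_itv/= andbT => /andP[].
by move=> /(_ sub) /(cintegrable_cres _ (measurable_itv _)).
Qed.

Lemma hl_profile c : hl (profile c) =
  (fun x => c * (hl (expz 1) x - conv (hl (expz 1)) p x)).
Proof.
apply/funext => x; have [x0|x0] := leP x 0.
  by rewrite !hl_le0// (conv_le0 (@hl_le0 _ (expz 1)) (@hl_le0 _ phi) x0) subrr mulr0.
rewrite hlE x0 (hlE (expz 1)) x0 /profile expz_real mul1r; congr (_ * (_ - _)).
rewrite cint_cres /conv; apply: eq_ae_cint.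
- have -> : cres `[0, x]%classic (fun r => phi r * (expR (r - x))%:C) =
      (fun r : R => cres `[0, x]%classic phi r * (expR (r - x))%:C).
    by apply/funext => r; rewrite /cres; case: ifP => // _; rewrite mul0r.
  apply: cmeasM; first by case: (cL1_phi x).
  apply: cmeas_real; apply: measurableT_comp => //; exact: measurable_funB.
- apply: (cmeasM _ mp); apply: (cmeas_comp _ (cmeas_hl_expz 1)); exact: measurable_funB.
apply: ae_imply2 (ae_neq 0) (ae_neq x) => r r0 rx.
rewrite /cres mem_setE in_itv/= !hlE subr_gt0 expz_real mul1r opprB.
case: (ltgtP r 0) r0 => // r0 _; first by rewrite mulr0.
by case: (ltgtP r x) rx => //= rx _; rewrite ?mul0r// mulrC.
Qed.

Let one_gt0 : 0 < complex.Re (1 : R[i]). Proof. by rewrite /= ltr01. Qed.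

Lemma cL1_phi_expzC (z : R[i]) : 0 < complex.Re z -> cL1 (fun x => p x * expz z x).
Proof. by move=> z0; exact: cL1_hl_expz (lexx _) (cL1_phi_expz phi_loc phi_L2 z0). Qed.

Lemma Laplace_profile c (z : R[i]) : 0 < complex.Re z ->
  cL1 (fun x => hl (profile c) x * expz z x) /\
  laplace (profile c) z = c * (1 - laplace phi z) / (1 + z).
Proof.
move=> z0; have Lp := cL1_phi_expzC z0.
have LE := cL1_inL2_expz z0 (inL2_expz one_gt0).
have LC := cL1_conv (cmeas_hl_expz 1) mp LE Lp.
have E : (fun x => hl (profile c) x * expz z x) = (fun x : R => c * (hl (expz 1) x * expz z x -
    conv (hl (expz 1)) p x * expz z x)).
  by apply/funext => x; rewrite hl_profile -mulrA mulrBl.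
split; first by rewrite E; exact: (cL1Z c (cL1B LE LC)).
rewrite [LHS]laplaceE E (cintZ c (cL1B LE LC)) (cintB LE LC).
rewrite (Laplace_conv (cmeas_hl_expz 1) mp LE Lp) -!laplaceE Laplace_expz//.
rewrite -mulrA; congr (_ * _); rewrite mulrBl mul1r; congr (_ - _); exact: mulrC.
Qed.

Lemma eqae_laplace (f g : R -> R[i]) z : cmeas (hl f) -> cmeas (hl g) -> eqae f g ->
  laplace f z = laplace g z.
Proof.
move=> mf mg /eqaeP fg; rewrite !laplaceE; apply: eq_ae_cint.
- exact: (cmeasM mf (cmeas_expz z)).
- exact: (cmeasM mg (cmeas_expz z)).
by apply: ae_imply fg => x ->.
Qed.

Lemma cmeas_hl_profile c : cmeas (hl (profile c)).
Proof.
rewrite hl_profile; apply: (cmeasM (cmeas_cst c)); apply: (cmeasB (cmeas_hl_expz 1)).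
exact: (cmeas_conv (cmeas_hl_expz 1) mp).
Qed.

Lemma profile_generator (M : R[i] -> R[i]) (q : R -> R[i]) :
  is_generator (graph_AM M) (op_T phi psi) -> inL2 q -> ~ ae_in dom_A q ->
  (forall z : R[i], 0 < complex.Re z -> (1 + z) * laplace q z = M z) ->
  exists c, [/\ c != 0, eqae (profile c) q &
    forall z : R[i], 0 < complex.Re z -> M z = c * (1 - laplace phi z)].
Proof.
move=> gen Lq nq qM; have [a a0 [_ ps]] := psi_laplace psiP.
have [pa _] := ps a (lexx a).
have na : 1 - laplace phi a%:C != 0 by rewrite laplaceE.
have [mq qi] := (inL2P q).1 Lq.
have nz (z : R[i]) : 0 < complex.Re z -> 1 + z != 0.
  by move=> z0; apply/eqP => /(congr1 (@complex.Re R)); rewrite ReD /=; lra.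
(* At the abscissa [a] of [psi] the denominator is nonzero by the definition of [psi]. *)
pose c := M a%:C / (1 - laplace phi a%:C).
have Ml (l : R) : 0 < l -> M l%:C = c * (1 - laplace phi l%:C).
  move=> l0; apply: (mulIf na); apply: (etrans (generator_relation gen a0 l0)).
  by rewrite /c; field.
have aeq : eqae (profile c) q.
  have aC : 0 < complex.Re (a%:C : R[i]) by [].
  have [LP _] := Laplace_profile c aC.
  have Lqa := cL1_inL2_expz aC Lq.
  apply/eqaeP; pose D x := profile c x - q x.
  have ED : (fun x => hl D x * expz a%:C x) = (fun x : R => hl (profile c) x * expz a%:C x - hl
    q x * expz a%:C x).
    by apply/funext => x; rewrite /D hlD hlN mulrDl mulNr.
  have D0 : {ae mu, forall x, hl D x = 0}.
    apply: (@Laplace_injective _ D a) => [|l al]; first by rewrite ED; exact: (cL1B LP Lqa).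
    have l0 : 0 < l by exact: lt_le_trans al.
    have lC : 0 < complex.Re (l%:C : R[i]) by [].
    have [LPl EP] := Laplace_profile c lC.
    have Lql := cL1_inL2_expz lC Lq.
    have -> : laplace D l%:C = laplace (profile c) l%:C - laplace q l%:C.
      rewrite !laplaceE; apply: etrans (cintB LPl Lql); congr cint; apply/funext => x.
      by rewrite /D hlD hlN mulrDl mulNr.
    by rewrite EP -Ml// -qM// mulrAC mulfV ?nz// mul1r subrr.
  apply: ae_imply D0 => x.
  by rewrite /D hlD hlN => /eqP; rewrite subr_eq0 => /eqP.
(* Real arguments have already identified [q] with [profile c]; transforming this function at a
   complex [z] gives the formula on the half-plane. *)
have ML z : 0 < complex.Re z -> M z = c * (1 - laplace phi z).
  move=> z0; rewrite -qM// -(eqae_laplace z (cmeas_hl_profile c) mq aeq).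
  have [_ ->] := Laplace_profile c z0.
  by field; exact: nz.
exists c; split => //; apply/eqP => c0; apply: nq.
(* If [c = 0] then [q] vanishes almost everywhere; the zero function, written as a trivial
   combination of exponentials, would represent it in the domain of [A]. *)
exists (fun x => 0 * expz 1 x + 0 * expz 1 x).
  by split; [exact: dom_Astar_expz_comb|rewrite !mul0r addr0].
apply/eqaeP; move/eqaeP : aeq; apply: ae_imply => x <-.
by rewrite !hlE; case: ifP => // _; rewrite /profile c0 !mul0r addr0.
Qed.

Lemma profile0 c : profile c 0 = c.
Proof.
rewrite /profile; set C := cint _ _.
have -> : C = 0; last by rewrite oppr0 expR0 subr0 mulr1.
rewrite /C cint_cres -[RHS](@cint0 _ setT); apply: eq_ae_cint; [|exact: cmeas_cst|].
- have -> : cres `[0, 0]%classic (fun r => phi r * (expR (r - 0))%:C) =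
      (fun r : R => cres `[0, 0]%classic phi r * (expR (r - 0))%:C).
    by apply/funext => r; rewrite /cres; case: ifP => // _; rewrite mul0r.
  apply: cmeasM; first by case: (cL1_phi 0).
  apply: cmeas_real; apply: measurableT_comp => //; exact: measurable_funB.
apply: ae_imply (ae_neq 0) => r; rewrite /cres mem_setE in_itv/=.
by case: (ltgtP r 0).
Qed.

(* The integrals start at [-1], so that [0] is an interior point. *)
Let G (r : R) : R[i] := cres `[0, +oo[%classic phi r * (expR r)%:C.

Let mG : cmeas G.
Proof.
apply: cmeasM; first exact: L1loc_cmeas.
by apply: cmeas_real.
Qed.

Let cL1_G (y : R) : cL1 (cres `[-1, y]%classic G).
Proof.
apply: (cL1_le _ (cL1Z (expR y)%:C (cL1_phi y))).
  by apply/(cmeasurable_cres _ (measurable_itv _)); case: mG => h1 h2; split;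
    apply: measurable_funTS.
move=> r; rewrite /G /cres !mem_setE !in_itv/= andbT.
case: ifP => [/andP[_ ry]|_]; last by rewrite cmodulus0 cmodulus_ge0.
case: ifP => r0 /=; last by rewrite mul0r cmodulus0 cmodulus_ge0.
by rewrite ry !cmodulusM !cmodulus_exp mulrC ler_wpM2r ?cmodulus_ge0// ler_expR.
Qed.

Let J x : R[i] := cint `[-1, x] G.

Lemma profileE c x : profile c x = c * ((expR (- x))%:C * (1 - J x)).
Proof.
rewrite /profile (mulrBr (expR (- x))%:C) mulr1; congr (_ * (_ - _)).
rewrite /J (cint_cres `[0, x]) (cint_cres `[-1, x]) -(cintZ _ (cL1_G x)); congr cint;
  apply/funext => r.
rewrite /cres /G /cres !mem_setE !in_itv/= andbT.
have [r0|r0] := leP 0 r; last by rewrite mul0r if_same mulr0.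
have -> : -1 <= r by lra.
case: (r <= x) => //=; last by rewrite mulr0.
by rewrite expRD rmorphM; ring.
Qed.

Let iG (y : R) : mu.-integrable `[-1, y]%classic (EFin \o Ref G) /\
  mu.-integrable `[-1, y]%classic (EFin \o Imf G).
Proof. exact/(cintegrable_cres _ (measurable_itv _)). Qed.

Let J_continuous x : 0 <= x ->
  {for x, continuous (Ref J)} /\ {for x, continuous (Imf J)}.
Proof.
move=> x0; have ab : -1 < x + 1 by lra.
have xin : x \in `]-1, (x + 1)[ by rewrite in_itv/=; apply/andP; split; lra.
have [iR iI] := iG (x + 1).
split; apply: (within_continuous_continuous ab _ xin).
  exact: (parameterized_integral_continuous (ltW ab) iR).
exact: (parameterized_integral_continuous (ltW ab) iI).
Qed.

Let loc_G (h : R[i] -> R) : measurable_fun setT (h \o G) -> (forall z, `|h z| <= cmodulus z) ->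
  locally_integrable [set: R] (h \o G).
Proof.
move=> mh hle; split => //; first exact: openT.
move=> K _ cK; have [B [_ hB]] := compact_bounded cK.
have mK : measurable K by exact: compact_measurable.
have [_] := cL1_G (B + 1); apply: le_lt_trans; rewrite integral_mkcond.
apply: ge0_le_integral => //.
- by move=> r _; rewrite patchE; case: ifP.
- apply/(measurable_restrictT _ mK); apply: measurable_funTS.
  by apply/measurable_EFinP; exact: measurableT_comp.
- by apply/measurable_EFinP; apply: measurable_cmodulus; case: (cL1_G (B + 1)).
move=> r _; rewrite patchE; case: ifP => [/set_mem Kr|_]; last by rewrite lee_fin cmodulus_ge0.
rewrite lee_fin; apply: le_trans (hle _) _.
have rB : r <= B + 1 by apply: le_trans (ler_norm _) (hB _ _ r Kr); rewrite ltrDl.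
rewrite /cres mem_setE in_itv/= rB andbT; case: ifP => // r1.
rewrite /G /cres mem_setE in_itv/= andbT.
have -> : (0 <= r) = false by apply/negP => r0; move/negP: r1; apply; lra.
by rewrite mul0r.
Qed.

Let J_derivable : {ae mu, forall x, 0 < x -> has_cderiv_at J x (G x)}.
Proof.
have [mR mI] := mG.
have lR := @loc_G (@complex.Re R) mR (@Re_le_cmodulus R).
have lI := @loc_G (@complex.Im R) mI (@Im_le_cmodulus R).
have hR := @FTC1 R (Ref G) (BLeft (-1)) (fun y => (iG y).1) lR.
have hI := @FTC1 R (Imf G) (BLeft (-1)) (fun y => (iG y).2) lI.
apply: ae_imply2 hR hI => x hR hI x0.
have x1 : ((-1)%:E < x%:E)%E by rewrite lte_fin; lra.
have [dR eR] := hR x1; have [dI eI] := hI x1.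
have eR' : 'D_1 (Ref J) x = Ref G x by rewrite -derive1E; exact: eR.
have eI' : 'D_1 (Imf J) x = Imf G x by rewrite -derive1E; exact: eI.
by split; [exact: (DeriveDef dR eR')|exact: (DeriveDef dI eI')].
Qed.

Lemma ccontinuous_at (f : R -> R[i]) x :
  {for x, continuous (Ref f)} -> {for x, continuous (Imf f)} ->
  {for x, continuous (f : R -> R[i]^o)}.
Proof.
move=> cR cI; apply/(@cvgrPdist_le _ (R[i]^o)) => e e0.
(* In the order on complex numbers a positive [e] is real, so the estimate reduces to real
   tolerances. *)
have /andP[/eqP im0 rpos] : (complex.Im e == 0) && (0 < complex.Re e).
  by move: e0; rewrite ltcE.
have ee : e = (complex.Re e)%:C by apply: complex_ext.
have re0 : 0 < complex.Re e / 2 by rewrite divr_gt0.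
move/cvgrPdist_le : cR => /(_ _ re0) cR; move/cvgrPdist_le : cI => /(_ _ re0) cI.
near=> y.
have hR : `|Ref f x - Ref f y| <= complex.Re e / 2 by near: y.
have hI : `|Imf f x - Imf f y| <= complex.Re e / 2 by near: y.
rewrite ee.
have -> : `|f x - f y : R[i]^o| = (cmodulus (f x - f y))%:C by [].
rewrite lecR; apply: le_trans (cmodulus_le_ReIm _) _; rewrite ReD ReN ImD ImN.
by rewrite [leRHS]splitr lerD.
Unshelve. all: by end_near.
Qed.

Let H x : R[i] := (expR (- x))%:C * (1 - J x).

Let RefH : Ref H = (fun x => expR (- x)) * (cst 1 - Ref J).
Proof. by apply/funext => x; rewrite /Ref /H ReM ReD ReN /= mul0r subr0. Qed.

Let ImfH : Imf H = - ((fun x => expR (- x)) * Imf J).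
Proof. by apply/funext => x; rewrite /Imf /H ImM ImD ImN /= mul0r addr0 sub0r mulrN. Qed.

Lemma profile_continuous c : {within `[0, +oo[%classic, continuous (profile c : R -> R[i]^o)}.
Proof.
apply: continuous_in_subspaceT => x; rewrite inE /= in_itv/= andbT => x0.
have [cR cI] := J_continuous x0.
have ce : {for x, continuous (fun x : R => expR (- x))}.
  by apply: continuous_comp; [exact: opp_continuous|exact: continuous_expR].
have c1 : {for x, continuous (cst 1 : R -> R)} by exact: cst_continuous.
have cRH : {for x, continuous (Ref H)}.
  by rewrite RefH; apply: continuousM => //; exact: continuousB.
have cIH : {for x, continuous (Imf H)}.
  by rewrite ImfH; apply: continuousN; exact: continuousM.
have -> : profile c = (fun x => c * H x) by apply/funext => y; rewrite profileE.
have ck (k : R) (h : R -> R) : {for x, continuous h} -> {for x, continuous (k \*: h)}.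
  by move=> ch; apply: continuousZ => //; exact: cst_continuous.
apply: ccontinuous_at.
  have -> : Ref (fun x => c * H x) = complex.Re c \*: Ref H - complex.Im c \*: Imf H.
    by apply/funext => y; rewrite /Ref /= ReM.
  by apply: continuousB; exact: ck.
have -> : Imf (fun x => c * H x) = complex.Re c \*: Imf H + complex.Im c \*: Ref H.
  by apply/funext => y; rewrite /Imf /= ImM.
by apply: continuousD; exact: ck.
Qed.

Lemma profile_derivable c : {ae mu, forall x, halfline x ->
  cderivable (profile c) x /\ cderiv (profile c) x = - profile c x - c * phi x}.
Proof.
apply: ae_imply J_derivable => x dJ; rewrite /halfline /= in_itv/= andbT => x0.
have [dR dI] := dJ x0.
have de : is_derive x (1 : R) (fun x => expR (- x)) (- expR (- x)).
  have dN : is_derive x (1 : R) (fun y : R => - y) (- 1) by exact: (is_deriveN (is_derive_id x 1)).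
  have := is_derive1_comp (is_derive_expR (- x)) dN.
  by rewrite mulrN1.
have dH : has_cderiv_at H x (- H x - phi x).
  have EG : G x = phi x * (expR x)%:C.
    by rewrite /G /cres mem_setE in_itv/= andbT ltW.
  have ex : expR (- x) * expR x = 1 by rewrite -expRD addNr expR0.
  split.
    have d1J : is_derive x (1 : R) (cst 1 - Ref J) (0 - complex.Re (G x)).
      by apply: is_deriveB; exact: is_derive_cst.
    have dM := is_deriveM de d1J.
    rewrite RefH; apply: (is_derive_eq dM).
    have -> : (cst 1 - Ref J) x = 1 - complex.Re (J x) by [].
    rewrite EG /H; move: (J x) => j.
    rewrite ReD ReN ReN !ReM ReD ReN /GRing.scale /= !mulr0 !mul0r !subr0.
    rewrite sub0r mulrN mulrCA ex mulr1; ring.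
  have dM := is_deriveN (is_deriveM de dI).
  rewrite ImfH; apply: (is_derive_eq dM).
  have -> : Imf J x = complex.Im (J x) by [].
  rewrite EG /H; move: (J x) => j.
  rewrite ImD ImN ImN !ImM ImD ImN /GRing.scale /= !mulr0 !mul0r.
  rewrite !add0r !addr0 mulrCA ex mulr1; ring.
have EP : profile c = (fun x => c * H x) by apply/funext => y; rewrite profileE.
have [d1 d2] := has_cderiv_atE (has_cderiv_atZ c dH).
by rewrite EP; split => //; rewrite d2 mulrBr mulrN.
Qed.

End generator_at_zero.

Theorem theorem5p3 (R : realType) (phi psi : R -> R[i])
  (hphi_loc : L1loc phi) (hphi_L2 : finite_weighted_L2 phi)
  (hpsi : is_psi phi psi) :
  [/\ C0_semigroup (op_T phi psi),
      left_inverse_of_shift (op_T phi psi)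
    & HS_perturbation_of_shift (op_T phi psi)] /\
  forall (M : R[i] -> R[i]) (q : R -> R[i]),
    HD2 M -> is_generator (graph_AM M) (op_T phi psi) ->
    inL2 q -> ~ ae_in dom_A q ->
    (forall z : R[i], 0 < complex.Re z -> (1 + z) * laplace q z = M z) ->
    (* q0 is the continuous representative of q *)
    exists q0 : R -> R[i],
      [/\ eqae q0 q,
          {within `[0, +oo[, continuous (q0 : R -> R[i]^o)},
          q0 0 != 0 &
      [/\ forall z : R[i], 0 < complex.Re z ->
            M z = q0 0 * (1 - laplace phi z),
          forall x : R, 0 <= x ->
            q0 x = q0 0 * ((expR (- x))%:C
                     - cint `[0, x] (fun s => phi s * (expR (s - x))%:C))
        & {ae @lebesgue_measure R, forall x : R, halfline x ->
             cderivable q0 x /\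
             phi x = - ((q0 x + cderiv q0 x) / q0 0)}]].
Proof.
split.
  split; [exact: C0_semigroup_op_T|exact: left_inverse_op_T|exact: HS_perturbation_op_T].
move=> M q _ gen Lq nq qM.
have [c [c0 cq cM]] := profile_generator hphi_loc hphi_L2 hpsi gen Lq nq qM.
exists (profile phi c); rewrite (profile0 hphi_loc c); split => //.
  exact: profile_continuous.
split => //.
have := profile_derivable hphi_loc c; apply: ae_imply => x h xh.
have [dx E] := h xh; split => //; rewrite E.
by rewrite addrA addrN sub0r mulNr opprK mulrAC mulfV ?mul1r.
Qed.
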